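(* Let $B > 0$ and let $S \subseteq \mathbb{R}^2$ be $(\ell,\rho)$-thick. Then there are $C_1, C_2, C_3, C_4 > 0$ such that for all $E > 0$ we have $$\lVert f \rVert_{L^2(\mathbb{R}^2)}^2 \leq \left( \frac{C_1}{\rho} \right)^{C_2 + C_3 \lvert \ell \rvert_1 \sqrt{E} + C_4 (\lvert \ell \rvert_1^2 B)} \lVert f \rVert_{L^2(S)}^2 \quad \text{for all } f \in \operatorname{Ran} \mathbf{1}_{(-\infty,E]}(H_B).$$
   Context: For $B>0$ the Landau operator is $H_B = \tilde\partial_1^2 + \tilde\partial_2^2$ with magnetic derivatives $\tilde\partial_1 = i\partial_1 - \frac{B}{2}x_2$, $\tilde\partial_2 = i\partial_2 + \frac{B}{2}x_1$; it is a self-adjoint operator in $L^2(\mathbb{R}^2)$ with operator core $C_0^\infty(\mathbb{R}^2)$ and spectrum $\{B,3B,5B,\dots\}$. $\mathbf{1}_{(-\infty,E]}(H_B)$ is its spectral projector onto energies up to $E$, and $\operatorname{Ran}$ denotes the range. For $\ell=(\ell_1,\ell_2)\in(0,\infty)^2$, $\lvert \ell\rvert_1 = \ell_1+\ell_2$. A measurable set $S \subseteq \mathbb{R}^2$ is $(\ell,\rho)$-thick (with $\ell\in(0,\infty)^2$, $\rho\in(0,1]$) if $\operatorname{Vol}(S\cap Q) \ge \rho \operatorname{Vol}(Q)$ for every rectangle $Q$ with side lengths $(\ell_1,\ell_2)$ parallel to the coordinate axes, where $\operatorname{Vol}$ is Lebesgue measure. *)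

(* Defs.v *)
From HB Require Import structures.
From mathcomp Require Import all_boot all_order all_algebra.
From mathcomp Require Import all_classical all_reals all_analysis.
From mathcomp Require Export complex.

Set Implicit Arguments.
Unset Strict Implicit.
Unset Printing Implicit Defensive.
Import Order.TTheory GRing.Theory Num.Theory.
Import numFieldNormedType.Exports.

Local Open Scope classical_set_scope.
Local Open Scope complex_scope.
Local Open Scope ring_scope.

Local Notation Re := complex.Re.
Local Notation Im := complex.Im.

(* R^2 is the product type R * R.  MathComp-Analysis equips it with the Borel
   sigma-algebra; completing the product measure gives the Lebesgue measure on
   the sigma-algebra of all Lebesgue-measurable subsets of the plane.  [plane R]
   is convertible to R * R and only carries this larger sigma-algebra. *)
Definition borel_leb2 (R : realType) :
    {measure set (measurableTypeR R * measurableTypeR R)%type -> \bar R} :=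
  (@lebesgue_measure R \x @lebesgue_measure R)%E.

Definition plane (R : realType) := caratheodory_type ((borel_leb2 R)^*)%mu.

Definition leb2 (R : realType) : {measure set (plane R) -> \bar R} :=
  @completed_measure_extension _ _ _ (borel_leb2 R).

Section L2.
Variable R : realType.
Local Notation C := R[i].
Local Notation fct := (plane R -> C).
Implicit Types (f g : fct) (T : fct -> fct).

(* The squared norm of f in L^2(D). *)
Definition L2sqnorm (D : set (plane R)) f : \bar R :=
  (\int[leb2 R]_(x in D) (Normc.normc (f x) ^+ 2)%:E)%E.

(* L^2(R^2; C), as a set of representatives: elements of the Hilbert space are
   compared with [_ = _ %[ae leb2 R]]. *)
Definition L2 : set fct :=
  [set f | [/\ measurable_fun setT (fun x => Re (f x)),
               measurable_fun setT (fun x => Im (f x)) &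
               (L2sqnorm setT f < +oo)%E]].

(* Conjugate-linear in the first argument. *)
Definition inner f g : C :=
  Complex (\int[leb2 R]_x Re ((f x)^* * g x))
          (\int[leb2 R]_x Im ((f x)^* * g x)).

Definition orthogonal_projection T : Prop :=
  [/\ (forall f, L2 f -> L2 (T f)) /\
      (forall f g, L2 f -> L2 g -> f = g %[ae leb2 R] ->
         T f = T g %[ae leb2 R]),
      forall (c : C) f g, L2 f -> L2 g ->
        T (fun x => c * f x + g x) = (fun x => c * T f x + T g x)
          %[ae leb2 R],
      forall f, L2 f -> T (T f) = T f %[ae leb2 R] &
      forall f g, L2 f -> L2 g -> inner (T f) g = inner f (T g)].

(* An unbounded operator H in L^2(R^2) is given by its graph, [H f g] meaning
   that f is in the domain of H and H f = g.  [spectral_measure_of H P] says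
   that P is the projection-valued measure of the self-adjoint operator H, that
   is H = \int x dP(x): with mu_f(A) = <f, P(A) f> = ||P(A) f||^2, the domain of
   H is {f | \int x^2 dmu_f(x) < +oo} and <f, H f> = \int x dmu_f(x) there.  By
   polarization these two conditions determine H from P; by the spectral theorem
   P exists and is unique (up to a.e. equality) when H is self-adjoint.  Countable
   additivity of P is the requirement that each mu_f be a measure. *)
Definition spectral_measure_of (H : fct -> fct -> Prop)
    (P : set R -> fct -> fct) : Prop :=
  [/\ forall A : set (measurableTypeR R), measurable A -> orthogonal_projection (P A),
      forall f, L2 f -> P setT f = f %[ae leb2 R],
      forall A A' : set (measurableTypeR R), measurable A -> measurable A' ->
        forall f, L2 f -> P (A `&` A') f = P A (P A' f) %[ae leb2 R] &
      forall f, L2 f ->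
        exists mu : {measure set (measurableTypeR R) -> \bar R},
          [/\ forall A : set (measurableTypeR R), measurable A -> mu A = L2sqnorm setT (P A f),
              (exists g, H f g) <-> (\int[mu]_x (x ^+ 2)%:E < +oo)%E &
              forall g, H f g -> inner f g = (\int[mu]_x x)%:C]].

(* The range of the spectral projector 1_A(H). *)
Definition spectral_range (H : fct -> fct -> Prop) (A : set (measurableTypeR R)) : set fct :=
  [set f | L2 f /\ exists2 P, spectral_measure_of H P &
             exists2 g, L2 g & f = P A g %[ae leb2 R]].

End L2.

Section Landau.
Variable R : realType.
Local Notation C := R[i].
Local Notation fct := (plane R -> C).

Definition e1 : R * R := (1, 0).
Definition e2 : R * R := (0, 1).

Fixpoint Ck (k : nat) (u : R * R -> R) : Prop :=
  if k is k'.+1 then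
    [/\ (forall x, derivable u x e1), (forall x, derivable u x e2),
        Ck k' (fun x => 'D_e1 u x) & Ck k' (fun x => 'D_e2 u x)]
  else continuous u.

(* C_0^\infty(R^2; C) *)
Definition test_function (f : R * R -> C) : Prop :=
  [/\ forall k, Ck k (fun x => Re (f x)),
      forall k, Ck k (fun x => Im (f x)) &
      exists2 K : set (R * R), compact K & forall x, ~ K x -> f x = 0].

(* Partial derivative of a complex-valued function of two real variables. *)
Definition cderive (v : R * R) (f : R * R -> C) (x : R * R) : C :=
  Complex ('D_v (fun y => Re (f y)) x) ('D_v (fun y => Im (f y)) x).

Definition magnetic_d1 (B : R) (f : R * R -> C) (x : R * R) : C :=
  'i%C * cderive e1 f x - (B / 2 * x.2)%:C * f x.

Definition magnetic_d2 (B : R) (f : R * R -> C) (x : R * R) : C :=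
  'i%C * cderive e2 f x + (B / 2 * x.1)%:C * f x.

Definition landau_expr (B : R) (f : R * R -> C) (x : R * R) : C :=
  magnetic_d1 B (magnetic_d1 B f) x + magnetic_d2 B (magnetic_d2 B f) x.

(* Graph of H_B: since C_0^\infty(R^2) is an operator core, H_B is the closure
   in L^2(R^2) of the differential expression on C_0^\infty(R^2). *)
Definition landau (B : R) (f g : fct) : Prop :=
  [/\ L2 f, L2 g &
      exists phi : nat -> R * R -> C,
        [/\ forall n, test_function (phi n),
            (L2sqnorm setT (fun x => phi n x - f x)%R
               @[n --> \oo] --> 0)%E &
            (L2sqnorm setT (fun x => landau_expr B (phi n) x - g x)%R
               @[n --> \oo] --> 0)%E]].

(* Lebesgue measurability of S is with respect to the completed sigma-algebra. *)
Definition thick (l : R * R) (rho : R) (S : set (plane R)) : Prop :=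
  [/\ measurable S, 0 < l.1 /\ 0 < l.2, 0 < rho <= 1 &
      forall a : R * R,
        let Q := `[a.1, a.1 + l.1] `*` `[a.2, a.2 + l.2] in
        (rho%:E * leb2 R Q <= leb2 R (S `&` Q))%E].

Definition norm1 (l : R * R) : R := l.1 + l.2.

End Landau.

(* Main.v *)
(* Let f be in the range of 1_(-oo,E](H) for the Landau operator H.  All iterates
   f_k = H^k f exist and |f_k| <= E^k |f|.  For t = E^(-1/2), say, the series
   F(x) = sum_k (t^k / k!) <K_t(x, .), f_k> with the Mehler kernel K_t of exp(-tH)
   represents exp(-tH) exp(tH) f = f almost everywhere, so f has a representative
   which is, up to a gauge factor on each cell of size l, a superposition of
   exponentials exp(<z, x>) with Gaussian weight.  These are entire functions of
   exponential type, and Lagrange interpolation of degree D ~ sqrt E at well separated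
   points of a thick set, first on vertical and then on horizontal segments, bounds F
   on the cell by K^D times its bound on a large part of the thick set, up to an error
   2^(-D) times a local mass of the f_k.  Averaging over all cells, the error is
   absorbed in the left-hand side.  The constants may depend on B, l and rho. *)
Require Import Defs.
From HB Require Import structures.
From mathcomp Require Import all_boot all_order all_algebra.
From mathcomp Require Import all_classical all_reals all_analysis.
From mathcomp Require Import measurable_realfun.
From mathcomp Require Import zify ring lra.

Set Implicit Arguments.
Unset Strict Implicit.
Unset Printing Implicit Defensive.
Import Order.TTheory GRing.Theory Num.Theory.
Import numFieldNormedType.Exports.
Local Open Scope classical_set_scope.
Local Open Scope ring_scope.
Local Notation Re := complex.Re.
Local Notation Im := complex.Im.

(** A spectral measure is tied to H only through quadratic forms and the domain, so there is no
    functional calculus at hand and exp(tH) f is never formed. Only scalar pairings of the iterates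
    with an explicit Gaussian occur, and H passes from an iterate to the Gaussian by integration by
    parts against test functions, which form a core. The obstacle on a cell is the vector potential,
    unbounded over the plane: far from the origin the kernel oscillates fast in x. A phase that is
    affine in x and depends on the cell removes this oscillation without changing |F|; this is why
    every pairing carries a free phase th. The time E^(-1/2) balances two costs, the factor exp(E t)
    caused by the iterates and the Gaussian exponent, of order 1/t, which governs the degree and the
    growth over a cell: both become multiples of sqrt E. The Lebesgue constant of the interpolation
    is itself exponential in D, so the Taylor error must gain lam^(-D) with a base lam that depends
    on rho and beats it. *)

Lemma ge0_integral_image_measure d d' (T : measurableType d) (U : measurableType d')
    (R : realType) (mu : {measure set T -> \bar R}) (nu : {measure set U -> \bar R})
    (phi : T -> U) (mphi : measurable_fun setT phi) (f : U -> \bar R) :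
  (forall A, measurable A -> mu (phi @^-1` A) = nu A) ->
  measurable_fun setT f -> (forall x, 0 <= f x)%E ->
  (\int[mu]_x f (phi x) = \int[nu]_x f x)%E.
Proof.
move=> munu mf f0; transitivity (\int[pushforward mu phi]_x f x)%E.
  by rewrite ge0_integral_pushforward.
by apply: eq_measure_integral => A mA _; exact: munu.
Qed.

(** * Lebesgue measure on the plane *)

Section PlaneMeasure.
Variable R : realType.
Local Notation mR := (measurableTypeR R).
Local Notation bplane := (mR * mR)%type.

Lemma borel_leb2X (X Y : set mR) : measurable X -> measurable Y ->
  (borel_leb2 R (X `*` Y) = lebesgue_measure X * lebesgue_measure Y)%E.
Proof. exact: product_measure1E. Qed.

Lemma borel_leb2_sigma_finite : sigma_finite setT (borel_leb2 R).
Proof.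
have /sigma_finiteP[F [TF ndF Foo]] := sigma_finiteT (@lebesgue_measure R).
exists (fun n => F n `*` F n).
  rewrite -setXTT predeqE => -[x y]; split.
    rewrite TF => -[/= [n _ Fnx] [k _ Gky]]; exists (maxn n k) => //; split.
    - by move: x Fnx; exact/subsetPset/ndF/leq_maxl.
    - by move: y Gky; exact/subsetPset/ndF/leq_maxr.
  by [].
move=> k; have [? ?] := Foo k.
split; first exact: measurableX.
by rewrite [ltLHS]borel_leb2X// lte_mul_pinfty// ge0_fin_numE.
Qed.

Lemma leb2_sigma_finite : sigma_finite setT (leb2 R).
Proof. exact/completed_measure_extension_sigma_finite/borel_leb2_sigma_finite. Qed.

(** [leb2 R] under a name of its own, to which the sigma-finite structure demanded by Tonelli's
    theorem is attached; [integral_sleb2] switches between the two names. *)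
Definition sleb2 : set (plane R) -> \bar R := leb2 R.
HB.instance Definition _ := Measure.copy sleb2 (leb2 R).
HB.instance Definition _ := Measure_isSigmaFinite.Build _ _ _ sleb2 leb2_sigma_finite.
Lemma measurable_borel_plane (A : set bplane) : measurable A ->
  measurable (A : set (plane R)).
Proof. by move=> mA; apply: sub_caratheodory; apply: sub_sigma_algebra. Qed.

Lemma leb2E (A : set bplane) : measurable A -> leb2 R A = borel_leb2 R A.
Proof. by move=> mA; rewrite /leb2 /= /completed_measure_extension measurable_mu_extE. Qed.

Lemma measurable_plane_id : measurable_fun setT (id : plane R -> bplane).
Proof. by move=> _ A mA; rewrite setTI; exact: measurable_borel_plane. Qed.

Lemma measurable_plane d (T : measurableType d) (f : bplane -> T) :
  measurable_fun setT f -> measurable_fun setT (f : plane R -> T).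
Proof. by move=> mf; apply: (measurableT_comp mf measurable_plane_id). Qed.

Lemma leb2_integral (f : bplane -> \bar R) : measurable_fun setT f ->
  (forall x, 0 <= f x)%E ->
  (\int[leb2 R]_x f x = \int[borel_leb2 R]_x f x)%E.
Proof. exact: (ge0_integral_image_measure measurable_plane_id leb2E). Qed.

End PlaneMeasure.

Section PlaneBorel.
Variable R : realType.
Local Notation mR := (measurableTypeR R).
Local Notation bplane := (mR * mR)%type.

(** The sigma-algebra of the product is generated by measurable rectangles, so an open set has to be
    exhibited as a countable union of them: the squares with rational centre and radius that it
    contains. *)
Lemma open_measurable_plane (U : set (R * R)) : open U -> measurable (U : set bplane).
Proof.
move=> oU.
pose bx (p q r : rat) : set bplane :=
  `]ratr p - ratr r, ratr p + ratr r[ `*` `]ratr q - ratr r, ratr q + ratr r[.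
have -> : U = \bigcup_p \bigcup_q \bigcup_r
    (if pselect (bx p q r `<=` U) then bx p q r else set0).
  apply/seteqP; split=> [[x y] Uxy|[x y] [p _ [q _ [r _]]]]; last first.
    by case: pselect => // /[apply].
  have /nbhs_ballP[e /= e0 exy] := open_nbhs_nbhs (conj oU Uxy).
  (* A radius below e / 2 and a centre within that radius of the point: by the triangle inequality
     the square stays in the ball of radius e. *)
  have [r /[!in_itv]/= /andP[r0 re]] := rat_in_itvoo (divr_gt0 e0 (ltr0n R 2)).
  have xr (z : R) : z - ratr r < z + ratr r by lra.
  have [p /[!in_itv]/= /andP[p0 pe]] := rat_in_itvoo (xr x).
  have [q /[!in_itv]/= /andP[q0 qe]] := rat_in_itvoo (xr y).
  exists p => //; exists q => //; exists r => //.
  case: pselect => [?|].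
    by split; rewrite /= in_itv /=; apply/andP; split; lra.
  case=> -[a b] [] /=; rewrite !in_itv/= => /andP[? ?] /andP[? ?].
  by apply: exy; split; rewrite /ball/= ltr_norml; apply/andP; split; lra.
apply: bigcupT_measurable_rat => p; apply: bigcupT_measurable_rat => q.
apply: bigcupT_measurable_rat => r; by case: pselect => ?; [exact: measurableX|exact: measurable0].
Qed.

Lemma continuous_measurable_plane (f : R * R -> R) : continuous f ->
  measurable_fun setT (f : bplane -> R).
Proof.
move=> /continuousP cf; apply: (measurability _ (RGenOpens.measurableE R)).
move=> _ [_ [a [b ->] <-]]; rewrite setTI; apply: open_measurable_plane.
by apply: cf; exact: interval_open.
Qed.

Lemma integral_gauss1 (c m : R) : 0 < c ->
  (\int[@lebesgue_measure R]_y (expR (- c * (y - m) ^+ 2))%:E = (Num.sqrt (pi / c))%:E)%E.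
Proof.
move=> c0.
(* Variance 1 / (2 c) makes the normal density a multiple of the integrand, and its peak value is
   the inverse of the claimed integral. *)
pose s : R := Num.sqrt (2 * c)^-1.
have s2 : s ^+ 2 = (2 * c)^-1 by rewrite sqr_sqrtr// invr_ge0 mulr_ge0 ?ltW.
have s0 : s != 0 by rewrite gt_eqF// sqrtr_gt0 invr_gt0 mulr_gt0.
have := integral_normal_pdf m s.
rewrite normal_pdfE// => h.
have pk : normal_peak s = (Num.sqrt (pi / c))^-1.
  rewrite /normal_peak s2; congr (_^-1); congr (Num.sqrt _); rewrite -mulr_natr; field.
  by rewrite gt_eqF.
have p0 : 0 < Num.sqrt (pi / c) by rewrite sqrtr_gt0 divr_gt0 ?pi_gt0.
transitivity (\int[@lebesgue_measure R]_y ((Num.sqrt (pi / c))%:E * (normal_peak s * normal_fun m s y)%:E))%E.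
  apply: eq_integral => y _; rewrite -EFinM pk; congr EFin; rewrite [RHS]mulrA divff ?gt_eqF// mul1r.
  rewrite /normal_fun s2; congr expR; rewrite -mulr_natr; field.
  by rewrite gt_eqF.
rewrite ge0_integralZl//= ?h ?mule1//.
- apply/measurable_EFinP/measurable_funM => //; exact: measurable_normal_fun.
- by move=> y _; rewrite lee_fin mulr_ge0 ?normal_peak_ge0 ?normal_fun_ge0.
Qed.

Definition sqdist (x y : R * R) : R := (y.1 - x.1) ^+ 2 + (y.2 - x.2) ^+ 2.

Lemma sqdist_ge0 x y : 0 <= sqdist x y.
Proof. by rewrite addr_ge0 ?sqr_ge0. Qed.

Lemma measurable_sqdist (x : R * R) : measurable_fun setT (sqdist x : bplane -> R).
Proof.
apply: measurable_funD; apply: measurable_funX; apply: measurable_funB => //.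
Qed.

Lemma measurable_gauss2 (c : R) (x : R * R) :
  measurable_fun setT (fun y : bplane => expR (- c * sqdist x y)).
Proof.
by apply: measurableT_comp => //; apply: measurable_funM => //; exact: measurable_sqdist.
Qed.

Lemma measurable_gauss1 (c m : R) :
  measurable_fun setT (fun y : mR => expR (- c * (y - m) ^+ 2)).
Proof.
apply: measurableT_comp => //; apply: measurable_funM => //.
by apply: measurable_funX; exact: measurable_funB.
Qed.

Lemma integral_gauss2_borel (c : R) (x : R * R) : 0 < c ->
  (\int[borel_leb2 R]_y (expR (- c * sqdist x y))%:E = (pi / c)%:E)%E.
Proof.
move=> c0; transitivity (\int[@lebesgue_measure R]_y
    ((Num.sqrt (pi / c))%:E * (expR (- c * (y - x.1) ^+ 2))%:E))%E; last first.
  rewrite ge0_integralZl//=.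
  - by rewrite integral_gauss1// -EFinM -expr2 sqr_sqrtr// divr_ge0 ?ltW ?pi_gt0.
  - apply/measurable_EFinP; exact: measurable_gauss1.
rewrite [LHS]fubini_tonelli1//=.
- rewrite /fubini_F; apply: eq_integral => a _.
  rewrite -(integral_gauss1 x.2 c0) -ge0_integralZr//=.
  - by apply: eq_integral => b _; rewrite -EFinM -expRD -mulrDr /sqdist /= addrC.
  - apply/measurable_EFinP; exact: measurable_gauss1.
- apply/measurable_EFinP; exact: measurable_gauss2.
Qed.

Lemma integral_gauss2 (c : R) (x : R * R) : 0 < c ->
  (\int[leb2 R]_y (expR (- c * sqdist x y))%:E = (pi / c)%:E)%E.
Proof.
move=> c0; rewrite leb2_integral ?integral_gauss2_borel//.
- apply/measurable_EFinP; exact: measurable_gauss2.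
Qed.

End PlaneBorel.

(** * Real inner products *)

Section RealL2.
Context d (T : measurableType d) (R : realType) (mu : {measure set T -> \bar R}).
Implicit Types (u v : T -> R) (f g h : T -> R[i]).

Definition sqint u := measurable_fun setT u /\ mu.-integrable setT (fun x => (u x ^+ 2)%:E).

Lemma sqintP u : measurable_fun setT u ->
  (\int[mu]_x (u x ^+ 2)%:E < +oo)%E -> sqint u.
Proof.
move=> mu_ ioo; split=> //; apply/integrableP; split.
  by apply/measurable_EFinP; exact: measurable_funX.
by under eq_integral do rewrite abse_EFin ger0_norm ?sqr_ge0//.
Qed.

Lemma sqint_mul u v : sqint u -> sqint v -> mu.-integrable setT (fun x => (u x * v x)%:E).
Proof.
move=> [mu_ iu] [mv iv].
apply: (@le_integrable _ _ _ _ _ measurableT _ (fun x => (u x ^+ 2)%:E + (v x ^+ 2)%:E)%E).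
- by apply/measurable_EFinP; exact: measurable_funM.
- move=> x _; rewrite !abse_EFin lee_fin.
  by rewrite [leRHS]ger0_norm ?addr_ge0 ?sqr_ge0// ler_norml; apply/andP; split; nra.
- exact: integrableD.
Qed.

Lemma sqint_le (w : T -> R) u : measurable_fun setT w -> sqint u ->
  (forall x, `|w x| <= `|u x|) -> sqint w.
Proof.
move=> mw [mu_ iu] wu; split=> //.
apply: le_integrable iu => //.
  by apply/measurable_EFinP; exact: measurable_funX.
by move=> x _; rewrite !abse_EFin lee_fin !normrX lerXn2r ?nnegrE.
Qed.

Lemma sqintD u v : sqint u -> sqint v -> sqint (fun x => u x + v x).
Proof.
move=> su sv; have [mu_ iu] := su; have [mv iv] := sv.
split; first exact: measurable_funD.
have -> : (fun x => ((u x + v x) ^+ 2)%:E) =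
    (fun x => (u x ^+ 2)%:E + (v x ^+ 2)%:E + 2%:E * (u x * v x)%:E)%E.
  by apply/funext => x; rewrite -EFinM -!EFinD; congr EFin; ring.
apply: integrableD => //; first exact: integrableD.
by apply: integrableZl => //; exact: sqint_mul.
Qed.

Lemma sqintZ a u : sqint u -> sqint (fun x => a * u x).
Proof.
move=> [mu_ iu]; split; first exact: measurable_funM.
have -> : (fun x => ((a * u x) ^+ 2)%:E) = (fun x => (a ^+ 2)%:E * (u x ^+ 2)%:E)%E.
  by apply/funext => x; rewrite -EFinM exprMn.
exact: integrableZl.
Qed.

Definition csqint f := sqint (fun x => Re (f x)) /\ sqint (fun x => Im (f x)).

(** The inner product of C seen as R^2. Thus [rip] is the real part of [inner] ([Re_inner]), and all
    Hilbert space estimates use real integrals only. Other components of a complex pairing are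
    reached by rotating one argument by a phase. *)
Definition rdot (z w : R[i]) : R := Re z * Re w + Im z * Im w.

Definition rip f g : R := \int[mu]_x rdot (f x) (g x).

Lemma csqint_integrable f g : csqint f -> csqint g ->
  mu.-integrable setT (EFin \o (fun x => rdot (f x) (g x))).
Proof.
move=> [f1 f2] [g1 g2].
exact: (integrableD measurableT (sqint_mul f1 g1) (sqint_mul f2 g2)).
Qed.

Lemma csqintD f g : csqint f -> csqint g -> csqint (fun x => f x + g x).
Proof.
move=> [f1 f2] [g1 g2]; split.
- have -> : (fun x => Re (f x + g x)) = (fun x => Re (f x) + Re (g x)).
    by apply/funext => x; case: (f x) => ? ?; case: (g x).
  exact: sqintD.
- have -> : (fun x => Im (f x + g x)) = (fun x => Im (f x) + Im (g x)).
    by apply/funext => x; case: (f x) => ? ?; case: (g x).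
  exact: sqintD.
Qed.

Lemma csqintZ (a : R) f : csqint f -> csqint (fun x => (a%:C)%C * f x).
Proof.
move=> [f1 f2]; split.
- have -> : (fun x => Re ((a%:C)%C * f x)) = (fun x => a * Re (f x)).
    by apply/funext => x; case: (f x) => ? ? /=; ring.
  exact: sqintZ.
- have -> : (fun x => Im ((a%:C)%C * f x)) = (fun x => a * Im (f x)).
    by apply/funext => x; case: (f x) => ? ? /=; ring.
  exact: sqintZ.
Qed.

Lemma csqintB f g : csqint f -> csqint g -> csqint (fun x => f x - g x).
Proof.
move=> cf cg; have := csqintD cf (csqintZ (-1) cg).
suff -> : (fun x => f x + ((-1)%:C)%C * g x) = (fun x => f x - g x) by [].
by apply/funext => x; rewrite rmorphN rmorph1 mulN1r.
Qed.

Lemma ripC f g : rip f g = rip g f.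
Proof. by apply: eq_Rintegral => x _; rewrite /rdot; ring. Qed.

Lemma ripDl f g h : csqint f -> csqint g -> csqint h ->
  rip (fun x => f x + g x) h = rip f h + rip g h.
Proof.
move=> cf cg ch; rewrite -RintegralD ?csqint_integrable//.
by apply: eq_Rintegral => x _; rewrite /rdot; case: (f x) => ? ?; case: (g x) => ? ? /=; ring.
Qed.

Lemma ripZl a f h : csqint f -> csqint h ->
  rip (fun x => (a%:C)%C * f x) h = a * rip f h.
Proof.
move=> cf ch; rewrite -RintegralZl ?csqint_integrable//.
by apply: eq_Rintegral => x _; rewrite /rdot; case: (f x) => ? ? /=; ring.
Qed.

Lemma ripBl f g h : csqint f -> csqint g -> csqint h ->
  rip (fun x => f x - g x) h = rip f h - rip g h.
Proof.
move=> cf cg ch; rewrite -RintegralB ?csqint_integrable//.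
by apply: eq_Rintegral => x _; rewrite /rdot; case: (f x) => ? ?; case: (g x) => ? ? /=; ring.
Qed.

Lemma rip_ge0 f : 0 <= rip f f.
Proof. by apply: Rintegral_ge0 => x _; rewrite /rdot addr_ge0// -expr2 sqr_ge0. Qed.

Lemma rip_quad f g (a : R) : csqint f -> csqint g ->
  rip (fun x => f x + (a%:C)%C * g x) (fun x => f x + (a%:C)%C * g x) =
  rip f f + 2 * a * rip f g + a ^+ 2 * rip g g.
Proof.
move=> cf cg; have cg' := csqintZ a cg.
set ag := fun x => (a%:C)%C * g x.
have e1 : rip ag f = a * rip f g by rewrite ripZl// ripC.
have e2 : rip ag ag = a ^+ 2 * rip g g by rewrite ripZl// ripC ripZl// mulrA.
have cs : csqint (fun x => f x + ag x) by exact: csqintD.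
rewrite ripDl// (ripC f) (ripC ag) !ripDl// e1 e2 (ripC f ag) e1; ring.
Qed.

Lemma rip_CS f g : csqint f -> csqint g -> rip f g ^+ 2 <= rip f f * rip g g.
Proof.
move=> cf cg.
have h a : 0 <= rip f f + 2 * a * rip f g + a ^+ 2 * rip g g.
  by rewrite -rip_quad// rip_ge0.
have := rip_ge0 g; rewrite le_eqVlt => /orP[/eqP g0|g0].
  rewrite -g0 mulr0.
  have [->|fg] := eqVneq (rip f g) 0; first by rewrite expr0n/= lexx.
  (* When <g, g> = 0 the quadratic is affine in a; at this a it equals -1. *)
  have := h (- (rip f f + 1) / (2 * rip f g)); rewrite -g0 mulr0 addr0.
  have -> : 2 * (- (rip f f + 1) / (2 * rip f g)) * rip f g = - (rip f f + 1) by field.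
  by rewrite opprD addrA subrr sub0r oppr_ge0 leNgt ltr01.
have := h (- rip f g / rip g g).
have -> : rip f f + 2 * (- rip f g / rip g g) * rip f g + (- rip f g / rip g g) ^+ 2 * rip g g
  = (rip f f * rip g g - rip f g ^+ 2) / rip g g by field; rewrite gt_eqF.
by rewrite pmulr_lge0 ?invr_gt0// subr_ge0.
Qed.

Lemma rip_abs_le f g : csqint f -> csqint g ->
  `|rip f g| <= Num.sqrt (rip f f) * Num.sqrt (rip g g).
Proof.
move=> cf cg; rewrite -sqrtrM ?rip_ge0// -sqrtr_sqr ler_sqrt ?mulr_ge0 ?rip_ge0//.
exact: rip_CS.
Qed.

Lemma ripD_le f g : csqint f -> csqint g ->
  rip (fun x => f x + g x) (fun x => f x + g x) <= 2 * rip f f + 2 * rip g g.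
Proof.
move=> cf cg.
have e : (fun x => f x + g x) = (fun x => f x + (1%:C)%C * g x).
  by apply/funext => x; rewrite mul1r.
have e' : (fun x => f x + (- 1)%:C%C * g x) = (fun x => f x - g x).
  by apply/funext => x; rewrite rmorphN rmorph1 mulN1r.
have := rip_ge0 (fun x => f x + (- 1)%:C%C * g x).
rewrite e !rip_quad//; nra.
Qed.

Lemma rip_EFin f g : csqint f -> csqint g ->
  (\int[mu]_x (rdot (f x) (g x))%:E = (rip f g)%:E)%E.
Proof.
move=> cf cg; rewrite /rip /Rintegral fineK//.
exact/integrable_fin_num/csqint_integrable.
Qed.

Lemma csqintP f : measurable_fun setT (fun x => Re (f x)) ->
  measurable_fun setT (fun x => Im (f x)) ->
  (\int[mu]_x (rdot (f x) (f x))%:E < +oo)%E -> csqint f.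
Proof.
move=> m1 m2 foo.
have m3 : measurable_fun setT (fun x => (rdot (f x) (f x))%:E).
  apply/measurable_EFinP; rewrite /rdot.
  by apply: measurable_funD; exact: measurable_funM.
split; apply: sqintP => //; apply: le_lt_trans foo; apply: ge0_le_integral => //.
- by move=> x _; rewrite lee_fin sqr_ge0.
- by apply/measurable_EFinP; exact: measurable_funX.
- by move=> x _; rewrite lee_fin /rdot; nra.
- by move=> x _; rewrite lee_fin sqr_ge0.
- by apply/measurable_EFinP; exact: measurable_funX.
- by move=> x _; rewrite lee_fin /rdot; nra.
Qed.

Lemma csqint_cont_rip k (phi : nat -> T -> R[i]) f : csqint k ->
  (forall n, csqint (phi n)) -> csqint f ->
  (rip (fun x => phi n x - f x) (fun x => phi n x - f x) @[n --> \oo] --> 0) ->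
  rip k (phi n) @[n --> \oo] --> rip k f.
Proof.
move=> ck cp cf h.
apply/cvgrPdistC_le => e e0.
pose M := rip k k + 1.
have M0 : 0 < M by rewrite ltr_wpDl ?rip_ge0.
have e2 : 0 < e ^+ 2 / M by rewrite divr_gt0 ?exprn_gt0.
move/cvgrPdist_le : h => /(_ _ e2); apply: filterS => n.
rewrite sub0r normrN ger0_norm ?rip_ge0// => hn.
rewrite ripC (ripC k) -ripBl// ripC -ler_sqr ?nnegrE ?normr_ge0 ?(ltW e0)// real_normK ?num_real//.
apply: (le_trans (rip_CS ck (csqintB (cp n) cf))).
apply: (@le_trans _ _ (M * (e ^+ 2 / M))).
  by rewrite ler_pM ?rip_ge0// /M lerDl.
by rewrite mulrC divfK ?gt_eqF.
Qed.

End RealL2.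

Section RipAe.
Context d (T : measurableType d) (R : realType) (mu : {measure set T -> \bar R}).
Implicit Types (f g h : T -> R[i]).

Lemma rip_ae f f' g : csqint mu f -> csqint mu f' -> csqint mu g ->
  f = f' %[ae mu] -> rip mu f g = rip mu f' g.
Proof.
move=> cf cf' cg ff'; rewrite /rip /Rintegral; congr fine.
apply: ae_eq_integral => //.
- exact: measurable_int (csqint_integrable cf cg).
- exact: measurable_int (csqint_integrable cf' cg).
by apply: filterS ff' => x /= xe _; rewrite xe.
Qed.

Lemma rip_eq0 f : csqint mu f -> rip mu f f = 0 -> f = (fun=> 0) %[ae mu].
Proof.
move=> cf f0.
have h : (\int[mu]_x `|(rdot (f x) (f x))%:E| = 0)%E.
  under eq_integral do rewrite abse_EFin ger0_norm ?addr_ge0 -?expr2 ?sqr_ge0//.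
  by rewrite rip_EFin// f0.
have := (ae_eq_integral_abs mu measurableT (measurable_int _ (csqint_integrable cf cf))).1 h.
apply: filterS => x /(_ I) /= [] xe _.
have [r0 i0] : Re (f x) = 0 /\ Im (f x) = 0 by move: xe; rewrite /rdot; nra.
by case: (f x) r0 i0 => a b /= -> ->.
Qed.

End RipAe.

(** * The norm and inner product of the statement in terms of [rip] *)

Section Bridge.
Variable R : realType.
Local Notation fct := (plane R -> R[i]).
Implicit Types f g : fct.

Lemma normc_sqr (z : R[i]) : Normc.normc z ^+ 2 = rdot z z.
Proof. by case: z => a b /=; rewrite sqr_sqrtr ?addr_ge0 ?sqr_ge0// /rdot -!expr2. Qed.

Lemma L2sqnormE (D : set (plane R)) f :
  L2sqnorm D f = (\int[leb2 R]_(x in D) (rdot (f x) (f x))%:E)%E.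
Proof. by apply: eq_integral => x _; rewrite normc_sqr. Qed.

Lemma L2_csqint f : L2 f <-> csqint (leb2 R) f.
Proof.
split=> [[m1 m2 foo]|].
  by apply: csqintP => //; rewrite -L2sqnormE.
move=> cf; have [[m1 _] [m2 _]] := cf; split=> //.
by rewrite L2sqnormE rip_EFin// ltry.
Qed.

Lemma L2sqnorm_rip f : L2 f -> L2sqnorm setT f = (rip (leb2 R) f f)%:E.
Proof. by move=> /L2_csqint cf; rewrite L2sqnormE rip_EFin. Qed.

Lemma Re_inner f g : Re (inner f g) = rip (leb2 R) f g.
Proof.
rewrite /inner /=; apply: eq_Rintegral => x _.
by case: (f x) => a b; case: (g x) => c d /=; rewrite /rdot /=; ring.
Qed.

End Bridge.

(** * Integration by parts *)

Section Slices.
Variable R : realType.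
Implicit Types (u w : R * R -> R) (x : R * R).

Lemma diff_quot_slice1 u x :
  (fun h => h^-1 *: ((u \o shift x) (h *: e1 R) - u x)) =
  (fun h => h^-1 *: (((fun a => u (a, x.2)) \o shift x.1) (h *: 1) - u (x.1, x.2))).
Proof.
apply/funext => h; case: x => a b /=.
congr (_ *: (u _ - _)).
have -> : h *: e1 R + (a, b) = (h *: 1 + a, h *: 0 + b) by [].
by rewrite scaler0 add0r.
Qed.

Lemma diff_quot_slice2 u x :
  (fun h => h^-1 *: ((u \o shift x) (h *: e2 R) - u x)) =
  (fun h => h^-1 *: (((fun a => u (x.1, a)) \o shift x.2) (h *: 1) - u (x.1, x.2))).
Proof.
apply/funext => h; case: x => a b /=.
congr (_ *: (u _ - _)).
have -> : h *: e2 R + (a, b) = (h *: 0 + a, h *: 1 + b) by [].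
by rewrite scaler0 add0r.
Qed.

Lemma is_derive_slice1 u x (d : R) :
  is_derive x (e1 R) u d <-> is_derive x.1 1 (fun a => u (a, x.2)) d.
Proof.
have h := diff_quot_slice1 u x.
by split=> -[p q]; split;
  move: p q; rewrite /derive /derivable ?h // -?h.
Qed.

Lemma is_derive_slice2 u x (d : R) :
  is_derive x (e2 R) u d <-> is_derive x.2 1 (fun a => u (x.1, a)) d.
Proof.
have h := diff_quot_slice2 u x.
by split=> -[p q]; split;
  move: p q; rewrite /derive /derivable ?h // -?h.
Qed.

(** Compact support, stated coordinatewise so that slices (for Fubini's theorem) and derivatives
    inherit it. *)
Definition boxed u := exists2 M : R, 0 < M &
  forall x, (M < `|x.1|) \/ (M < `|x.2|) -> u x = 0.

Lemma continuous_slice1 u (y : R) : continuous u -> continuous (fun a => u (a, y)).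
Proof.
move=> cu a; apply: (@continuous_comp _ _ _ (fun a : R => (a, y)) u); last exact: cu.
exact: (cvg_pair cvg_id (cvg_cst y)).
Qed.

Lemma continuous_slice2 u (y : R) : continuous u -> continuous (fun a => u (y, a)).
Proof.
move=> cu a; apply: (@continuous_comp _ _ _ (fun a : R => (y, a)) u); last exact: cu.
exact: (cvg_pair (cvg_cst y) cvg_id).
Qed.

Lemma continuous_boxed_bounded u : continuous u -> boxed u ->
  exists2 C : R, 0 < C & forall x, `|u x| <= C.
Proof.
move=> cu [M M0 uM].
have cK : compact (`[-M, M] `*` `[-M, M] : set (R * R)).
  by apply: compact_setX; exact: segment_compact.
have := compact_bounded (continuous_compact (continuous_subspaceT cu) cK).
move=> [N [Nr hN]].
exists (Num.max N 0 + 1); first by rewrite ltr_pwDr// le_max lexx orbT.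
move=> x; have C0 : 0 <= Num.max N 0 + 1 by rewrite addr_ge0// le_max lexx orbT.
have [h1|h1] := ltP M `|x.1|; first by rewrite uM ?normr0//; left.
have [h2|h2] := ltP M `|x.2|; first by rewrite uM ?normr0//; right.
apply: (hN (Num.max N 0 + 1)).
  by rewrite (@le_lt_trans _ _ (Num.max N 0)) ?le_max ?lexx// ltrDl.
exists x => //; split => /=; rewrite in_itv /= -ler_norml//.
Qed.

Local Notation bplane := (measurableTypeR R * measurableTypeR R)%type.

Let sqbox (M : R) : set bplane := `[-M, M] `*` `[-M, M].

Let borel_box_lty (M : R) : (borel_leb2 R (sqbox M) < +oo)%E.
Proof.
rewrite [ltLHS]borel_leb2X// !lebesgue_measure_itv /=.
case: ifP => _; last by rewrite mule0 ltry.
by rewrite -EFinB -EFinM ltry.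
Qed.

Lemma boxed_integrable_borel (u : bplane -> R) : measurable_fun setT u -> boxed u ->
  (exists C : R, forall x, `|u x| <= C) -> (borel_leb2 R).-integrable setT (EFin \o u).
Proof.
move=> mu [M M0 uM] [C uC].
have mB : measurable (sqbox M) by exact: measurableX.
suff h : (borel_leb2 R).-integrable (sqbox M) (EFin \o u).
  move: h => /(integrable_mkcond _ mB); apply: eq_integrable => // x _.
  rewrite patchE; case: ifPn => //; rewrite notin_setE => nB.
  rewrite /= uM//; apply: contra_notP nB => /not_orP[] /negP + /negP.
  by rewrite -!leNgt !ler_norml => h1 h2; split; rewrite /= in_itv.
apply: measurable_bounded_integrable => //.
- exact: measurable_funTS.
- exists C; split; first exact: num_real.
  by move=> z Cz x _; apply: (le_trans (uC x)); exact: ltW.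
Qed.

Lemma leb2_integrable (u : bplane -> \bar R) :
  (borel_leb2 R).-integrable setT u -> (leb2 R).-integrable setT (u : plane R -> _).
Proof.
move=> /integrableP[mu ui]; apply/integrableP; split; first exact: measurable_plane.
rewrite (leb2_integral (f := fun x => `|u x|%E))//.
exact: measurableT_comp.
Qed.

Lemma leb2_integral_signed (u : bplane -> \bar R) : measurable_fun setT u ->
  (\int[leb2 R]_x u x = \int[borel_leb2 R]_x u x)%E.
Proof.
move=> mu; rewrite integralE [RHS]integralE; congr (_ - _)%E.
- by rewrite (leb2_integral (f := u^\+%E))//; exact: measurable_funepos.
- by rewrite (leb2_integral (f := u^\-%E))//; exact: measurable_funeneg.
Qed.

End Slices.

Section DerivativeIntegral.
Variable R : realType.
Implicit Types (u w : R * R -> R) (x : R * R).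
Local Notation bplane := (measurableTypeR R * measurableTypeR R)%type.

(** The region where [w] is assumed to vanish is open, so near each of its points [w] agrees with a
    constant. *)
Lemma derive_vanish w (v : R * R) (M : R) :
  (forall x, (M < `|x.1|) \/ (M < `|x.2|) -> w x = 0) ->
  forall x, (M < `|x.1|) \/ (M < `|x.2|) -> 'D_v w x = 0.
Proof.
move=> wM x xM.
rewrite -[RHS](derive_cst (0 : R) x v); apply: near_eq_derive.
case: xM => xM.
- have h : (fun y : R * R => `|y.1|) @ x --> `|x.1| by apply: cvg_norm; exact: cvg_fst.
  have : \forall y \near x, M < `|y.1| by exact: (h _ (lt_nbhsr xM)).
  by apply: filterS => y yM; rewrite wM//; left.
- have h : (fun y : R * R => `|y.2|) @ x --> `|x.2| by apply: cvg_norm; exact: cvg_snd.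
  have : \forall y \near x, M < `|y.2| by exact: (h _ (lt_nbhsr xM)).
  by apply: filterS => y yM; rewrite wM//; right.
Qed.

Lemma boxed_derive w (v : R * R) : boxed w -> boxed (fun x => 'D_v w x).
Proof. by move=> [M M0 wM]; exists M => //; exact: derive_vanish. Qed.

Lemma integral_derive1_boxed (f F : R -> R) (M : R) : 0 < M -> continuous f ->
  (forall x : R, is_derive x 1 F (f x)) -> (forall x : R, M < `|x| -> F x = 0) ->
  (forall x : R, M < `|x| -> f x = 0) ->
  (\int[@lebesgue_measure R]_x (f x)%:E = 0)%E.
Proof.
move=> M0 cf dF FM fM.
(* One more than [M], since [F] is known to vanish only strictly outside [-M, M] and must vanish at
   both endpoints. *)
pose N := M + 1.
have MN : - N < N by rewrite /N; lra.
have fD (x : R) : F^`()%classic x = f x by rewrite derive1E; apply: derive_val.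
have cF : continuous F.
  by move=> x; apply/differentiable_continuous/derivable1_diffP; apply: ex_derive.
have -> : (\int[@lebesgue_measure R]_x (f x)%:E = \int[@lebesgue_measure R]_(x in `[(- N)%R, N]) (f x)%:E)%E.
  rewrite [RHS]integral_mkcond; apply: eq_integral => x _.
  rewrite patchE; case: ifPn => //; rewrite notin_setE /= in_itv /= -ler_norml => /negP.
  by rewrite -ltNge /N => h; rewrite fM//; lra.
rewrite (continuous_FTC2 MN (F := F)).
- rewrite !FM ?subee//; last by rewrite gtr0_norm; rewrite /N; lra.
  by rewrite ltr0_norm /N; lra.
- by apply: continuous_subspaceT.
- split; first by move=> x _; apply: ex_derive.
  + exact: cvg_at_right_filter (cF _).
  + exact: cvg_at_left_filter (cF _).
- by move=> x _.
Qed.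

Lemma integral_derive_e1 w : (forall x, derivable w x (e1 R)) ->
  continuous (fun x => 'D_(e1 R) w x) -> boxed w ->
  \int[leb2 R]_x ('D_(e1 R) w x) = 0.
Proof.
move=> dw cD bw; have bD := boxed_derive (e1 R) bw.
have mD := continuous_measurable_plane cD.
have [C C0 DC] := continuous_boxed_bounded cD bD.
have iD : (borel_leb2 R).-integrable setT (fun x => ('D_(e1 R) w x)%:E).
  by apply: (boxed_integrable_borel mD bD); exists C.
rewrite /Rintegral (leb2_integral_signed (u := fun x => ('D_(e1 R) w x)%:E)); last first.
  exact/measurable_EFinP.
rewrite -(integral21_prod_meas1 iD) integral0_eq//= => y _.
have [M M0 wM] := bw.
rewrite /fubini_G.
apply: (integral_derive1_boxed (F := fun a => w (a, y)) M0).
- exact: continuous_slice1 cD.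
- by move=> a; apply/(is_derive_slice1 w (a, y)); exact/derivableP.
- by move=> a aM; rewrite wM//; left.
- by move=> a aM; apply: (derive_vanish _ wM); left.
Qed.

Lemma integral_derive_e2 w : (forall x, derivable w x (e2 R)) ->
  continuous (fun x => 'D_(e2 R) w x) -> boxed w ->
  \int[leb2 R]_x ('D_(e2 R) w x) = 0.
Proof.
move=> dw cD bw; have bD := boxed_derive (e2 R) bw.
have mD := continuous_measurable_plane cD.
have [C C0 DC] := continuous_boxed_bounded cD bD.
have iD : (borel_leb2 R).-integrable setT (fun x => ('D_(e2 R) w x)%:E).
  by apply: (boxed_integrable_borel mD bD); exists C.
rewrite /Rintegral (leb2_integral_signed (u := fun x => ('D_(e2 R) w x)%:E)); last first.
  exact/measurable_EFinP.
rewrite -(integral12_prod_meas1 iD) integral0_eq//= => y _.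
have [M M0 wM] := bw.
rewrite /fubini_F.
apply: (integral_derive1_boxed (F := fun a => w (y, a)) M0).
- exact: continuous_slice2 cD.
- by move=> a; apply/(is_derive_slice2 w (y, a)); exact/derivableP.
- by move=> a aM; rewrite wM//; right.
- by move=> a aM; apply: (derive_vanish _ wM); right.
Qed.

End DerivativeIntegral.

(** * C^1 functions and symmetry of the magnetic derivatives *)

Section C1.
Variable R : realType.
Implicit Types (u w : R * R -> R) (v x : R * R).

Definition C1dir v u :=
  [/\ continuous u, forall x, derivable u x v & continuous (fun x => 'D_v u x)].

Definition C1 u := C1dir (e1 R) u /\ C1dir (e2 R) u.

Lemma C1dir_derive v u (du : R * R -> R) : continuous u -> continuous du ->
  (forall x, is_derive x v u (du x)) -> C1dir v u.
Proof.
move=> cu cdu h; split=> //.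
have -> // : (fun x => 'D_v u x) = du.
by apply/funext => x; case: (h x).
Qed.

Lemma continuous_addf u w : continuous u -> continuous w -> continuous (fun x => u x + w x).
Proof. by move=> cu cw x; apply: cvgD; [exact: cu|exact: cw]. Qed.

Lemma continuous_mulf u w : continuous u -> continuous w -> continuous (fun x => u x * w x).
Proof. by move=> cu cw x; apply: cvgM; [exact: cu|exact: cw]. Qed.

Lemma continuous_fst_plane : continuous (fun x : R * R => x.1).
Proof. by move=> x; exact: cvg_fst. Qed.

Lemma continuous_snd_plane : continuous (fun x : R * R => x.2).
Proof. by move=> x; exact: cvg_snd. Qed.

Lemma C1dirD v u w : C1dir v u -> C1dir v w -> C1dir v (fun x => u x + w x).
Proof.
move=> [cu du cDu] [cw dw cDw].
apply: (@C1dir_derive _ _ (fun x => 'D_v u x + 'D_v w x)).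
- exact (continuous_addf cu cw).
- exact (continuous_addf cDu cDw).
- by move=> x; apply: is_deriveD; exact/derivableP.
Qed.

Lemma C1dirM v u w : C1dir v u -> C1dir v w -> C1dir v (fun x => u x * w x).
Proof.
move=> [cu du cDu] [cw dw cDw].
apply: (@C1dir_derive _ _ (fun x => u x * 'D_v w x + w x * 'D_v u x)).
- exact (continuous_mulf cu cw).
- exact (continuous_addf (continuous_mulf cu cDw) (continuous_mulf cw cDu)).
- by move=> x; apply: is_deriveM; exact/derivableP.
Qed.

Lemma C1dir_cst v (a : R) : C1dir v (fun=> a).
Proof.
apply: (@C1dir_derive _ _ (fun x => 0)).
- by move=> x; exact: cvg_cst.
- by move=> x; exact: cvg_cst.
Qed.

Lemma C1D u w : C1 u -> C1 w -> C1 (fun x => u x + w x).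
Proof. by move=> [u1 u2] [w1 w2]; split; exact: C1dirD. Qed.

Lemma C1M u w : C1 u -> C1 w -> C1 (fun x => u x * w x).
Proof. by move=> [u1 u2] [w1 w2]; split; exact: C1dirM. Qed.

Lemma C1_cst (a : R) : C1 (fun=> a).
Proof. by split; exact: C1dir_cst. Qed.

Lemma C1N u : C1 u -> C1 (fun x => - u x).
Proof.
move=> cu; have -> : (fun x => - u x) = (fun x => -1 * u x).
  by apply/funext => x; rewrite mulN1r.
exact: (C1M (C1_cst _) cu).
Qed.

Lemma C1_fst : C1 (fun x => x.1).
Proof.
split.
- apply: (@C1dir_derive _ _ (fun x => 1)).
  + exact: continuous_fst_plane.
  + by move=> x; exact: cvg_cst.
  + by move=> x; apply/is_derive_slice1; exact: is_derive_id.
- apply: (@C1dir_derive _ _ (fun x => 0)).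
  + exact: continuous_fst_plane.
  + by move=> x; exact: cvg_cst.
  + by move=> x; apply/is_derive_slice2; exact: is_derive_cst.
Qed.

Lemma C1_snd : C1 (fun x => x.2).
Proof.
split.
- apply: (@C1dir_derive _ _ (fun x => 0)).
  + exact: continuous_snd_plane.
  + by move=> x; exact: cvg_cst.
  + by move=> x; apply/is_derive_slice1; exact: is_derive_cst.
- apply: (@C1dir_derive _ _ (fun x => 1)).
  + exact: continuous_snd_plane.
  + by move=> x; exact: cvg_cst.
  + by move=> x; apply/is_derive_slice2; exact: is_derive_id.
Qed.

Lemma Ck_C1 u : (forall k, Ck k u) -> C1 u.
Proof.
move=> h; have c0 := h 0%N; have [d1 d2 c1 c2] := h 1%N.
by split; [exact: (And3 c0 d1 c1)|exact: (And3 c0 d2 c2)].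
Qed.

Lemma Ck_derive u : (forall k, Ck k u) ->
  (forall k, Ck k (fun x => 'D_(e1 R) u x)) /\ (forall k, Ck k (fun x => 'D_(e2 R) u x)).
Proof. by move=> h; split=> k; case: (h k.+1). Qed.

Lemma Ck_derive_C1 u : (forall k, Ck k u) ->
  C1 (fun x => 'D_(e1 R) u x) /\ C1 (fun x => 'D_(e2 R) u x).
Proof. by move=> /Ck_derive[h1 h2]; split; exact: Ck_C1. Qed.

Lemma C1_boxed_integrable u : continuous u -> boxed u ->
  (leb2 R).-integrable setT (EFin \o (u : plane R -> R)).
Proof.
move=> cu bu; have mu := continuous_measurable_plane cu.
have [C C0 uC] := continuous_boxed_bounded cu bu.
by apply: (leb2_integrable (u := EFin \o u)); apply: boxed_integrable_borel => //; exists C.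
Qed.

Lemma boxedD u w : boxed u -> boxed w -> boxed (fun x => u x + w x).
Proof.
move=> [M M0 uM] [N N0 wN]; exists (Num.max M N); first by rewrite lt_max M0.
move=> x; rewrite !gt_max => h; rewrite uM ?wN ?addr0//.
  by case: h => /andP[? ?]; [left|right].
by case: h => /andP[? ?]; [left|right].
Qed.

Lemma boxedMr u w : boxed w -> boxed (fun x => u x * w x).
Proof. by move=> [M M0 uM]; exists M => // x h; rewrite uM ?mulr0. Qed.

Lemma boxedMl u w : boxed w -> boxed (fun x => w x * u x).
Proof. by move=> [M M0 uM]; exists M => // x h; rewrite uM ?mul0r. Qed.

Local Notation C := R[i].
Implicit Types f g h : R * R -> C.

Definition cC1 f := C1 (fun x => Re (f x)) /\ C1 (fun x => Im (f x)).
Definition cboxed f := boxed (fun x => Re (f x)) /\ boxed (fun x => Im (f x)).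

Variable B : R.

Lemma Re_magnetic_d1 f x :
  Re (magnetic_d1 B f x) = - 'D_(e1 R) (fun y => Im (f y)) x - B / 2 * x.2 * Re (f x).
Proof. rewrite /magnetic_d1 /cderive; case: (f x) => a b /=; ring. Qed.

Lemma Im_magnetic_d1 f x :
  Im (magnetic_d1 B f x) = 'D_(e1 R) (fun y => Re (f y)) x - B / 2 * x.2 * Im (f x).
Proof. rewrite /magnetic_d1 /cderive; case: (f x) => a b /=; ring. Qed.

Lemma Re_magnetic_d2 f x :
  Re (magnetic_d2 B f x) = - 'D_(e2 R) (fun y => Im (f y)) x + B / 2 * x.1 * Re (f x).
Proof. rewrite /magnetic_d2 /cderive; case: (f x) => a b /=; ring. Qed.

Lemma Im_magnetic_d2 f x :
  Im (magnetic_d2 B f x) = 'D_(e2 R) (fun y => Re (f y)) x + B / 2 * x.1 * Im (f x).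
Proof. rewrite /magnetic_d2 /cderive; case: (f x) => a b /=; ring. Qed.

Lemma continuous_rdot_boxed f g : (continuous (fun x => Re (f x))) -> (continuous (fun x => Im (f x))) ->
  (continuous (fun x => Re (g x))) -> (continuous (fun x => Im (g x))) ->
  cboxed f \/ cboxed g ->
  (leb2 R).-integrable setT (EFin \o (fun x : plane R => rdot (f x) (g x))).
Proof.
move=> c1 c2 c3 c4 bx; apply: C1_boxed_integrable.
  by apply: continuous_addf; exact: continuous_mulf.
by case: bx => -[b1 b2]; apply: boxedD; solve [exact: boxedMl|exact: boxedMr].
Qed.

Lemma magnetic_d1_continuous f : cC1 f ->
  continuous (fun x => Re (magnetic_d1 B f x)) /\ continuous (fun x => Im (magnetic_d1 B f x)).
Proof.
move=> [[[c1 d1 D1] _] [[c2 d2 D2] _]].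
under [X in continuous X /\ _]eq_fun do rewrite Re_magnetic_d1.
under [X in _ /\ continuous X]eq_fun do rewrite Im_magnetic_d1.
split=> x; apply: cvgB.
- by apply: cvgN; exact: D2.
- apply: cvgM; last exact: c1.
  by apply: cvgM; [exact: cvg_cst|exact: continuous_snd_plane].
- exact: D1.
- apply: cvgM; last exact: c2.
  by apply: cvgM; [exact: cvg_cst|exact: continuous_snd_plane].
Qed.

Lemma magnetic_d2_continuous f : cC1 f ->
  continuous (fun x => Re (magnetic_d2 B f x)) /\ continuous (fun x => Im (magnetic_d2 B f x)).
Proof.
move=> [[_ [c1 d1 D1]] [_ [c2 d2 D2]]].
under [X in continuous X /\ _]eq_fun do rewrite Re_magnetic_d2.
under [X in _ /\ continuous X]eq_fun do rewrite Im_magnetic_d2.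
split=> x; apply: cvgD.
- by apply: cvgN; exact: D2.
- apply: cvgM; last exact: c1.
  by apply: cvgM; [exact: cvg_cst|exact: continuous_fst_plane].
- exact: D1.
- apply: cvgM; last exact: c2.
  by apply: cvgM; [exact: cvg_cst|exact: continuous_fst_plane].
Qed.

Lemma cboxed_magnetic_d1 f : cboxed f -> cboxed (magnetic_d1 B f).
Proof.
move=> [b1 b2]; split.
- under eq_fun do rewrite Re_magnetic_d1 -mulNr -[X in X + _]mulN1r.
  by apply: boxedD; apply: boxedMr => //; exact: boxed_derive.
- under eq_fun do rewrite Im_magnetic_d1 -mulNr.
  by apply: boxedD; [exact: boxed_derive|apply: boxedMr].
Qed.

Lemma cboxed_magnetic_d2 f : cboxed f -> cboxed (magnetic_d2 B f).
Proof.
move=> [b1 b2]; split.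
- under eq_fun do rewrite Re_magnetic_d2 -[X in X + _]mulN1r.
  by apply: boxedD; apply: boxedMr => //; exact: boxed_derive.
- under eq_fun do rewrite Im_magnetic_d2.
  by apply: boxedD; [exact: boxed_derive|apply: boxedMr].
Qed.

(** The potential terms cancel, and the difference of the two integrands is the partial derivative
    of the imaginary part [w] of f times the conjugate of g. Compact support of g alone localizes
    [w], so f may be a Gaussian kernel. *)
Lemma magnetic_ibp1 f g : cC1 f -> cC1 g -> cboxed g ->
  rip (leb2 R) f (magnetic_d1 B g) = rip (leb2 R) (magnetic_d1 B f) g.
Proof.
move=> cf cg bg.
have [cf1 cf2] := magnetic_d1_continuous cf.
have [cg1 cg2] := magnetic_d1_continuous cg.
have [b1 b2] := bg.
have [[[a1 a2 a3] _] [[a4 a5 a6] _]] := cf.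
have [[[a7 a8 a9] _] [[a10 a11 a12] _]] := cg.
apply/eqP; rewrite -subr_eq0 -RintegralB//; last 2 first.
- by apply: continuous_rdot_boxed => //; right; exact: cboxed_magnetic_d1.
- by apply: continuous_rdot_boxed => //; right.
pose w x := Im (f x) * Re (g x) + (- Re (f x)) * Im (g x).
have [wc wd wD] : C1dir (e1 R) w.
  move: cf cg => [f1 f2] [g1 g2].
  exact: (C1D (C1M f2 g1) (C1M (C1N f1) g2)).1.
rewrite -[X in _ == X](integral_derive_e1 wd wD); last first.
  by apply: boxedD; exact: boxedMr.
apply/eqP; apply: eq_Rintegral => x _.
have : is_derive x (e1 R) w
  ((Im (f x) * 'D_(e1 R) (fun y => Re (g y)) x + Re (g x) * 'D_(e1 R) (fun y => Im (f y)) x) +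
  (- Re (f x) * 'D_(e1 R) (fun y => Im (g y)) x + Im (g x) * (- 'D_(e1 R) (fun y => Re (f y)) x))).
  apply: is_deriveD; apply: is_deriveM; try exact/derivableP.
  by apply: is_deriveN; exact/derivableP.
move=> /@derive_val ->.
by rewrite /rdot Re_magnetic_d1 Im_magnetic_d1 Re_magnetic_d1 Im_magnetic_d1; ring.
Qed.

Lemma magnetic_ibp2 f g : cC1 f -> cC1 g -> cboxed g ->
  rip (leb2 R) f (magnetic_d2 B g) = rip (leb2 R) (magnetic_d2 B f) g.
Proof.
move=> cf cg bg.
have [cf1 cf2] := magnetic_d2_continuous cf.
have [cg1 cg2] := magnetic_d2_continuous cg.
have [b1 b2] := bg.
have [[_ [a1 a2 a3]] [_ [a4 a5 a6]]] := cf.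
have [[_ [a7 a8 a9]] [_ [a10 a11 a12]]] := cg.
apply/eqP; rewrite -subr_eq0 -RintegralB//; last 2 first.
- by apply: continuous_rdot_boxed => //; right; exact: cboxed_magnetic_d2.
- by apply: continuous_rdot_boxed => //; right.
pose w x := Im (f x) * Re (g x) + (- Re (f x)) * Im (g x).
have [wc wd wD] : C1dir (e2 R) w.
  move: cf cg => [f1 f2] [g1 g2].
  exact: (C1D (C1M f2 g1) (C1M (C1N f1) g2)).2.
rewrite -[X in _ == X](integral_derive_e2 wd wD); last first.
  by apply: boxedD; exact: boxedMr.
apply/eqP; apply: eq_Rintegral => x _.
have : is_derive x (e2 R) w
  ((Im (f x) * 'D_(e2 R) (fun y => Re (g y)) x + Re (g x) * 'D_(e2 R) (fun y => Im (f y)) x) +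
  (- Re (f x) * 'D_(e2 R) (fun y => Im (g y)) x + Im (g x) * (- 'D_(e2 R) (fun y => Re (f y)) x))).
  apply: is_deriveD; apply: is_deriveM; try exact/derivableP.
  by apply: is_deriveN; exact/derivableP.
move=> /@derive_val ->.
by rewrite /rdot Re_magnetic_d2 Im_magnetic_d2 Re_magnetic_d2 Im_magnetic_d2; ring.
Qed.
End C1.

(** * The Landau form *)

Section LandauForm.
Variables (R : realType) (B : R).
Local Notation C := R[i].
Local Notation fct := (plane R -> C).
Local Notation leb := (leb2 R).
Implicit Types (f g h : fct) (phi psi u : R * R -> C).

Lemma test_function_C1 phi : test_function phi ->
  [/\ cC1 phi, cC1 (magnetic_d1 B phi), cC1 (magnetic_d2 B phi) & cboxed phi].
Proof.
move=> [r1 r2 [K cK Kphi]].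
have [a1 a2] := Ck_derive_C1 r1; have [b1 b2] := Ck_derive_C1 r2.
have c1 := Ck_C1 r1; have c2 := Ck_C1 r2.
have x1 : C1 (fun x : R * R => B / 2 * x.1) := C1M (C1_cst _) (C1_fst _).
have x2 : C1 (fun x : R * R => B / 2 * x.2) := C1M (C1_cst _) (C1_snd _).
have bx : exists2 M : R, 0 < M & forall x, (M < `|x.1|) \/ (M < `|x.2|) -> phi x = 0.
  have [N [Nr hN]] := compact_bounded cK.
  have C0 : 0 < Num.max N 0 + 1 by rewrite ltr_pwDr// le_max lexx orbT.
  exists (Num.max N 0 + 1) => // x xM; apply: Kphi => Kx.
  have : `|x| <= Num.max N 0 + 1.
    by apply: (hN (Num.max N 0 + 1)) => //; rewrite (@le_lt_trans _ _ (Num.max N 0)) ?le_max ?lexx// ltrDl.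
  rewrite prod_normE ge_max => /andP[h1 h2].
  by case: xM; rewrite ltNge ?h1 ?h2.
split; first by split.
- split.
  + have -> : (fun x => Re (magnetic_d1 B phi x)) = (fun x =>
      - 'D_(e1 R) (fun y => Im (phi y)) x + - (B / 2 * x.2 * Re (phi x))).
      by apply/funext => x; rewrite Re_magnetic_d1.
    exact: (C1D (C1N b1) (C1N (C1M x2 c1))).
  + have -> : (fun x => Im (magnetic_d1 B phi x)) = (fun x =>
      'D_(e1 R) (fun y => Re (phi y)) x + - (B / 2 * x.2 * Im (phi x))).
      by apply/funext => x; rewrite Im_magnetic_d1.
    exact: (C1D a1 (C1N (C1M x2 c2))).
- split.
  + have -> : (fun x => Re (magnetic_d2 B phi x)) = (fun x =>
      - 'D_(e2 R) (fun y => Im (phi y)) x + (B / 2 * x.1 * Re (phi x))).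
      by apply/funext => x; rewrite Re_magnetic_d2.
    exact: (C1D (C1N b2) (C1M x1 c1)).
  + have -> : (fun x => Im (magnetic_d2 B phi x)) = (fun x =>
      'D_(e2 R) (fun y => Re (phi y)) x + (B / 2 * x.1 * Im (phi x))).
      by apply/funext => x; rewrite Im_magnetic_d2.
    exact: (C1D a2 (C1M x1 c2)).
- have [M M0 Mphi] := bx.
  by split; exists M => // x /Mphi ->.
Qed.

Lemma rdotDr (z w1 w2 : C) : rdot z (w1 + w2) = rdot z w1 + rdot z w2.
Proof. by rewrite /rdot; case: w1 => a b; case: w2 => c e /=; ring. Qed.

Lemma rdotDl (z w1 w2 : C) : rdot (w1 + w2) z = rdot w1 z + rdot w2 z.
Proof. by rewrite /rdot; case: w1 => a b; case: w2 => c e /=; ring. Qed.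

Lemma cC1_cont u : cC1 u -> continuous (fun x => Re (u x)) /\ continuous (fun x => Im (u x)).
Proof. by move=> [[[c1 _ _] _] [[c2 _ _] _]]. Qed.

Lemma rip_landau_expr u psi : cC1 u -> cC1 (magnetic_d1 B u) -> cC1 (magnetic_d2 B u) ->
  test_function psi ->
  rip leb u (landau_expr B psi) =
    rip leb (magnetic_d1 B u) (magnetic_d1 B psi) + rip leb (magnetic_d2 B u) (magnetic_d2 B psi) /\
  rip leb u (landau_expr B psi) = rip leb (landau_expr B u) psi.
Proof.
move=> cu cu1 cu2 tpsi.
have [cp cp1 cp2 bp] := test_function_C1 tpsi.
have bp1 := cboxed_magnetic_d1 B bp; have bp2 := cboxed_magnetic_d2 B bp.
have [u1 u2] := cC1_cont cu; have [p1 p2] := cC1_cont cp.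
have [u11 u12] := cC1_cont cu1; have [u21 u22] := cC1_cont cu2.
have [p11 p12] := cC1_cont cp1; have [p21 p22] := cC1_cont cp2.
have [v11 v12] := magnetic_d1_continuous B cu1; have [v21 v22] := magnetic_d2_continuous B cu2.
have [q11 q12] := magnetic_d1_continuous B cp1; have [q21 q22] := magnetic_d2_continuous B cp2.
have bp11 := cboxed_magnetic_d1 B bp1; have bp22 := cboxed_magnetic_d2 B bp2.
have e1 : rip leb u (landau_expr B psi) = rip leb (magnetic_d1 B u) (magnetic_d1 B psi) +
    rip leb (magnetic_d2 B u) (magnetic_d2 B psi).
  rewrite -(magnetic_ibp1 B cu cp1 bp1) -(magnetic_ibp2 B cu cp2 bp2).
  rewrite -RintegralD//.
  - by apply: eq_Rintegral => x _; rewrite rdotDr.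
  - exact (continuous_rdot_boxed u1 u2 q11 q12 (or_intror bp11)).
  - exact (continuous_rdot_boxed u1 u2 q21 q22 (or_intror bp22)).
split=> //; rewrite e1.
rewrite (magnetic_ibp1 B cu1 cp bp) (magnetic_ibp2 B cu2 cp bp) -RintegralD//.
- by apply: eq_Rintegral => x _; rewrite /landau_expr rdotDl.
- exact (continuous_rdot_boxed v11 v12 p1 p2 (or_intror bp)).
- exact (continuous_rdot_boxed v21 v22 p1 p2 (or_intror bp)).
Qed.

Lemma cboxed_csqint phi : continuous (fun x => Re (phi x)) -> continuous (fun x => Im (phi x)) ->
  cboxed phi -> csqint leb phi.
Proof.
move=> c1 c2 [b1 b2].
have sq (w : R * R -> R) : continuous w -> boxed w -> sqint leb w.
  move=> cw bw; split.
    exact: (measurable_plane (continuous_measurable_plane cw)).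
  exact (C1_boxed_integrable (continuous_mulf cw cw) (boxedMr w bw)).
by split; apply: sq.
Qed.

Lemma test_function_csqint phi : test_function phi -> csqint leb phi /\ csqint leb (landau_expr B phi).
Proof.
move=> tphi; have [cp cp1 cp2 bp] := test_function_C1 tphi.
have [p1 p2] := cC1_cont cp.
split; first exact: cboxed_csqint.
apply: csqintD; apply: cboxed_csqint.
- exact: (magnetic_d1_continuous B cp1).1.
- exact: (magnetic_d1_continuous B cp1).2.
- exact/cboxed_magnetic_d1/cboxed_magnetic_d1.
- exact: (magnetic_d2_continuous B cp2).1.
- exact: (magnetic_d2_continuous B cp2).2.
- exact/cboxed_magnetic_d2/cboxed_magnetic_d2.
Qed.

Lemma landauP f g : landau B f g -> [/\ csqint leb f, csqint leb g &
  exists phi : nat -> R * R -> C,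
    [/\ forall n, test_function (phi n),
      rip leb (fun x => phi n x - f x) (fun x => phi n x - f x) @[n --> \oo] --> 0 &
      rip leb (fun x => landau_expr B (phi n) x - g x) (fun x => landau_expr B (phi n) x - g x)
        @[n --> \oo] --> 0]].
Proof.
move=> [/L2_csqint cf /L2_csqint cg [phi [tphi h1 h2]]]; split=> //.
have cphi n := (test_function_csqint (tphi n)).1.
have cHphi n := (test_function_csqint (tphi n)).2.
exists phi; split=> //.
- have e n : L2sqnorm setT (fun x => phi n x - f x) = (rip leb (fun x => phi n x - f x) (fun x => phi n x - f x))%:E.
    by apply: L2sqnorm_rip; apply/L2_csqint; exact (csqintB (cphi n) cf).
  by move: h1; under eq_fun do rewrite e; move/fine_cvgP => [].
- have e n : L2sqnorm setT (fun x => landau_expr B (phi n) x - g x) =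
     (rip leb (fun x => landau_expr B (phi n) x - g x) (fun x => landau_expr B (phi n) x - g x))%:E.
    by apply: L2sqnorm_rip; apply/L2_csqint; exact (csqintB (cHphi n) cg).
  by move: h2; under eq_fun do rewrite e; move/fine_cvgP => [].
Qed.

(** H is the closure of its restriction to test functions, so an adjoint relation tested on them
    passes to the limit along the approximating sequence of any pair in the graph. *)
Lemma landau_adjoint_test u v f g : csqint leb u -> csqint leb v ->
  (forall psi, test_function psi -> rip leb u (landau_expr B psi) = rip leb v psi) ->
  landau B f g -> rip leb u g = rip leb v f.
Proof.
move=> cu cv uv /landauP[cf cg [phi [tphi h1 h2]]].
have l1 : rip leb v (phi n) @[n --> \oo] --> rip leb v f.
  exact (csqint_cont_rip cv (fun n => (test_function_csqint (tphi n)).1) cf h1).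
have l2 : rip leb u (landau_expr B (phi n)) @[n --> \oo] --> rip leb u g.
  exact (csqint_cont_rip cu (fun n => (test_function_csqint (tphi n)).2) cg h2).
have e : (fun n => rip leb u (landau_expr B (phi n))) = (fun n => rip leb v (phi n)).
  by apply/funext => n; exact: uv.
rewrite e in l2.
exact: cvg_unique l2 l1.
Qed.

(** The core property is used once for each argument: a fixed test function is first paired with the
    graph element (f, g), then replaced by (f', g'). *)
Lemma landau_sym f g f' g' : landau B f g -> landau B f' g' -> rip leb f g' = rip leb g f'.
Proof.
move=> h h'; have [cf cg _] := landauP h.
apply: (landau_adjoint_test cf cg _ h') => psi tpsi.
have [cp cHp] := test_function_csqint tpsi.
rewrite (ripC leb f) (ripC leb g); apply/esym; apply: (landau_adjoint_test cp cHp _ h) => chi tchi.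
by have [c1 c2 c3 _] := test_function_C1 tpsi; have [_ ->] := rip_landau_expr c1 c2 c3 tchi.
Qed.

Lemma landau_ge0 f g : landau B f g -> 0 <= rip leb f g.
Proof.
move=> h; have [cf cg [phi [tphi h1 h2]]] := landauP h.
have cphi n := (test_function_csqint (tphi n)).1.
have cHphi n := (test_function_csqint (tphi n)).2.
have l2 : rip leb f (landau_expr B (phi n)) @[n --> \oo] --> rip leb f g.
  exact: csqint_cont_rip.
have l1 : rip leb g (phi n) @[n --> \oo] --> rip leb g f.
  exact: csqint_cont_rip.
pose q n := rip leb (fun x => landau_expr B (phi n) x - g x) (fun x => landau_expr B (phi n) x - g x).
pose p n := rip leb (fun x => phi n x - f x) (fun x => phi n x - f x).
(* This sequence tends to <f, g> and dominates <phi, H phi>, a sum of two squared norms. Indeed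
   <phi, H phi> differs from its first two groups by <phi - f, H phi - g>, which [ripD_le] bounds by
   (p + q) / 2. *)
have : (rip leb f (landau_expr B (phi n)) + (rip leb g (phi n) - rip leb g f) + (p n + q n)) @[n --> \oo] -->
   rip leb f g + (rip leb g f - rip leb g f) + (0 + 0).
  by apply: cvgD; [apply: cvgD => //; apply: cvgB => //; exact: cvg_cst|exact: cvgD].
rewrite subrr !addr0 => H.
rewrite -(cvg_lim _ H)//; apply: limr_ge; first by apply/cvg_ex; eexists; exact: H.
apply: nearW => n.
have cpf := csqintB (cphi n) cf; have cqg := csqintB (cHphi n) cg.
have [c1 c2 c3 _] := test_function_C1 (tphi n).
have [e _] := rip_landau_expr c1 c2 c3 (tphi n).
have pos : 0 <= rip leb (phi n) (landau_expr B (phi n)) by rewrite e addr_ge0 ?rip_ge0.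
have := ripD_le cpf cqg; have := rip_ge0 leb (fun x => (phi n x - f x) + (landau_expr B (phi n) x - g x)).
have e1 : rip leb (fun x => phi n x - f x) (fun x => landau_expr B (phi n) x - g x) =
  rip leb (phi n) (landau_expr B (phi n)) - rip leb f (landau_expr B (phi n)) - rip leb g (phi n) + rip leb g f.
  rewrite (ripBl (cphi n) cf cqg) (ripC leb (phi n)) (ripC leb f).
  rewrite (ripBl (cHphi n) cg (cphi n)) (ripBl (cHphi n) cg cf).
  rewrite (ripC leb (landau_expr _ _) (phi n)) (ripC leb (landau_expr _ _) f); ring.
have := rip_quad 1 cpf cqg; rewrite e1.
have -> : (fun x => phi n x - f x + (1%:C)%C * (landau_expr B (phi n) x - g x)) =
  (fun x => (phi n x - f x) + (landau_expr B (phi n) x - g x)).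
  by apply/funext => x; rewrite mul1r.
move=> -> _; rewrite -/(p n) -/(q n).
have := rip_ge0 leb (fun x => phi n x - f x); rewrite -/(p n).
have := rip_ge0 leb (fun x => landau_expr B (phi n) x - g x); rewrite -/(q n).
lra.
Qed.

End LandauForm.

(** * Iterates of the Landau operator on a spectral subspace *)

Section BoundedSupport.
Variable R : realType.
Local Notation mR := (measurableTypeR R).
Variables (mu : {measure set mR -> \bar R}) (a b : R).
Hypothesis muT : (mu setT < +oo)%E.
Hypothesis muab : mu (~` `[a, b]) = 0%E.

Let mI : measurable (`[a, b] : set mR). Proof. by []. Qed.

Let setTD : (setT `\` ~` `[a, b] : set mR) = `[a, b]%classic.
Proof. by rewrite setTD setCK. Qed.

Let muI : mu (`[a, b]%classic : set mR) = mu setT.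
Proof.
rewrite -(setUv (`[a, b]%classic : set mR)) measureU// ?setICr//; last exact: measurableC.
by rewrite [X in (_ + X)%E]muab adde0.
Qed.

Lemma bounded_support_integrable (f : mR -> R) (C : R) : measurable_fun setT f ->
  (forall x, a <= x <= b -> `|f x| <= C) -> mu.-integrable setT (EFin \o f).
Proof.
move=> mf fC; have mN : measurable (~` `[a, b]%classic : set mR) by exact: measurableC.
have mf' : measurable_fun setT (EFin \o f) by exact/measurable_EFinP.
apply: (negligible_integrable mN measurableT mf' muab).2.
rewrite setTD; apply: measurable_bounded_integrable => //.
- by rewrite [ltLHS]muI.
- exact: measurable_funTS.
- exists C; split; first exact: num_real.
  move=> z Cz x /=; rewrite in_itv /= => xab.
  by apply: (le_trans (fC _ xab)); exact: ltW.
Qed.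

Lemma bounded_support_integrable_id : mu.-integrable setT (fun x => x%:E).
Proof.
apply: (bounded_support_integrable (f := id) (C := `|a| + `|b|)) => // x /andP[ax xb].
by rewrite ler_norml; apply/andP; split; have := ler_norm a; have := ler_norm b; have := ler_norm (-a); have := ler_norm (-b); rewrite !normrN; lra.
Qed.

Lemma bounded_support_sqr : (\int[mu]_x (x ^+ 2)%:E < +oo)%E.
Proof.
apply: integrable_lty => //.
apply: (bounded_support_integrable (f := fun x => x ^+ 2) (C := (`|a| + `|b|) ^+ 2)).
  exact: measurable_funX.
move=> x /andP[ax xb]; rewrite normrX lerXn2r ?nnegrE ?addr_ge0//.
by rewrite ler_norml; apply/andP; split; have := ler_norm a; have := ler_norm b; have := ler_norm (-a); have := ler_norm (-b); rewrite !normrN; lra.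
Qed.

Lemma bounded_support_mean :
  a * fine (mu setT) <= \int[mu]_x x <= b * fine (mu setT).
Proof.
have fT : mu setT \is a fin_num by rewrite ge0_fin_numE.
have e : (\int[mu]_x x%:E = \int[mu]_(x in `[a, b]) x%:E)%E.
  have mN : measurable (~` `[a, b]%classic : set mR) by exact: measurableC.
  by rewrite (negligible_integral mN measurableT bounded_support_integrable_id muab) setTD.
have ii : mu.-integrable `[a, b] (fun x => x%:E).
  by apply: (integrableS measurableT) => //; exact: bounded_support_integrable_id.
have ic r : mu.-integrable `[a, b] (cst r%:E).
  by apply: (integrableS measurableT) => //; apply: (bounded_support_integrable (f := cst r) (C := `|r|)).
have fin : (\int[mu]_x x%:E \is a fin_num)%E.
  exact: integrable_fin_num bounded_support_integrable_id.
apply/andP; split; rewrite /Rintegral -lee_fin fineK// EFinM fineK// -muI -integral_cst// e;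
  apply: le_integral => // x /[!inE] /=; rewrite in_itv /= => /andP[h1 h2]; by rewrite lee_fin.
Qed.
End BoundedSupport.

(** * Spectral projectors of the Landau operator *)

Section SpectralSubspace.
Variables (R : realType) (B : R).
Local Notation C := R[i].
Local Notation fct := (plane R -> C).
Local Notation leb := (leb2 R).
Local Notation mR := (measurableTypeR R).
Variable P : set R -> fct -> fct.
Hypothesis hP : spectral_measure_of (landau B) P.
Implicit Types (f g h : fct) (A : set mR).

Let nrm f := rip leb f f.
Local Notation "f =ae g" := (f = g %[ae leb]) (at level 70).

Lemma proj_csqint A f : measurable A -> csqint leb f -> csqint leb (P A f).
Proof.
by move=> mA /L2_csqint Lf; apply/L2_csqint; have [/(_ _ mA)[[+ _] _ _ _] _ _ _] := hP; apply.
Qed.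

Lemma proj_ae A f g : measurable A -> csqint leb f -> csqint leb g -> f =ae g -> P A f =ae P A g.
Proof.
by move=> mA /L2_csqint Lf /L2_csqint Lg; have [/(_ _ mA)[[_ +] _ _ _] _ _ _] := hP; apply.
Qed.

Lemma projD A f g : measurable A -> csqint leb f -> csqint leb g ->
  P A (fun x => f x + g x) =ae (fun x => P A f x + P A g x).
Proof.
move=> mA /L2_csqint Lf /L2_csqint Lg; have [/(_ _ mA)[_ + _ _] _ _ _] := hP.
move=> /(_ 1 f g Lf Lg).
have -> : (fun x => 1 * f x + g x) = (fun x => f x + g x) by apply/funext => x; rewrite mul1r.
by apply: filterS => x; rewrite mul1r.
Qed.

Lemma projZ A (a : R) f g : measurable A -> csqint leb f -> csqint leb g ->
  P A (fun x => a%:C%C * f x + g x) =ae (fun x => a%:C%C * P A f x + P A g x).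
Proof.
by move=> mA /L2_csqint Lf /L2_csqint Lg; have [/(_ _ mA)[_ + _ _] _ _ _] := hP; apply.
Qed.

Lemma projI A A' f : measurable A -> measurable A' -> csqint leb f ->
  P (A `&` A') f =ae P A (P A' f).
Proof. by move=> mA mA' /L2_csqint Lf; have [_ _ + _] := hP; apply. Qed.

Lemma projT f : csqint leb f -> P setT f =ae f.
Proof. by move=> /L2_csqint Lf; have [_ + _ _] := hP; apply. Qed.

Lemma proj_sym A f g : measurable A -> csqint leb f -> csqint leb g ->
  rip leb (P A f) g = rip leb f (P A g).
Proof.
move=> mA /L2_csqint Lf /L2_csqint Lg; have [/(_ _ mA)[_ _ _ +] _ _ _] := hP.
by move=> /(_ f g Lf Lg) e; rewrite -!Re_inner e.
Qed.

Lemma spectral_mu f : csqint leb f -> exists mu : {measure set mR -> \bar R},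
  [/\ forall A, measurable A -> mu A = (nrm (P A f))%:E,
      (\int[mu]_x (x ^+ 2)%:E < +oo)%E -> exists g, landau B f g &
      forall g, landau B f g -> rip leb f g = \int[mu]_x x].
Proof.
move=> cf; have [_ _ _ /(_ f) h] := hP; have [mu [m1 m2 m3]] := h (iffRL (L2_csqint f) cf).
exists mu; split.
- move=> A mA; rewrite (m1 A mA).
  exact (L2sqnorm_rip (iffRL (L2_csqint _) (proj_csqint mA cf))).
- by move/m2.
- by move=> g /m3 e; rewrite -Re_inner e.
Qed.

Lemma nrm_ae f g : csqint leb f -> csqint leb g -> f =ae g -> nrm f = nrm g.
Proof.
move=> cf cg fg; rewrite /nrm (rip_ae cf cg cf fg) ripC (rip_ae cf cg cg fg)//.
Qed.

Lemma nrm0_ae f : csqint leb f -> nrm f = 0 -> f =ae (fun=> 0).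
Proof. exact: rip_eq0. Qed.

Lemma nrm_proj0 f : csqint leb f -> nrm (P set0 f) = 0.
Proof.
move=> cf; have [mu [m1 _ _]] := spectral_mu cf.
by have := m1 set0 measurable0; rewrite measure0 => -[<-].
Qed.

Lemma nrm_projC A A' f : measurable A -> measurable A' -> csqint leb f ->
  P A f =ae f -> A' `&` A = set0 -> nrm (P A' f) = 0.
Proof.
move=> mA mA' cf Af AA'.
have cAf := proj_csqint mA cf; have c1 := proj_csqint mA' cf.
have c2 := proj_csqint mA' cAf; have c0 := proj_csqint measurable0 cf.
have e1 : P A' f =ae P A' (P A f) by exact (proj_ae mA' cf cAf (ae_eq_sym Af)).
have e2 : P A' (P A f) =ae P set0 f.
  by rewrite -AA'; exact (ae_eq_sym (projI mA' mA cf)).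
rewrite (nrm_ae c1 c2 e1) (nrm_ae c2 c0 e2); exact (nrm_proj0 cf).
Qed.

Lemma nrm_projT f : csqint leb f -> nrm (P setT f) = nrm f.
Proof. by move=> cf; exact (nrm_ae (proj_csqint measurableT cf) cf (projT cf)). Qed.

Lemma proj_idem A f : measurable A -> csqint leb f -> P A (P A f) =ae P A f.
Proof.
move=> mA cf; have := projI mA mA cf; rewrite setIid => h; exact (ae_eq_sym h).
Qed.

Lemma rip_proj A f : measurable A -> csqint leb f -> rip leb (P A f) f = nrm (P A f).
Proof.
move=> mA cf; have cA := proj_csqint mA cf; have cAA := proj_csqint mA cA.
rewrite /nrm (proj_sym mA cf cA) (ripC leb f).
exact (rip_ae cA cAA cf (ae_eq_sym (proj_idem mA cf))).
Qed.

Lemma nrm_sub_proj A f : measurable A -> csqint leb f ->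
  nrm (fun x => f x - P A f x) = nrm f - nrm (P A f).
Proof.
move=> mA cf; have cA := proj_csqint mA cf; have c := csqintB cf cA.
have e2 := rip_proj mA cf.
have h1 : rip leb (P A f) (fun x => f x - P A f x) = 0.
  by rewrite ripC (ripBl cf cA cA) ripC e2 /nrm subrr.
rewrite {1}/nrm (ripBl cf cA c) h1 subr0 ripC (ripBl cf cA cf) e2//.
Qed.

Lemma sub_ae f g : csqint leb f -> csqint leb g -> nrm (fun x => f x - g x) = 0 -> f =ae g.
Proof.
move=> cf cg /(nrm0_ae (csqintB cf cg)); apply: filterS => x /(_ I) /= h0 _.
by apply/eqP; rewrite -subr_eq0 h0.
Qed.

(** Additivity of the spectral measure gives |P A f| = |f|, and |f - P A f|^2 = |f|^2 - |P A f|^2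
    because [P A] is an orthogonal projection. *)
Lemma proj_nrm_compl A f : measurable A -> csqint leb f -> nrm (P (~` A) f) = 0 -> P A f =ae f.
Proof.
move=> mA cf h; have [mu [m1 _ _]] := spectral_mu cf.
have mAc := measurableC mA.
have e : nrm (P A f) = nrm f.
  have : mu setT = (nrm f)%:E by rewrite (m1 _ measurableT) (nrm_projT cf).
  have hU : mu (A `|` ~` A) = (mu A + mu (~` A))%E by exact: (measureU _ mA mAc (setICr A)).
  rewrite -(setUv A) hU (m1 _ mA) (m1 _ mAc) h adde0.
  by case.
apply: ae_eq_sym; apply: (sub_ae cf (proj_csqint mA cf)).
by rewrite (nrm_sub_proj mA cf) e subrr.
Qed.

(** The spectral measure of [f] is finite and carried by [a, b], so it has a finite second moment
    and its first moment lies between a and b times its mass. *)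
Lemma spectral_dom (a b : R) f : csqint leb f -> P `[a, b] f =ae f ->
  exists g, [/\ landau B f g, a * nrm f <= rip leb f g & rip leb f g <= b * nrm f].
Proof.
move=> cf fab; have [mu [m1 m2 m3]] := spectral_mu cf.
have mT : mu setT = (nrm f)%:E by rewrite (m1 _ measurableT) (nrm_projT cf).
have muT : (mu setT < +oo)%E by rewrite mT ltry.
have mI : measurable (`[a, b]%classic : set mR) by [].
have mIc := measurableC mI.
have muab : mu (~` `[a, b]) = 0%E.
  by rewrite (m1 _ mIc) (nrm_projC mI mIc cf fab (setICl _)).
have [g fg] := m2 (bounded_support_sqr muT muab).
exists g; rewrite (m3 _ fg); have := bounded_support_mean muT muab.
by rewrite mT /= => /andP[].
Qed.

(** On the range of the projector of [-n, -1/(n+1)] the form <u, H u> is nonnegative by [landau_ge0]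
    and at most -|u|^2 / (n+1), so this range is trivial. Compact intervals make [spectral_dom]
    applicable, and countably many of them exhaust the negative axis. *)
Lemma spectral_neg0 f : csqint leb f -> nrm (P `]-oo, 0[ f) = 0.
Proof.
move=> cf; have [mu [m1 m2 m3]] := spectral_mu cf.
pose An (n : nat) : set mR := `[(- n%:R)%R, (- n.+1%:R^-1)%R]%classic.
have mA n : measurable (An n) by exact: measurable_itv.
have A0 n : mu (An n) = 0%E.
  have cA := proj_csqint (mA n) cf.
  rewrite (m1 _ (mA n)); congr EFin.
  have [g [lg _ h2]] := spectral_dom cA (proj_idem (mA n) cf).
  have h := landau_ge0 lg.
  have n0 : (0 : R) < n.+1%:R^-1 by rewrite invr_gt0 ltr0n.
  apply/eqP; rewrite eq_le rip_ge0 andbT leNgt; apply/negP => N0.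
  by have := mulr_gt0 n0 N0; move: (le_trans h h2); rewrite mulNr oppr_ge0 leNgt => /negbTE ->.
have mN : measurable (`]-oo, (0:R)[%classic : set mR) by [].
pose N0 : set mR := `]-oo, 0[%classic.
have : (mu N0 <= 0)%E.
  apply: (le_trans (measure_sigma_subadditive mu mA mN _)).
    move=> x /=; rewrite in_itv /= => x0.
    have [n nx] : exists n : nat, - x <= n%:R by exists (Num.truncn (- x)).+1; rewrite ltW// truncnS_gt.
    have [m mx] : exists m : nat, (- x)^-1 <= m.+1%:R by exists (Num.truncn ((- x)^-1)); rewrite ltW// truncnS_gt.
    exists (maxn n m) => //=; rewrite /An /= in_itv /=; apply/andP; split.
      by rewrite lerNl (le_trans nx)// ler_nat leq_maxl.
    rewrite lerNr -[leRHS]invrK lef_pV2 ?posrE ?invr_gt0 ?oppr_gt0 ?ltr0n//.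
    by rewrite (le_trans mx)// ler_nat ltnS leq_maxr.
  by rewrite eseries0// => i _ _; exact: A0.
by rewrite (m1 _ mN) lee_fin => h; apply/eqP; rewrite eq_le h rip_ge0.
Qed.

Lemma spectral_ge0_range (E : R) f : csqint leb f -> P `]-oo, E] f =ae f -> P `[0, E] f =ae f.
Proof.
move=> cf fE.
have mI : measurable (`[0, E]%classic : set mR) by [].
have mE : measurable (`]-oo, E]%classic : set mR) by [].
have mN : measurable (`]-oo, (0:R)[%classic : set mR) by [].
have mEc := measurableC mE; have mIc := measurableC mI.
apply: (proj_nrm_compl mI cf).
have [mu [m1 m2 m3]] := spectral_mu cf.
have h1 := spectral_neg0 cf.
have h2 := nrm_projC mE mEc cf fE (setICl _).
pose I0 : set mR := `[0, E]%classic.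
pose J0 : set mR := `]-oo, E]%classic.
pose N0 : set mR := `]-oo, 0[%classic.
have : (mu (~` I0) <= mu (~` J0 `|` N0))%E.
  apply: le_measure; rewrite ?inE//; first exact: measurableU.
  move=> x; rewrite /I0 /J0 /N0 /= !in_itv /=.
  by have [x0|x0] := ltP x 0; [right|left].
have h3 : (mu (~` J0 `|` N0) <= mu (~` J0) + mu N0)%E by exact: (measureU2 _ mEc mN).
rewrite (m1 (~` J0) mEc) (m1 N0 mN) h1 h2 adde0 in h3.
move=> h4; have := le_trans h4 h3; rewrite (m1 (~` I0) mIc) lee_fin => h.
by apply/eqP; rewrite eq_le h rip_ge0.
Qed.

End SpectralSubspace.

(** * Invariance of the spectral subspace and growth of the iterates *)

Section SpectralIterates.
Variables (R : realType) (B : R).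
Local Notation C := R[i].
Local Notation fct := (plane R -> C).
Local Notation leb := (leb2 R).
Local Notation mR := (measurableTypeR R).
Variable P : set R -> fct -> fct.
Hypothesis hP : spectral_measure_of (landau B) P.
Implicit Types (f g h : fct) (A : set mR).
Local Notation nrm f := (rip leb f f).
Local Notation "f =ae g" := (f = g %[ae leb]) (at level 70).

Let zeroC (x : plane R) : C := 0.

Lemma csqint0 : csqint leb zeroC.
Proof. by split; split; rewrite /zeroC //=; under eq_fun do rewrite expr0n /=; exact: integrable0. Qed.

Lemma rip0r f : rip leb f zeroC = 0.
Proof.
by rewrite /rip /Rintegral integral0_eq// => x _; rewrite /rdot !mulr0 addr0.
Qed.

Lemma proj_zero A : measurable A -> P A zeroC =ae zeroC.
Proof.
move=> mA; have c := proj_csqint hP mA csqint0.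
by apply: (nrm0_ae c); rewrite -(rip_proj hP mA csqint0) rip0r.
Qed.

Lemma proj_comm0 A A' h : measurable A -> measurable A' -> csqint leb h ->
  P A h =ae zeroC -> P A (P A' h) =ae zeroC.
Proof.
move=> mA mA' ch h0; have cA := proj_csqint hP mA ch.
have e1 := projI hP mA mA' ch; rewrite setIC in e1.
apply: ae_eq_trans (ae_eq_sym e1) _.
apply: ae_eq_trans (projI hP mA' mA ch) _.
apply: ae_eq_trans (proj_ae hP mA' cA csqint0 h0) _.
exact: proj_zero.
Qed.

Lemma proj_mono A A' f : measurable A -> measurable A' -> A `<=` A' -> csqint leb f ->
  P A f =ae f -> P A' f =ae f.
Proof.
move=> mA mA' AA' cf Af; have cA := proj_csqint hP mA cf.
apply: ae_eq_trans (proj_ae hP mA' cf cA (ae_eq_sym Af)) _.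
apply: ae_eq_trans (ae_eq_sym (projI hP mA' mA cf)) _.
by rewrite setIidr.
Qed.

(** Spectral projectors commute, so after projecting with any [A'] the vector h is still annihilated
    by [P A], hence orthogonal to f = P A f. *)
Lemma rip_proj_ortho A A' f h : measurable A -> measurable A' -> csqint leb f -> csqint leb h ->
  P A f =ae f -> P A h =ae zeroC -> rip leb (P A' f) (P A' h) = 0.
Proof.
move=> mA mA' cf ch Af Ah; have cA := proj_csqint hP mA cf.
have c1 := proj_csqint hP mA' cf; have c2 := proj_csqint hP mA' ch.
have c3 := proj_csqint hP mA' c2; have c4 := proj_csqint hP mA c3.
rewrite (proj_sym hP mA' cf c2) (rip_ae cf cA c3 (ae_eq_sym Af)) (proj_sym hP mA cf c3) ripC.
rewrite (rip_ae c4 csqint0 cf); last first.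
  apply: proj_comm0 => //; exact: proj_comm0.
by rewrite ripC rip0r.
Qed.

Lemma nrmD f h : csqint leb f -> csqint leb h ->
  nrm (fun x => f x + h x) = nrm f + 2 * rip leb f h + nrm h.
Proof.
move=> cf ch; have cs := csqintD cf ch.
rewrite (ripDl cf ch cs) (ripC leb f) (ripC leb h) (ripDl cf ch cf) (ripDl cf ch ch).
rewrite (ripC leb h f); ring.
Qed.

Lemma spectral_mu_integrable (mu : {measure set mR -> \bar R}) (N : R) f :
  csqint leb f -> (forall A, measurable A -> mu A = (nrm (P A f))%:E) ->
  P `[- N, N] f =ae f -> mu.-integrable setT (fun x => x%:E).
Proof.
move=> cf m1 fN.
have mJ : measurable (`[- N, N]%classic : set mR) by exact: measurable_itv.
have mJc := measurableC mJ.
apply: (bounded_support_integrable_id (a := - N) (b := N)).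
  by rewrite (m1 _ measurableT) ltry.
by rewrite (m1 _ mJc) (nrm_projC hP mJ mJc cf fN (setICl _)).
Qed.

(** The spectral measure gives access to diagonal values <u, H u> only, and commutation of H with
    [P] has to be derived. As f and h lie in complementary spectral subspaces, mu_(f+h) = mu_f +
    mu_h, so the cross terms of <f + h, H (f + h)> cancel; by symmetry each of them vanishes. *)
Lemma landau_ortho_dom (E N : R) f g h k : 0 <= N -> E <= N ->
  csqint leb f -> P `[0, E] f =ae f -> landau B f g ->
  csqint leb h -> P `[0, E] h =ae zeroC -> P `[- N, N] h =ae h -> landau B h k ->
  rip leb h g = 0.
Proof.
move=> N0 EN cf fE lfg ch h0 hN lhk.
have mE : measurable (`[0, E]%classic : set mR) by exact: measurable_itv.
have mJ : measurable (`[- N, N]%classic : set mR) by exact: measurable_itv.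
have fJ : P `[- N, N] f =ae f.
  apply: (proj_mono mE mJ _ cf fE) => x /=; rewrite !in_itv /= => /andP[x0 xE].
  by apply/andP; split; [rewrite (le_trans _ x0)// oppr_le0|rewrite (le_trans xE)].
have cs := csqintD cf ch.
have sJ : P `[- N, N] (fun x => f x + h x) =ae (fun x => f x + h x).
  apply: ae_eq_trans (projD hP mJ cf ch) _.
  by apply: filterS2 fJ hN => x e1 e2 /[dup] /e1 -> /e2 ->.
have [g' [ls _ _]] := spectral_dom hP cs sJ.
have [mf [mf1 _ mf3]] := spectral_mu hP cf.
have [mh [mh1 _ mh3]] := spectral_mu hP ch.
have [ms [ms1 _ ms3]] := spectral_mu hP cs.
have add A : measurable A -> ms A = measure_add mf mh A.
  move=> mA; rewrite measure_addE (ms1 _ mA) (mf1 _ mA) (mh1 _ mA) -EFinD; congr EFin.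
  have c1 := proj_csqint hP mA cf; have c2 := proj_csqint hP mA ch.
  rewrite (nrm_ae (proj_csqint hP mA cs) (csqintD c1 c2) (projD hP mA cf ch)) (nrmD c1 c2).
  by rewrite (rip_proj_ortho mE mA cf ch fE h0) mulr0 addr0.
have if_ := spectral_mu_integrable cf mf1 fJ.
have ih := spectral_mu_integrable ch mh1 hN.
have e : rip leb (fun x => f x + h x) g' = rip leb f g + rip leb h k.
  rewrite (ms3 _ ls) (mf3 _ lfg) (mh3 _ lhk) /Rintegral.
  rewrite (eq_measure_integral (measure_add mf mh)); last by move=> A mA _; exact: add.
  rewrite integral_measure_add//= fineD//; exact: integrable_fin_num.
have [_ cg _] := landauP lfg; have [_ ck _] := landauP lhk; have [_ cg' _] := landauP ls.
rewrite (ripDl cf ch cg') in e.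
(* The value g' of H at f + h is never identified with g + k; symmetry moves H back to f and to
   h. *)
rewrite (landau_sym lfg ls) (landau_sym lhk ls) in e.
rewrite (ripC leb g) (ripC leb k) (ripDl cf ch cg) (ripDl cf ch ck) in e.
have e2 := landau_sym lfg lhk.
rewrite (ripC leb g) in e2.
lra.
Qed.

Lemma proj_approx h : csqint leb h ->
  nrm (fun x => h x - P `[- n%:R, n%:R] h x) @[n --> \oo] --> 0.
Proof.
move=> ch; have [mu [m1 _ _]] := spectral_mu hP ch.
pose J (n : nat) : set mR := `[(- n%:R)%R, n%:R%R]%classic.
have mJ n : measurable (J n) by exact: measurable_itv.
have UJ : \bigcup_n J n = setT.
  apply/seteqP; split=> // x _; exists (Num.truncn `|x|).+1 => //.
  rewrite /J /= in_itv /= -ler_norml; apply/ltW; exact: truncnS_gt.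
have : mu (J n) @[n --> \oo] --> mu (\bigcup_n J n).
  apply: nondecreasing_cvg_mu => //; first by rewrite UJ.
  move=> n m nm; apply/subsetPset => x; rewrite /J /= !in_itv /= => /andP[h1 h2].
  have nm' : n%:R <= m%:R :> R by rewrite ler_nat.
  by apply/andP; split; [rewrite (le_trans _ h1)// lerN2|rewrite (le_trans h2)].
rewrite UJ (m1 _ measurableT) (nrm_projT hP ch).
under eq_fun do rewrite (m1 _ (mJ _)).
move=> /fine_cvgP[_ /= hc].
under eq_fun do rewrite (nrm_sub_proj hP (mJ _) ch).
rewrite -(subrr (nrm h)); apply: cvgB; [exact: cvg_cst|exact: hc].
Qed.

(** A general h need not lie in the domain of H. Its truncations to the spectral window [-n, n] do,
    stay orthogonal to the subspace of f, and converge to h. *)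
Lemma landau_ortho (E : R) f g h : 0 <= E ->
  csqint leb f -> P `[0, E] f =ae f -> landau B f g ->
  csqint leb h -> P `[0, E] h =ae zeroC -> rip leb h g = 0.
Proof.
move=> E0 cf fE lfg ch h0.
have [_ cg _] := landauP lfg.
pose J (n : nat) : set mR := `[(- n%:R)%R, n%:R%R]%classic.
have mJ n : measurable (J n) by exact: measurable_itv.
have mE : measurable (`[0, E]%classic : set mR) by exact: measurable_itv.
have cJ n := proj_csqint hP (mJ n) ch.
have lim : rip leb g (P (J n) h) @[n --> \oo] --> rip leb g h.
  apply: (csqint_cont_rip cg cJ ch).
  have e n : rip leb (fun x => P (J n) h x - h x) (fun x => P (J n) h x - h x) =
     nrm (fun x => h x - P (J n) h x).
    by apply: eq_Rintegral => x _; rewrite /rdot; case: (h x) => ? ?; case: (P (J n) h x) => ? ? /=; ring.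
  by under eq_fun do rewrite e; exact: proj_approx.
have : \forall n \near \oo, rip leb g (P (J n) h) = 0.
  have [m Em] : exists m : nat, E <= m%:R by exists (Num.truncn E).+1; rewrite ltW// truncnS_gt.
  exists m => // n /= mn.
  have hn := proj_idem hP (mJ n) ch.
  have [k [lk _ _]] := spectral_dom hP (cJ n) hn.
  rewrite ripC; apply: (landau_ortho_dom (ler0n R n) _ cf fE lfg (cJ n) _ hn lk).
    by rewrite (le_trans Em)// ler_nat.
  exact: proj_comm0.
move=> z; rewrite ripC; apply/esym.
apply: cvg_unique lim => //.
apply: cvg_near_cst; exact: z.
Qed.

(** The part g - P g of g is annihilated by the projector, hence orthogonal to g by [landau_ortho]
    and to P g by symmetry of the projector; its norm is therefore 0. *)
Lemma landau_range (E : R) f g : 0 <= E ->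
  csqint leb f -> P `[0, E] f =ae f -> landau B f g -> P `[0, E] g =ae g.
Proof.
move=> E0 cf fE lfg; have [_ cg _] := landauP lfg.
have mE : measurable (`[0, E]%classic : set mR) by exact: measurable_itv.
have cPg := proj_csqint hP mE cg.
have ch := csqintB cg cPg.
have h0 : P `[0, E] (fun x => g x - P `[0, E] g x) =ae zeroC.
  have e : (fun x => g x - P `[0, E] g x) = (fun x => (-1)%:C%C * P `[0, E] g x + g x).
    by apply/funext => x; rewrite rmorphN rmorph1 mulN1r addrC.
  apply: (eq_ind_r (fun z => P `[0, E] z =ae zeroC) _ e).
  apply: ae_eq_trans (projZ hP (-1) mE cPg cg) _.
  apply: filterS (proj_idem hP mE cg) => x /[apply] ->.
  by rewrite rmorphN rmorph1 mulN1r addNr.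
have o1 := landau_ortho E0 cf fE lfg ch h0.
have o2 : rip leb (fun x => g x - P `[0, E] g x) (P `[0, E] g) = 0.
  have c1 := proj_csqint hP mE ch.
  by rewrite -(proj_sym hP mE ch cg) (rip_ae c1 csqint0 cg h0) ripC rip0r.
apply: ae_eq_sym; apply: (sub_ae cg cPg).
rewrite (ripBl cg cPg ch) (ripC leb g) (ripC leb (P _ _)) o1 o2 subrr//.
Qed.

(** Only 0 <= <u, H u> <= E |u|^2 is available. Nonnegativity at u = f - g / E expands to 0 <= <f,
    g> - 2 |g|^2 / E + <g, H g> / E^2, and the upper bounds for <f, g> and <g, H g> leave |g|^2 <=
    E^2 |f|^2. *)
Lemma landau_norm_le (E : R) f g : 0 < E ->
  csqint leb f -> P `[0, E] f =ae f -> landau B f g -> nrm g <= E ^+ 2 * nrm f.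
Proof.
move=> E0 cf fE lfg; have [_ cg _] := landauP lfg.
have mE : measurable (`[0, E]%classic : set mR) by exact: measurable_itv.
have gE := landau_range (ltW E0) cf fE lfg.
have [g2 [lg _ g2E]] := spectral_dom hP cg gE.
have [g1 [lf _ fE']] := spectral_dom hP cf fE.
have [_ cg2 _] := landauP lg; have [_ cg1 _] := landauP lf.
have fg : rip leb f g <= E * nrm f.
  by rewrite (landau_sym lf lfg) ripC.
pose a := - E^-1.
pose u x := a%:C%C * g x + f x.
have cag := csqintZ a cg.
have cu : csqint leb u := csqintD cag cf.
have uE : P `[0, E] u =ae u.
  apply: ae_eq_trans (projZ hP a mE cg cf) _.
  by apply: filterS2 gE fE => x e1 e2 /[dup] /e1 -> /e2 ->.
have [k [lk _ _]] := spectral_dom hP cu uE.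
have [_ ck _] := landauP lk.
have := landau_ge0 lk.
rewrite (ripDl cag cf ck) (ripZl a cg ck) (landau_sym lfg lk) (landau_sym lg lk).
rewrite (ripC leb g) (ripC leb g2) !(ripDl cag cf) // !(ripZl a cg) //.
rewrite (ripC leb f g2) -(landau_sym lg lfg) => h.
have h2 : 0 <= a * (a * (E * nrm g) + nrm g) + (a * nrm g + E * nrm f).
  apply: (le_trans h); rewrite lerD ?lerD2l//.
  have a0 : a < 0 by rewrite oppr_lt0 invr_gt0.
  rewrite ler_nM2l// lerD2r ler_nM2l//.
have Ei : E * E^-1 = 1 by rewrite divff ?gt_eqF.
have : 0 <= E * (a * (a * (E * nrm g) + nrm g) + (a * nrm g + E * nrm f)) by rewrite mulr_ge0// ltW.
have -> : E * (a * (a * (E * nrm g) + nrm g) + (a * nrm g + E * nrm f)) = E ^+ 2 * nrm f - nrm g.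
  rewrite /a; field; rewrite gt_eqF //.
by rewrite subr_ge0.
Qed.

Lemma landau_iterates (E : R) f : 0 < E -> csqint leb f -> P `[0, E] f =ae f ->
  exists s : nat -> fct, [/\ s 0%N = f, forall k, landau B (s k) (s k.+1) &
    forall k, nrm (s k) <= (E ^+ k) ^+ 2 * nrm f].
Proof.
move=> E0 cf fE.
pose V h := csqint leb h /\ P `[0, E] h =ae h.
(* The choice function must be total, so outside the subspace it returns the default value h. *)
have next h : exists g, V h -> landau B h g /\ V g.
  have [[ch hE]|nV] := pselect (V h); last by exists h.
  have [g [lhg _ _]] := spectral_dom hP ch hE.
  have [_ cg _] := landauP lhg.
  by exists g => _; split=> //; split=> //; exact: landau_range (ltW E0) ch hE lhg.
have [N hN] := choice next.
pose s k := iter k N f.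
have Vs k : V (s k) by elim: k => [|k /hN[]].
exists s; split; first by [].
- by move=> k; exact (hN _ (Vs k)).1.
- elim=> [|k IH]; first by rewrite expr0 expr1n mul1r.
  have [lk _] := hN _ (Vs k); have [ck kE] := Vs k.
  apply: (le_trans (landau_norm_le E0 ck kE lk)).
  by rewrite [E ^+ k.+1]exprS exprMn -[leRHS]mulrA ler_pM2l ?exprn_gt0.
Qed.

End SpectralIterates.

Section SpectralRangeIterates.
Variables (R : realType) (B : R).
Local Notation leb := (leb2 R).

Lemma spectral_range_iterates (E : R) (f : plane R -> R[i]) : 0 < E ->
  spectral_range (landau B) `]-oo, E] f ->
  csqint leb f /\ exists s : nat -> plane R -> R[i],
    [/\ s 0%N = f, forall k, landau B (s k) (s k.+1) &
      forall k, rip leb (s k) (s k) <= (E ^+ k) ^+ 2 * rip leb f f].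
Proof.
move=> E0 [/L2_csqint cf [P hP [g /L2_csqint cg fPg]]]; split=> //.
have mE : measurable (`]-oo, E]%classic : set (measurableTypeR R)) by exact: measurable_itv.
have cP := proj_csqint hP mE cg.
have fE : P `]-oo, E]%classic f = f %[ae leb].
  apply: ae_eq_trans (proj_ae hP mE cf cP fPg) _.
  by apply: ae_eq_trans (proj_idem hP mE cg) _; exact: ae_eq_sym.
exact: (landau_iterates hP E0 cf (spectral_ge0_range hP cf fE)).
Qed.
End SpectralRangeIterates.

(** * The Mehler kernel *)

Section GaussianKernel.
Variables (R : realType) (B : R).
Implicit Types (al a th : R) (x y : R * R).

(** The bilinear term is the phase of the magnetic translation by x, which recentres the vector
    potential at x. The constant th rotates the kernel, so that [rip] reads off any real component
    of a complex pairing. *)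
Definition phase th x y : R := th + B / 2 * (x.1 * y.2 - x.2 * y.1).

Definition gcos al th x y : R := expR (- al * sqdist x y) * cos (phase th x y).
Definition gsin al th x y : R := expR (- al * sqdist x y) * sin (phase th x y).
Definition gker al th x y : R[i] := Complex (gcos al th x y) (gsin al th x y).

Lemma is_derive_gcos1 al th x y : is_derive y (e1 R) (gcos al th x)
  (- (2 * al * (y.1 - x.1)) * gcos al th x y + B / 2 * x.2 * gsin al th x y).
Proof.
apply/is_derive_slice1; rewrite /gcos /gsin /sqdist /phase /=.
apply: is_derive_eq; rewrite /GRing.scale /=; ring.
Qed.

Lemma is_derive_gsin1 al th x y : is_derive y (e1 R) (gsin al th x)
  (- (2 * al * (y.1 - x.1)) * gsin al th x y - B / 2 * x.2 * gcos al th x y).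
Proof.
apply/is_derive_slice1; rewrite /gcos /gsin /sqdist /phase /=.
apply: is_derive_eq; rewrite /GRing.scale /=; ring.
Qed.

Lemma is_derive_gcos2 al th x y : is_derive y (e2 R) (gcos al th x)
  (- (2 * al * (y.2 - x.2)) * gcos al th x y - B / 2 * x.1 * gsin al th x y).
Proof.
apply/is_derive_slice2; rewrite /gcos /gsin /sqdist /phase /=.
apply: is_derive_eq; rewrite /GRing.scale /=; ring.
Qed.

Lemma is_derive_gsin2 al th x y : is_derive y (e2 R) (gsin al th x)
  (- (2 * al * (y.2 - x.2)) * gsin al th x y + B / 2 * x.1 * gcos al th x y).
Proof.
apply/is_derive_slice2; rewrite /gcos /gsin /sqdist /phase /=.
apply: is_derive_eq; rewrite /GRing.scale /=; ring.
Qed.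

Lemma continuous_sqdist x : continuous (sqdist x).
Proof.
move=> y; apply: cvgD; apply: cvgM; apply: cvgB; try exact: cvg_cst;
  solve [exact: continuous_fst_plane|exact: continuous_snd_plane].
Qed.

Lemma continuous_phase th x : continuous (phase th x).
Proof.
move=> y; apply: cvgD; first exact: cvg_cst.
apply: cvgM; first exact: cvg_cst.
apply: cvgB; apply: cvgM; try exact: cvg_cst;
  solve [exact: continuous_fst_plane|exact: continuous_snd_plane].
Qed.

Lemma continuous_gexp al x : continuous (fun y => expR (- al * sqdist x y)).
Proof.
move=> y; have h : {for y, continuous (fun y => - al * sqdist x y)}.
  by apply: cvgM; [exact: cvg_cst|exact: continuous_sqdist].
exact: (continuous_comp h (@continuous_expR R _)).
Qed.

Lemma continuous_gcos al th x : continuous (gcos al th x).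
Proof.
move=> y; apply: cvgM; first exact: continuous_gexp.
have h : {for y, continuous (phase th x)} by exact: continuous_phase.
exact: (continuous_comp h (@continuous_cos R _)).
Qed.

Lemma continuous_gsin al th x : continuous (gsin al th x).
Proof.
move=> y; apply: cvgM; first exact: continuous_gexp.
have h : {for y, continuous (phase th x)} by exact: continuous_phase.
exact: (continuous_comp h (@continuous_sin R _)).
Qed.

Let cst_mul_fst (c d : R) : continuous (fun y : R * R => c * (y.1 - d)).
Proof.
move=> y; apply: cvgM; first exact: cvg_cst.
by apply: cvgB; [exact: continuous_fst_plane|exact: cvg_cst].
Qed.

Let cst_mul_snd (c d : R) : continuous (fun y : R * R => c * (y.2 - d)).
Proof.
move=> y; apply: cvgM; first exact: cvg_cst.
by apply: cvgB; [exact: continuous_snd_plane|exact: cvg_cst].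
Qed.

Let neg_mul_fst (c d : R) : continuous (fun y : R * R => - (c * (y.1 - d))).
Proof. by move=> y; apply: cvgN; exact: cst_mul_fst. Qed.

Let neg_mul_snd (c d : R) : continuous (fun y : R * R => - (c * (y.2 - d))).
Proof. by move=> y; apply: cvgN; exact: cst_mul_snd. Qed.

Let cstc (c : R) : continuous (fun y : R * R => c).
Proof. by move=> y; exact: cvg_cst. Qed.

Lemma C1_gcos al th x : C1 (gcos al th x).
Proof.
split.
- apply: (C1dir_derive (@continuous_gcos al th x) _ (is_derive_gcos1 al th x)).
  exact (continuous_addf (continuous_mulf (@neg_mul_fst _ _) (@continuous_gcos al th x))
    (continuous_mulf (@cstc _) (@continuous_gsin al th x))).
- apply: (C1dir_derive (@continuous_gcos al th x) _ (is_derive_gcos2 al th x)).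
  move=> y; apply: cvgB.
    exact (continuous_mulf (@neg_mul_snd _ _) (@continuous_gcos al th x) (x := y)).
  exact (continuous_mulf (@cstc _) (@continuous_gsin al th x) (x := y)).
Qed.

Lemma C1_gsin al th x : C1 (gsin al th x).
Proof.
split.
- apply: (C1dir_derive (@continuous_gsin al th x) _ (is_derive_gsin1 al th x)).
  move=> y; apply: cvgB.
    exact (continuous_mulf (@neg_mul_fst _ _) (@continuous_gsin al th x) (x := y)).
  exact (continuous_mulf (@cstc _) (@continuous_gcos al th x) (x := y)).
- apply: (C1dir_derive (@continuous_gsin al th x) _ (is_derive_gsin2 al th x)).
  exact (continuous_addf (continuous_mulf (@neg_mul_snd _ _) (@continuous_gsin al th x))
    (continuous_mulf (@cstc _) (@continuous_gcos al th x))).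
Qed.

(** The product of p + i q with [gker]. This class is stable under both magnetic derivatives, so the
    second-order expression follows by applying one rule twice. *)
Definition pgker (p q : R * R -> R) al th x y : R[i] :=
  Complex (p y * gcos al th x y - q y * gsin al th x y)
          (p y * gsin al th x y + q y * gcos al th x y).

Lemma cC1_pgker p q al th x : C1 p -> C1 q -> cC1 (pgker p q al th x).
Proof.
move=> cp cq; have c := C1_gcos al th x; have s := C1_gsin al th x; split.
- exact (C1D (C1M cp c) (C1N (C1M cq s))).
- exact (C1D (C1M cp s) (C1M cq c)).
Qed.

Lemma magnetic_d1_pgker p q (p1 q1 : R * R -> R) al th x :
  (forall y, is_derive y (e1 R) p (p1 y)) -> (forall y, is_derive y (e1 R) q (q1 y)) ->
  magnetic_d1 B (pgker p q al th x) =
  pgker (fun y => - q1 y + p y * (- (B / 2) * (y.2 - x.2)) - q y * (- (2 * al) * (y.1 - x.1)))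
        (fun y => p1 y + p y * (- (2 * al) * (y.1 - x.1)) + q y * (- (B / 2) * (y.2 - x.2))) al th x.
Proof.
move=> dp dq; apply/funext => y.
have hc := is_derive_gcos1 al th x y; have hs := is_derive_gsin1 al th x y.
have h1 := is_deriveB (is_deriveM (dp y) hc) (is_deriveM (dq y) hs).
have h2 := is_deriveD (is_deriveM (dp y) hs) (is_deriveM (dq y) hc).
apply/eqP; rewrite eq_complex Re_magnetic_d1 Im_magnetic_d1 /=; apply/andP; split; apply/eqP.
- by rewrite (@derive_val _ _ _ _ _ _ _ h2) /GRing.scale /=; ring.
- by rewrite (@derive_val _ _ _ _ _ _ _ h1) /GRing.scale /=; ring.
Qed.

Lemma magnetic_d2_pgker p q (p1 q1 : R * R -> R) al th x :
  (forall y, is_derive y (e2 R) p (p1 y)) -> (forall y, is_derive y (e2 R) q (q1 y)) ->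
  magnetic_d2 B (pgker p q al th x) =
  pgker (fun y => - q1 y + p y * (B / 2 * (y.1 - x.1)) - q y * (- (2 * al) * (y.2 - x.2)))
        (fun y => p1 y + p y * (- (2 * al) * (y.2 - x.2)) + q y * (B / 2 * (y.1 - x.1))) al th x.
Proof.
move=> dp dq; apply/funext => y.
have hc := is_derive_gcos2 al th x y; have hs := is_derive_gsin2 al th x y.
have h1 := is_deriveB (is_deriveM (dp y) hc) (is_deriveM (dq y) hs).
have h2 := is_deriveD (is_deriveM (dp y) hs) (is_deriveM (dq y) hc).
apply/eqP; rewrite eq_complex Re_magnetic_d2 Im_magnetic_d2 /=; apply/andP; split; apply/eqP.
- by rewrite (@derive_val _ _ _ _ _ _ _ h2) /GRing.scale /=; ring.
- by rewrite (@derive_val _ _ _ _ _ _ _ h1) /GRing.scale /=; ring.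
Qed.

Let aff1 (c d y1 : R) : C1 (fun y : R * R => c * (y.1 - d)).
Proof. exact (C1M (C1_cst c) (C1D (C1_fst R) (C1_cst (- d)))). Qed.

Let aff2 (c d y1 : R) : C1 (fun y : R * R => c * (y.2 - d)).
Proof. exact (C1M (C1_cst c) (C1D (C1_snd R) (C1_cst (- d)))). Qed.

Lemma gker_pgker al th x : gker al th x = pgker (fun=> 1) (fun=> 0) al th x.
Proof. by apply/funext => y; rewrite /gker /pgker mul0r subr0 !mul1r mul0r addr0. Qed.

Lemma eq_pgker p q p' q' al th x : (forall y, p y = p' y) -> (forall y, q y = q' y) ->
  pgker p q al th x = pgker p' q' al th x.
Proof. by move=> /funext -> /funext ->. Qed.

Lemma magnetic_d1_gker al th x : magnetic_d1 B (gker al th x) =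
  pgker (fun y => - (B / 2) * (y.2 - x.2)) (fun y => - (2 * al) * (y.1 - x.1)) al th x.
Proof.
rewrite gker_pgker (@magnetic_d1_pgker _ _ (fun=> 0) (fun=> 0)).
by apply: eq_pgker => y; ring.
Qed.

Lemma magnetic_d2_gker al th x : magnetic_d2 B (gker al th x) =
  pgker (fun y => B / 2 * (y.1 - x.1)) (fun y => - (2 * al) * (y.2 - x.2)) al th x.
Proof.
rewrite gker_pgker (@magnetic_d2_pgker _ _ (fun=> 0) (fun=> 0)).
by apply: eq_pgker => y; ring.
Qed.

Lemma gker_C1 al th x :
  [/\ cC1 (gker al th x), cC1 (magnetic_d1 B (gker al th x)) & cC1 (magnetic_d2 B (gker al th x))].
Proof.
rewrite magnetic_d1_gker magnetic_d2_gker gker_pgker; split.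
- exact (cC1_pgker al th x (C1_cst _) (C1_cst _)).
- exact (cC1_pgker al th x (aff2 _ _ 0) (aff1 _ _ 0)).
- exact (cC1_pgker al th x (aff1 _ _ 0) (aff2 _ _ 0)).
Qed.

(** Centred at x, the Landau operator is the Laplacian with a harmonic potential plus an angular
    momentum term, and the latter annihilates radial functions; only the radial multiplier of a
    harmonic oscillator is left. *)
Lemma landau_expr_gker al th x y : landau_expr B (gker al th x) y =
  ((4 * al + (B ^+ 2 / 4 - 4 * al ^+ 2) * sqdist x y)%:C)%C * gker al th x y.
Proof.
rewrite /landau_expr magnetic_d1_gker magnetic_d2_gker.
have h1 z : is_derive z (e1 R) (fun y : R * R => - (B / 2) * (y.2 - x.2)) 0.
  by apply/is_derive_slice1 => /=; exact: is_derive_cst.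
have h2 z : is_derive z (e1 R) (fun y : R * R => - (2 * al) * (y.1 - x.1)) (- (2 * al)).
  by apply/is_derive_slice1 => /=; apply: is_derive_eq; rewrite /GRing.scale /=; ring.
have h3 z : is_derive z (e2 R) (fun y : R * R => B / 2 * (y.1 - x.1)) 0.
  by apply/is_derive_slice2 => /=; exact: is_derive_cst.
have h4 z : is_derive z (e2 R) (fun y : R * R => - (2 * al) * (y.2 - x.2)) (- (2 * al)).
  by apply/is_derive_slice2 => /=; apply: is_derive_eq; rewrite /GRing.scale /=; ring.
rewrite (magnetic_d1_pgker al th x h1 h2) (magnetic_d2_pgker al th x h3 h4).
rewrite /pgker /gker /sqdist; apply/eqP; rewrite eq_complex /=; apply/andP; split; apply/eqP; by field.
Qed.

End GaussianKernel.

(** * Time dependence of the Mehler kernel *)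

Section HeatTime.
Variables (R : realType) (B : R).
Hypothesis B0 : 0 < B.
Implicit Types s : R.

(** With p = exp(-B s), [hal] is (B / 4) coth(B s) and [ham] is B / (4 pi sinh(B s)): the exponent
    and the amplitude of the Mehler kernel. Written as rational functions of a single exponential,
    they are within reach of [field]. *)
Definition hp s : R := expR (- B * s).
Definition hal s : R := B / 4 * (1 + hp s ^+ 2) / (1 - hp s ^+ 2).
Definition ham s : R := B / (2 * pi) * hp s / (1 - hp s ^+ 2).

Lemma hp_gt0 s : 0 < hp s. Proof. exact: expR_gt0. Qed.

Lemma hp_lt1 s : 0 < s -> hp s < 1.
Proof. by move=> s0; rewrite /hp expR_lt1 mulNr oppr_lt0 mulr_gt0. Qed.

Lemma hp2_lt1 s : 0 < s -> 0 < 1 - hp s ^+ 2.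
Proof. by move=> s0; rewrite subr_gt0 expr_lt1// ?hp_lt1// ltW// hp_gt0. Qed.

Lemma hp2E s : hp s ^+ 2 = expR (- (2 * B * s)).
Proof. by rewrite /hp -expRM_natl; congr expR; rewrite -mulr_natl; ring. Qed.

Lemma hal_ge s : 0 < s -> B / 4 <= hal s.
Proof.
move=> s0; rewrite /hal ler_pdivlMr ?hp2_lt1// ler_pM2l ?divr_gt0//.
by have := exprn_gt0 2 (hp_gt0 s); lra.
Qed.

Lemma hal_gt0 s : 0 < s -> 0 < hal s.
Proof. by move=> s0; apply: lt_le_trans (hal_ge s0); rewrite divr_gt0. Qed.

Lemma ham_gt0 s : 0 < s -> 0 < ham s.
Proof.
by move=> s0; rewrite /ham divr_gt0 ?hp2_lt1// mulr_gt0 ?hp_gt0// divr_gt0// mulr_gt0// pi_gt0.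
Qed.

Lemma hal_ge_inv s : 0 < s -> (8 * s)^-1 <= hal s.
Proof.
move=> s0; rewrite /hal ler_pdivlMr ?hp2_lt1// ler_pdivrMl ?mulr_gt0//.
have := expR_ge1Dx (- (2 * B * s)); rewrite -hp2E => h.
have := exprn_gt0 2 (hp_gt0 s) => h2.
have : 0 < B * s by rewrite mulr_gt0.
nra.
Qed.

Lemma hal_le s : 0 < s -> hal s <= (1 + 2 * B * s) / (4 * s).
Proof.
move=> s0; rewrite /hal ler_pdivrMr ?hp2_lt1// [leRHS]mulrAC ler_pdivlMr ?mulr_gt0//.
have := expR_ge1Dx (2 * B * s) => h.
have e : hp s ^+ 2 * expR (2 * B * s) = 1 by rewrite hp2E -expRD addNr expR0.
have := exprn_gt0 2 (hp_gt0 s) => h2.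
have : 0 < B * s by rewrite mulr_gt0.
have h3 : hp s ^+ 2 * (1 + 2 * B * s) <= 1 by rewrite -[leRHS]e ler_pM2l.
have h4 : 0 < 1 - hp s ^+ 2 := hp2_lt1 s0.
nra.
Qed.

(** The left-hand side is the integral of the Gaussian profile, so the mass of the kernel is 1 /
    cosh(B s): at most 1, and 1 up to (B s)^2 for small times. *)
Lemma ham_hal s : 0 < s -> ham s * pi / hal s = 2 * hp s / (1 + hp s ^+ 2).
Proof.
move=> s0; rewrite /ham /hal; move: (@pi R) (pi_gt0 R) => c c0; field.
have h1 := hp2_lt1 s0; have h2 := exprn_gt0 2 (hp_gt0 s).
by apply/and4P; split; rewrite gt_eqF// addr_gt0.
Qed.

Lemma ham_hal_le1 s : 0 < s -> ham s * pi / hal s <= 1.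
Proof.
move=> s0; rewrite ham_hal// ler_pdivrMr ?addr_gt0 ?exprn_gt0 ?hp_gt0// mul1r.
by have := sqr_ge0 (1 - hp s); nra.
Qed.

Lemma ham_hal_ge s : 0 < s -> 1 - (B * s) ^+ 2 <= ham s * pi / hal s.
Proof.
move=> s0; rewrite ham_hal// ler_pdivlMr ?addr_gt0 ?exprn_gt0 ?hp_gt0//.
have := expR_ge1Dx (- B * s); rewrite -/(hp s) => h.
have := hp_lt1 s0; have := hp_gt0 s.
have : 0 < B * s by rewrite mulr_gt0.
nra.
Qed.

Lemma is_derive_hp s : is_derive s 1 hp (- B * hp s).
Proof. rewrite /hp; apply: is_derive_eq; rewrite /GRing.scale /=; ring. Qed.

Lemma is_derive_hden s : 0 < s ->
  is_derive s 1 (fun s => (1 - hp s ^+ 2)^-1) (- (2 * B * hp s ^+ 2) / (1 - hp s ^+ 2) ^+ 2).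
Proof.
move=> s0; have h1 := hp2_lt1 s0; have h2 := is_derive_hp s.
have n0 : (fun s => 1 - hp s ^+ 2) s != 0 by rewrite gt_eqF.
have d : is_derive s 1 (fun s => 1 - hp s ^+ 2) (2 * B * hp s ^+ 2).
  by apply: is_derive_eq; rewrite /GRing.scale /=; ring.
have hd := is_deriveV (f := fun s => 1 - hp s ^+ 2) n0 d; apply: is_derive_eq; rewrite /GRing.scale /=; field.
by rewrite gt_eqF.
Qed.

(** This Riccati equation, with the linear equation for [ham], matches the two coefficients in
    [landau_expr_gker]; together they say that the time derivative of the kernel is minus H applied
    to it. *)
Lemma is_derive_hal s : 0 < s -> is_derive s 1 hal (B ^+ 2 / 4 - 4 * hal s ^+ 2).
Proof.
move=> s0; have h1 := hp2_lt1 s0; have h2 := is_derive_hp s; have h3 := is_derive_hden s0.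
have d : is_derive s 1 (fun s => B / 4 * (1 + hp s ^+ 2)) (- (B ^+ 2 / 2 * hp s ^+ 2)).
  by apply: is_derive_eq; rewrite /GRing.scale /=; field.
have hd := is_deriveM d h3; apply: is_derive_eq; rewrite /hal /GRing.scale /=; field.
by rewrite gt_eqF.
Qed.

Lemma is_derive_ham s : 0 < s -> is_derive s 1 ham (- (4 * hal s * ham s)).
Proof.
move=> s0; have h1 := hp2_lt1 s0; have h2 := is_derive_hp s; have h3 := is_derive_hden s0.
have d : is_derive s 1 (fun s => B / (2 * pi) * hp s) (- (B ^+ 2 / (2 * pi) * hp s)).
  apply: is_derive_eq; rewrite /GRing.scale /=; move: (@pi R) (pi_gt0 R) => c c0; field.
  by rewrite gt_eqF.
have hd := is_deriveM d h3; apply: is_derive_eq; rewrite /ham /hal /GRing.scale /=.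
move: (@pi R) (pi_gt0 R) => c c0; field.
by rewrite !gt_eqF.
Qed.

(* The radial profile solves the heat equation of the Landau operator. *)
Lemma is_derive_heat s (r : R) : 0 < s ->
  is_derive s 1 (fun s => ham s * expR (- hal s * r))
    (- ((4 * hal s + (B ^+ 2 / 4 - 4 * hal s ^+ 2) * r) * (ham s * expR (- hal s * r)))).
Proof.
move=> s0; have h1 := is_derive_hal s0; have h2 := is_derive_ham s0.
by apply: is_derive_eq; rewrite /GRing.scale /=; ring.
Qed.

End HeatTime.

(** * The heat equation for pairings with the kernel *)

Section HeatKernel.
Variables (R : realType) (B : R).
Hypothesis B0 : 0 < B.
Local Notation leb := (leb2 R).
Implicit Types (s al th c : R) (x y : R * R) (f g : plane R -> R[i]).

Lemma mul_expRN_le (c r : R) : 0 < c -> 0 <= r -> r * expR (- c * r) <= 2 / c * expR (- (c / 2) * r).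
Proof.
move=> c0 r0.
have e : expR (- c * r) = expR (- (c / 2) * r) * expR (- (c / 2) * r).
  by rewrite -expRD; congr expR; field.
have h := expR_ge1Dx (c / 2 * r).
have h2 : expR (- (c / 2) * r) * expR (c / 2 * r) = 1 by rewrite -expRD mulNr addNr expR0.
have h3 := expR_gt0 (- (c / 2) * r).
rewrite e mulrA ler_pM2r// mulrC.
have h4 : expR (- (c / 2) * r) * (1 + c / 2 * r) <= 1 by rewrite -[leRHS]h2 ler_pM2l.
rewrite ler_pdivlMr//; nra.
Qed.

Lemma sqint_gauss c x : 0 < c -> sqint leb (fun y => expR (- c * sqdist x y)).
Proof.
move=> c0; apply: sqintP; first exact: (measurable_plane (measurable_gauss2 c x)).
have c2 : 0 < 2 * c by rewrite mulr_gt0.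
have e : (fun y : plane R => (expR (- c * sqdist x y) ^+ 2)%:E) =
    (fun y => (expR (- (2 * c) * sqdist x y))%:E).
  by apply/funext => y; rewrite -expRM_natl; congr EFin; congr expR; rewrite -mulr_natl; ring.
by rewrite e (integral_gauss2 x c2) ltry.
Qed.

Lemma sqint_gauss_le (w : R * R -> R) c M x : 0 < c ->
  measurable_fun setT (w : plane R -> R) -> 0 <= M ->
  (forall y, `|w y| <= M * expR (- c * sqdist x y)) -> sqint leb w.
Proof.
move=> c0 mw M0 h; apply: (sqint_le mw (sqintZ M (sqint_gauss x c0))) => y.
by rewrite (le_trans (h y))// ler_norm.
Qed.

Lemma norm_gcos_le al th x y : `|gcos B al th x y| <= expR (- al * sqdist x y).
Proof.
rewrite /gcos normrM ger0_norm ?expR_ge0// ler_piMr ?expR_ge0//.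
by rewrite ler_norml cos_geN1 cos_le1.
Qed.

Lemma norm_gsin_le al th x y : `|gsin B al th x y| <= expR (- al * sqdist x y).
Proof.
rewrite /gsin normrM ger0_norm ?expR_ge0// ler_piMr ?expR_ge0//.
by rewrite ler_norml sin_geN1 sin_le1.
Qed.

Lemma csqint_gker al th x : 0 < al -> csqint leb (gker B al th x).
Proof.
move=> al0; split.
- apply: (sqint_gauss_le al0 _ ler01 (x := x)).
    exact: (measurable_plane (continuous_measurable_plane (@continuous_gcos _ B al th x))).
  by move=> y; rewrite mul1r; exact: norm_gcos_le.
- apply: (sqint_gauss_le al0 _ ler01 (x := x)).
    exact: (measurable_plane (continuous_measurable_plane (@continuous_gsin _ B al th x))).
  by move=> y; rewrite mul1r; exact: norm_gsin_le.
Qed.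

Definition radial al x y : R := 4 * al + (B ^+ 2 / 4 - 4 * al ^+ 2) * sqdist x y.

Lemma continuous_radial al x : continuous (radial al x).
Proof.
move=> y; apply: cvgD; first exact: cvg_cst.
by apply: cvgM; [exact: cvg_cst|exact: continuous_sqdist].
Qed.

Lemma coef_ge0 al : 0 <= B ^+ 2 / 4 + 4 * al ^+ 2.
Proof. by have := sqr_ge0 B; have := sqr_ge0 al; nra. Qed.

Lemma radial_gauss_le al c x y : 0 < c ->
  `|radial al x y| * expR (- c * sqdist x y) <=
  (4 * `|al| + (B ^+ 2 / 4 + 4 * al ^+ 2) * (2 / c)) * expR (- (c / 2) * sqdist x y).
Proof.
move=> c0; have r0 := sqdist_ge0 x y; set r := sqdist x y in r0 *.
have h1 := mul_expRN_le c0 r0.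
have h2 : expR (- c * r) <= expR (- (c / 2) * r).
  by rewrite ler_expR !mulNr lerN2 ler_wpM2r//; lra.
have h3 : `|radial al x y| <= 4 * `|al| + (B ^+ 2 / 4 + 4 * al ^+ 2) * r.
  rewrite /radial -/r (le_trans (ler_normD _ _))// normrM ger0_norm// lerD2l.
  rewrite normrM (ger0_norm r0) ler_wpM2r// (le_trans (ler_normB _ _))//.
  have := sqr_ge0 B; have := sqr_ge0 al => ha hb.
  by rewrite !ger0_norm//; nra.
have a0 := normr_ge0 al.
have b0 := coef_ge0 al.
apply: (le_trans (ler_wpM2r (expR_ge0 _) h3)).
rewrite mulrDl [leRHS]mulrDl lerD//; first by rewrite ler_wpM2l// mulr_ge0.
by rewrite -!mulrA ler_wpM2l// mulrA.
Qed.

Lemma csqint_radial_gker al th x : 0 < al ->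
  csqint leb (fun y => (radial al x y)%:C%C * gker B al th x y).
Proof.
move=> al0.
pose M := 4 * `|al| + (B ^+ 2 / 4 + 4 * al ^+ 2) * (2 / al).
have M0 : 0 <= M.
  by apply: addr_ge0; apply: mulr_ge0 => //; [exact: coef_ge0|rewrite divr_ge0// ltW].
have al2 : 0 < al / 2 by rewrite divr_gt0.
split.
- have -> : (fun y : plane R => Re ((radial al x y)%:C%C * gker B al th x y)) =
     (fun y => radial al x y * gcos B al th x y) by apply/funext => y /=; ring.
  apply: (sqint_gauss_le al2 _ M0 (x := x)).
    exact: (measurable_plane (continuous_measurable_plane (continuous_mulf (@continuous_radial al x) (@continuous_gcos _ B al th x)))).
  move=> y; apply: le_trans (radial_gauss_le al x y al0).
  by rewrite normrM ler_wpM2l// norm_gcos_le.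
- have -> : (fun y : plane R => Im ((radial al x y)%:C%C * gker B al th x y)) =
     (fun y => radial al x y * gsin B al th x y) by apply/funext => y /=; ring.
  apply: (sqint_gauss_le al2 _ M0 (x := x)).
    exact: (measurable_plane (continuous_measurable_plane (continuous_mulf (@continuous_radial al x) (@continuous_gsin _ B al th x)))).
  move=> y; apply: le_trans (radial_gauss_le al x y al0).
  by rewrite normrM ler_wpM2l// norm_gsin_le.
Qed.

(** The Gaussian is not a test function, but the integration by parts asks for compact support of
    the other factor only. This puts the kernel in the domain of the adjoint of H on test functions,
    and the core property carries the relation to all of the graph. *)
Lemma landau_gker al th x f g : 0 < al -> landau B f g ->
  rip leb (gker B al th x) g = rip leb (fun y => (radial al x y)%:C%C * gker B al th x y) f.
Proof.
move=> al0 lfg.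
apply: (landau_adjoint_test (csqint_gker th x al0) (csqint_radial_gker th x al0) _ lfg).
move=> psi tpsi; have [c1 c2 c3] := gker_C1 B al th x.
have [_ ->] := rip_landau_expr c1 c2 c3 tpsi.
by apply: eq_Rintegral => y _; rewrite landau_expr_gker.
Qed.

Definition heat s th x y : R[i] := (ham B s)%:C%C * gker B (hal B s) th x y.

Definition profile s x y : R := ham B s * expR (- hal B s * sqdist x y).

(** The component of f y along the phase of the kernel. In [rdot_heat] it is the factor independent
    of time, next to a positive radial profile that carries the whole dependence on s. *)
Definition pol th x f y : R := rdot (Complex (cos (phase B th x y)) (sin (phase B th x y))) (f y).

Lemma rdot_heat s th x f y : rdot (heat s th x y) (f y) = profile s x y * pol th x f y.
Proof. by rewrite /heat /profile /pol /rdot /gker /gcos /gsin /=; ring. Qed.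

Lemma csqint_heat s th x : 0 < s -> csqint leb (heat s th x).
Proof. by move=> s0; exact: (csqintZ (ham B s) (csqint_gker th x (hal_gt0 B0 s0))). Qed.

Lemma norm_pol_le th x f y : `|pol th x f y| <= `|Re (f y)| + `|Im (f y)|.
Proof.
rewrite /pol /rdot /= (le_trans (ler_normD _ _))// !normrM lerD// ler_piMl//.
  by rewrite ler_norml cos_geN1 cos_le1.
by rewrite ler_norml sin_geN1 sin_le1.
Qed.

(** Differentiation under the integral gives minus the pairing of f with the radial multiple of the
    kernel, and [landau_gker] turns this multiple into H acting on f. *)
Lemma heat_pairing_derive th x f g s : landau B f g -> 0 < s ->
  is_derive s 1 (fun s => rip leb (heat s th x) f) (- rip leb (heat s th x) g).
Proof.
move=> lfg s0.
have [cf cg _] := landauP lfg.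
pose F (s : R) (y : plane R) : R := rdot (heat s th x y) (f y).
have dF (t : R) y : 0 < t -> is_derive t 1 (F^~ y) (- (radial (hal B t) x y * profile t x y) * pol th x f y).
  move=> t0; have -> : F^~ y = (fun t : R => profile t x y * pol th x f y).
    by apply/funext => t'; rewrite /F rdot_heat.
  have h := is_derive_heat B0 (sqdist x y) t0.
  by apply: is_derive_eq; rewrite /GRing.scale /= /radial /profile; ring.
(* A window that stays away from time 0, so that one Gaussian times |f| dominates all the time
   derivatives. *)
pose u := s / 2; pose v := 2 * s.
have Is : `]u, v[%classic s by rewrite /= in_itv /u /v /=; apply/andP; split; lra.
have I0 (t : R) : `]u, v[%classic t -> 0 < t by rewrite /= in_itv /= /u => /andP[h _]; lra.
have intF (t : R) : `]u, v[%classic t -> leb.-integrable setT (EFin \o F t).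
  by move=> /I0 t0; exact: csqint_integrable (csqint_heat th x t0) cf.
(* The bound of [hal_le] at its worst on the window. It also bounds [ham], since the mass
   [ham * pi / hal] is at most 1 and pi is at least 1. *)
pose a1 := (1 + 4 * B * s) / (2 * s).
have B8 : 0 < B / 4 / 2 by rewrite !divr_gt0.
have B4 : 0 < B / 4 by rewrite divr_gt0.
pose K := (4 * a1 + (B ^+ 2 / 4 + 4 * a1 ^+ 2) * (2 / (B / 4))) * a1.
have a10 : 0 < a1 by rewrite divr_gt0 ?mulr_gt0// addr_gt0// !mulr_gt0.
have K0 : 0 <= K.
  apply: mulr_ge0; last exact: ltW.
  apply: addr_ge0; first by rewrite mulr_ge0// ltW.
  by apply: mulr_ge0; [exact: coef_ge0|rewrite divr_ge0// ltW].
pose G (y : plane R) : R := (K * expR (- (B / 4 / 2) * sqdist x y)) * (`|Re (f y)| + `|Im (f y)|).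
have G0 y : 0 <= G y.
  by apply: mulr_ge0; [apply: mulr_ge0 => //; exact: expR_ge0|exact: addr_ge0].
have intG : leb.-integrable setT (EFin \o G).
  have sg := sqintZ K (sqint_gauss x B8).
  have [[mf1 f1] [mf2 f2]] := cf.
  have h1 : sqint leb (fun y => `|Re (f y)|).
    apply: (sqint_le _ cf.1); first exact: measurableT_comp.
    by move=> y; rewrite normr_id.
  have h2 : sqint leb (fun y => `|Im (f y)|).
    apply: (sqint_le _ cf.2); first exact: measurableT_comp.
    by move=> y; rewrite normr_id.
  exact (sqint_mul sg (sqintD h1 h2)).
have d1 (t : R) y : 0 < t -> partial1of2 F t y = - (radial (hal B t) x y * profile t x y) * pol th x f y.
  by move=> t0; rewrite partial1of2E; case: (dF t y t0).
have ubG (t : R) y : `]u, v[%classic t -> setT y -> `|partial1of2 F t y| <= G y.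
  move=> It _; have t0 := I0 _ It; rewrite (d1 _ _ t0).
  rewrite normrM; apply: ler_pM => //; last exact: norm_pol_le.
  have a0 := hal_gt0 B0 t0.
  have aa1 : hal B t <= a1.
    apply: (le_trans (hal_le B0 t0)); rewrite /a1.
    move: It; rewrite /= in_itv /= /u /v => /andP[t1 t2].
    rewrite ler_pdivrMr ?mulr_gt0// [leRHS]mulrAC ler_pdivlMr ?mulr_gt0//.
    have : 0 < B * s * t by rewrite !mulr_gt0.
    nra.
  have p0 := ham_gt0 B0 t0.
  have pa1 : ham B t <= a1.
    apply: le_trans aa1; have := ham_hal_le1 B0 t0; rewrite ler_pdivrMr// mul1r.
    by apply: le_trans; rewrite ler_peMr ?(ltW p0)//; have := pi_ge2 R; lra.
  have B4a := hal_ge B0 t0.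
  have r0 := sqdist_ge0 x y.
  rewrite normrN normrM /profile normrM (gtr0_norm p0) (gtr0_norm (expR_gt0 _)).
  rewrite mulrCA mulrC /K [leRHS]mulrAC; apply: ler_pM; [|exact: ltW| |exact: pa1].
    by apply: mulr_ge0 => //; exact: expR_ge0.
  have h1 : expR (- hal B t * sqdist x y) <= expR (- (B / 4) * sqdist x y).
    by rewrite ler_expR !mulNr lerN2 ler_wpM2r.
  apply: (le_trans (ler_wpM2l (normr_ge0 _) h1)).
  apply: (le_trans (radial_gauss_le _ x y B4)).
  apply: ler_wpM2r; first exact: expR_ge0.
  rewrite (gtr0_norm a0); apply: lerD; first by rewrite ler_wpM2l.
  apply: ler_wpM2r; first by apply: divr_ge0 => //; exact: ltW.
  by rewrite lerD2l ler_wpM2l// lerXn2r ?nnegrE ?(ltW a0) ?(ltW a10).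
have derF (t : R) y : `]u, v[%classic t -> setT y -> derivable (F^~ y) t 1.
  by move=> /I0 t0 _; case: (dF t y t0).
have H1 := derivable_under_integral measurableT Is intF derF G0 intG ubG.
have H2 := differentiation_under_integral measurableT Is intF derF G0 intG ubG.
split; first exact: H1.
rewrite -derive1E; apply: (etrans H2).
have e : rip leb (heat s th x) g = \int[leb]_y (radial (hal B s) x y * profile s x y * pol th x f y).
  have a0 := hal_gt0 B0 s0; have cgk := csqint_gker th x a0.
  have crk := csqint_radial_gker th x a0.
  have -> : rip leb (heat s th x) g = ham B s * rip leb (gker B (hal B s) th x) g.
    exact (ripZl (ham B s) cgk cg).
  rewrite (landau_gker th x a0 lfg) -(ripZl (ham B s) crk cf).
  apply: eq_Rintegral => y _.
  by rewrite /profile /pol /rdot /gker /gcos /gsin /=; ring.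
rewrite e.
have ee : (fun y => partial1of2 F s y) = (fun y => (-1) * (radial (hal B s) x y * profile s x y * pol th x f y)).
  by apply/funext => y; rewrite (d1 _ _ s0); ring.
have ir : leb.-integrable setT (EFin \o (fun y => radial (hal B s) x y * profile s x y * pol th x f y)).
  have cr := csqintZ (ham B s) (csqint_radial_gker th x (hal_gt0 B0 s0)).
  have := csqint_integrable cr cf; apply: eq_integrable => // y _ /=; congr EFin.
  by rewrite /profile /pol /rdot /gker /gcos /gsin /=; ring.
rewrite -[RHS]mulN1r -RintegralZl//.
by rewrite -ee.
Qed.

End HeatKernel.

(** * The heat extension *)

Section ExpSeries.
Variable R : realType.
Implicit Types x c : R.

Lemma eq_ler x y : x = y -> x <= y. Proof. by move=> ->. Qed.

Lemma exp_coeff_norm x n : `|exp_coeff x n| = exp_coeff `|x| n.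
Proof. by rewrite /exp_coeff /= normrM normrX [in X in _ * X]ger0_norm. Qed.

Lemma exp_coeff_ge0 x n : 0 <= x -> 0 <= exp_coeff x n.
Proof. by move=> x0; rewrite /exp_coeff /= divr_ge0// exprn_ge0. Qed.

Lemma series_exp_coeff_le x n : 0 <= x -> series (exp_coeff x) n <= expR x.
Proof.
move=> x0; apply: nondecreasing_cvgn_le; last exact: is_cvg_series_exp_coeff.
by apply: nondecreasing_series => k _ _; exact: exp_coeff_ge0.
Qed.

Lemma exp_coeff_le_exp x n : 0 <= x -> x ^+ n / n`!%:R <= expR x.
Proof.
move=> x0; apply: le_trans (series_exp_coeff_le n.+1 x0).
rewrite seriesSr /= lerDr sumr_ge0// => i _; exact: exp_coeff_ge0.
Qed.

Lemma series_dominated_cvg (c v : R^nat) : (forall n, `|c n| <= v n) ->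
  cvgn (series v) -> cvgn (series c).
Proof.
move=> cv hv; apply: normed_cvg; apply: (series_le_cvg _ _ _ hv) => n //=.
by apply: le_trans (cv n).
Qed.

Lemma cvg_series_expM (M x : R) : cvgn (series (fun n => M * exp_coeff x n)).
Proof. exact: (is_cvg_seriesZ (k := M) (is_cvg_series_exp_coeff x)). Qed.

End ExpSeries.

(** * Taylor expansion backward in time *)

Section HeatTaylor.
Variable R : realType.
Variables (e : nat -> R -> R) (E M : R).
Hypothesis E0 : 0 <= E.
Hypothesis de : forall k (s : R), 0 < s -> is_derive s 1 (e k) (- e k.+1 s).

(** The Taylor polynomial of [e 0] based at u and evaluated at s. As a function of the base point u
    its derivative telescopes to a single term, so the mean value theorem between s and t yields the
    remainder. *)
Let Psi (s : R) n (u : R) : R := \sum_(k < n) exp_coeff (u - s) k * e k u.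

Let dcoef (s u : R) n : is_derive u 1 (fun u => exp_coeff (u - s) n.+1) (exp_coeff (u - s) n).
Proof.
rewrite /exp_coeff /=.
have h : is_derive u 1 (fun u => (u - s) ^+ n.+1) (n.+1%:R * (u - s) ^+ n).
  have h0 : is_derive u 1 (fun u => u - s) 1 by apply: is_derive_eq; rewrite subr0.
  have h1 := is_deriveX n.+1 h0.
  have e1 : (fun u => u - s) ^+ n.+1 = (fun u => (u - s) ^+ n.+1) by apply/funext => v; rewrite fctE.
  by rewrite e1 in h1; apply: is_derive_eq; rewrite /GRing.scale /= mulr1.
apply: is_derive_eq; rewrite /GRing.scale /= factS natrM invfM.
have n0 : n.+1%:R != 0 :> R by rewrite pnatr_eq0.
have f0 : n`!%:R != 0 :> R by rewrite pnatr_eq0 -lt0n fact_gt0.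
move: (n.+1%:R : R) n0 (n`!%:R : R) f0 => a a0 b b0.
by field; rewrite b0 a0.
Qed.

Let dPsi (s u : R) n : 0 < u ->
  is_derive u 1 (Psi s n.+1) (- (exp_coeff (u - s) n * e n.+1 u)).
Proof.
move=> u0; elim: n => [|n IH].
  have -> : Psi s 1 = e 0%N.
    by apply/funext => v; rewrite /Psi big_ord1 /exp_coeff /= fact0 expr0 divr1 mul1r.
  by rewrite /exp_coeff /= fact0 expr0 divr1 mul1r; exact: de.
have -> : Psi s n.+2 = (fun v => Psi s n.+1 v + exp_coeff (v - s) n.+1 * e n.+1 v).
  by apply/funext => v; rewrite /Psi big_ord_recr.
have h1 := dcoef s u n; have h2 := de n.+1 u0.
by apply: is_derive_eq; rewrite /GRing.scale /=; ring.
Qed.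

Lemma heat_taylor (s t : R) n : 0 < s -> s <= t ->
  (forall k u, s <= u <= t -> `|e k u| <= M * E ^+ k) ->
  `|e 0%N s - \sum_(k < n.+1) exp_coeff (t - s) k * e k t| <= M * E * (t - s) * exp_coeff (E * (t - s)) n.
Proof.
move=> s0 st eM.
have sM : 0 <= M by have := eM 0%N s; rewrite lexx st => /(_ isT); rewrite expr0 mulr1; apply: le_trans.
have Ps : Psi s n.+1 s = e 0%N s.
  rewrite /Psi big_ord_recl subrr /exp_coeff /= fact0 expr0 divr1 mul1r big1 ?addr0// => i _.
  by rewrite /bump /= expr0n /= mul0r mul0r.
have der u : u \in `]s, t[ -> is_derive u 1 (Psi s n.+1) (- (exp_coeff (u - s) n * e n.+1 u)).
  by rewrite in_itv /= => /andP[su _]; apply: dPsi; exact: lt_trans su.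
have cont : {within `[s, t], continuous (Psi s n.+1)}.
  apply: derivable_within_continuous => u; rewrite in_itv /= => /andP[su _].
  by have [] := dPsi s n (lt_le_trans s0 su).
have [c] := MVT_segment st der cont.
rewrite in_itv /= => /andP[sc ct] hc.
rewrite -Ps -[X in _ - X]/(Psi s n.+1 t) distrC hc normrM normrN normrM.
have ts0 : 0 <= t - s by rewrite subr_ge0.
have cs0 : 0 <= c - s by rewrite subr_ge0.
rewrite (ger0_norm ts0) exp_coeff_norm (ger0_norm cs0).
have h1 : `|e n.+1 c| <= M * E ^+ n.+1 by apply: eM; rewrite sc ct.
have h2 : exp_coeff (c - s) n <= exp_coeff (t - s) n.
  by rewrite /exp_coeff /= ler_pM2r ?invr_gt0 ?ltr0n ?fact_gt0// lerXn2r ?nnegrE// lerD2r.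
apply: (@le_trans _ _ (exp_coeff (t - s) n * (M * E ^+ n.+1) * (t - s))).
  by rewrite ler_wpM2r// ler_pM// exp_coeff_ge0.
by rewrite /exp_coeff /= exprMn exprS; apply: eq_ler; ring.
Qed.

Lemma cvg_exp_coeff0 (x : R) : exp_coeff x n @[n --> \oo] --> 0.
Proof. exact: cvg_series_cvg_0 (is_cvg_series_exp_coeff x). Qed.

Lemma heat_taylor_cvg (s t : R) : 0 < s -> s <= t ->
  (forall k u, s <= u <= t -> `|e k u| <= M * E ^+ k) ->
  series (fun k => exp_coeff (t - s) k * e k t) n @[n --> \oo] --> e 0%N s.
Proof.
move=> s0 st eM; rewrite -cvg_shiftS.
apply/subr_cvg0; apply: norm_cvg0.
apply: (@squeeze_cvgr _ _ _ _ (cst 0) (fun n => M * E * (t - s) * exp_coeff (E * (t - s)) n)).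
- apply: nearW => n /=; rewrite normr_ge0 /= distrC.
  have := heat_taylor n s0 st eM.
  by rewrite /series /= big_mkord.
- exact: cvg_cst.
- rewrite -[X in _ --> X](mulr0 (M * E * (t - s))).
  by apply: cvgM; [exact: cvg_cst|exact: cvg_exp_coeff0].
Qed.

Lemma pow_sub_le (s t : R) k : 0 <= s <= t ->
  t ^+ k.+1 - (t - s) ^+ k.+1 <= k.+1%:R * s * t ^+ k.
Proof.
move=> /andP[s0 st]; have t0 : 0 <= t by exact: le_trans st.
elim: k => [|k IH]; first by rewrite !expr1 expr0; lra.
have h1 : 0 <= (t - s) ^+ k.+1 by rewrite exprn_ge0// subr_ge0.
have h2 : (t - s) ^+ k.+1 <= t ^+ k.+1 by rewrite lerXn2r ?nnegrE ?subr_ge0// lerBlDr lerDl.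
have h3 : 0 <= t ^+ k by rewrite exprn_ge0.
rewrite [t ^+ k.+2]exprS [(t - s) ^+ k.+2]exprS -[k.+2%:R]natr1.
have -> : t * t ^+ k.+1 - (t - s) * (t - s) ^+ k.+1 =
  t * (t ^+ k.+1 - (t - s) ^+ k.+1) + s * (t - s) ^+ k.+1 by ring.
have -> : (k.+1%:R + 1) * s * t ^+ k.+1 = t * (k.+1%:R * s * t ^+ k) + s * t ^+ k.+1.
  by rewrite exprS; ring.
by rewrite lerD// ler_wpM2l.
Qed.

Lemma exp_coeff_sub_le (s t : R) k : 0 <= s <= t ->
  `|exp_coeff t k.+1 - exp_coeff (t - s) k.+1| <= s * exp_coeff t k.
Proof.
move=> /[dup] st /andP[s0 st']; have t0 : 0 <= t by exact: le_trans st'.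
have f0 : 0 < (k.+1)`!%:R :> R by rewrite ltr0n fact_gt0.
rewrite /exp_coeff /= -mulrBl normrM (ger0_norm (_ : 0 <= _^-1)) ?invr_ge0 ?(ltW f0)//.
rewrite ger0_norm; last by rewrite subr_ge0 lerXn2r ?nnegrE ?subr_ge0// lerBlDr lerDl.
rewrite ler_pdivrMr// (le_trans (pow_sub_le k st))//.
rewrite factS natrM.
have n0 : k`!%:R != 0 :> R by rewrite pnatr_eq0 -lt0n fact_gt0.
have -> : s * (t ^+ k / k`!%:R) * (k.+1%:R * k`!%:R) = k.+1%:R * s * t ^+ k by field.
by [].
Qed.

(** The bound M over [s, t] may blow up as s tends to 0; it only ensures that the Taylor series with
    increment t - s converges. The rate comes from comparing this series with the one of increment
    t, where the bound K at time t suffices, and is linear in s. *)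
Lemma heat_limit (s t K : R) : 0 < s -> s <= t -> 0 <= K ->
  (forall k u, s <= u <= t -> `|e k u| <= M * E ^+ k) ->
  (forall k, `|e k t| <= K * E ^+ k) ->
  cvgn (series (fun k => exp_coeff t k * e k t)) /\
  `|e 0%N s - limn (series (fun k => exp_coeff t k * e k t))| <= s * E * K * expR (E * t).
Proof.
move=> s0 st K0 eM eK.
have t0 : 0 <= t by exact: le_trans (ltW s0) st.
have cF : cvgn (series (fun k => exp_coeff t k * e k t)).
  apply: (series_dominated_cvg (v := fun n => K * exp_coeff (E * t) n)); last exact: cvg_series_expM.
  move=> k.
  rewrite normrM exp_coeff_norm (ger0_norm t0).
  apply: le_trans (ler_wpM2l (exp_coeff_ge0 k t0) (eK k)) _.
  by rewrite /exp_coeff /= exprMn; apply: eq_ler; ring.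
split=> //.
have c1 := heat_taylor_cvg s0 st eM.
have lim : (series (fun k => exp_coeff (t - s) k * e k t) n - series (fun k => exp_coeff t k * e k t) n)
    @[n --> \oo] --> e 0%N s - limn (series (fun k => exp_coeff t k * e k t)).
  by apply: cvgB.
rewrite -(cvg_lim _ (cvg_norm lim))//; apply: limr_le.
  by apply/cvg_ex; eexists; exact: cvg_norm lim.
apply: nearW => n.
rewrite /series /= -sumrB.
case: n => [|n]; first by rewrite big_geq// normr0 !mulr_ge0 ?expR_ge0 ?(ltW s0).
rewrite big_nat_recl// /exp_coeff /= !expr0 subrr add0r.
apply: (le_trans (ler_norm_sum _ _ _)).
apply: (@le_trans _ _ (\sum_(0 <= i < n) s * E * K * exp_coeff (E * t) i)); last first.
  rewrite -mulr_sumr ler_wpM2l// ?mulr_ge0 ?(ltW s0)//.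
  exact: (series_exp_coeff_le n (mulr_ge0 E0 t0)).
apply: ler_sum => i _; rewrite -mulrBl normrM distrC.
have := exp_coeff_sub_le i (_ : 0 <= s <= t); rewrite (ltW s0) st => /(_ isT) h.
apply: (@le_trans _ _ (s * exp_coeff t i * (K * E ^+ i.+1))); first exact: ler_pM.
by rewrite /exp_coeff /= exprMn exprS; apply: eq_ler; ring.
Qed.

End HeatTaylor.

(** * Norm of the kernel and convergence of the extension *)

Section HeatNorms.
Variables (R : realType) (B : R).
Hypothesis B0 : 0 < B.
Local Notation leb := (leb2 R).
Implicit Types (s t th c : R) (x y : R * R) (f g : plane R -> R[i]).

Lemma gauss_integrable c x : 0 < c -> leb.-integrable setT (fun y : plane R => (expR (- c * sqdist x y))%:E).
Proof.
move=> c0; apply/integrableP; split.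
  by apply/measurable_EFinP; exact: (measurable_plane (measurable_gauss2 c x)).
under eq_integral do rewrite abse_EFin ger0_norm ?expR_ge0//.
by rewrite (integral_gauss2 x c0) ltry.
Qed.

Lemma Rintegral_gauss c x : 0 < c -> \int[leb]_y expR (- c * sqdist x y) = pi / c.
Proof. by move=> c0; rewrite /Rintegral (integral_gauss2 x c0). Qed.

Lemma profile_ge0 s x y : 0 < s -> 0 <= profile B s x y.
Proof. by move=> s0; rewrite mulr_ge0 ?expR_ge0// ltW// ham_gt0. Qed.

Lemma profile_integrable s x : 0 < s -> leb.-integrable setT (EFin \o (fun y : plane R => profile B s x y)).
Proof.
by move=> s0; exact: (integrableZl measurableT (ham B s) (gauss_integrable x (hal_gt0 B0 s0))).
Qed.

Lemma Rintegral_profile s x : 0 < s -> \int[leb]_y profile B s x y = ham B s * pi / hal B s.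
Proof.
move=> s0; have a0 := hal_gt0 B0 s0.
rewrite -mulrA -(Rintegral_gauss x a0) -RintegralZl//; exact: gauss_integrable.
Qed.

Lemma heat_norm_le s th x : 0 < s -> rip leb (heat B s th x) (heat B s th x) <= hal B s.
Proof.
move=> s0; have a0 := hal_gt0 B0 s0; have p0 := ham_gt0 B0 s0.
have a20 : 0 < 2 * hal B s by rewrite mulr_gt0.
have -> : rip leb (heat B s th x) (heat B s th x) = ham B s ^+ 2 * (pi / (2 * hal B s)).
  rewrite -(Rintegral_gauss x a20) -RintegralZl//; last exact: gauss_integrable.
  apply: eq_Rintegral => y _; rewrite /heat /gker /gcos /gsin /rdot /=.
  have -> : - (2 * hal B s) * sqdist x y = - hal B s * sqdist x y + - hal B s * sqdist x y by ring.
  rewrite expRD; set e := expR _.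
  have := cos2Dsin2 (phase B th x y) => h.
  transitivity (ham B s ^+ 2 * (e * e) * (cos (phase B th x y) ^+ 2 + sin (phase B th x y) ^+ 2)); first ring.
  by rewrite h mulr1.
have h := ham_hal_le1 B0 s0.
have h1 : ham B s <= hal B s.
  have := h; rewrite ler_pdivrMr// mul1r; apply: le_trans.
  by rewrite ler_peMr ?(ltW p0)//; have := pi_ge2 R; lra.
have -> : ham B s ^+ 2 * (pi / (2 * hal B s)) = ham B s / 2 * (ham B s * pi / hal B s).
  by move: (@pi R) => c; field; rewrite gt_eqF.
apply: (le_trans (ler_wpM2l _ h)); first by rewrite divr_ge0// ltW.
by rewrite mulr1; lra.
Qed.

Lemma heat_pairing_le s th x f : 0 < s -> csqint leb f ->
  `|rip leb (heat B s th x) f| <= Num.sqrt (hal B s) * Num.sqrt (rip leb f f).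
Proof.
move=> s0 cf; apply: (le_trans (rip_abs_le (csqint_heat B0 th x s0) cf)).
by rewrite ler_wpM2r ?sqrtr_ge0// ler_sqrt ?heat_norm_le// ltW// hal_gt0.
Qed.

Section Iterates.
Variables (fk : nat -> plane R -> R[i]) (E N0 t : R).
Hypothesis E0 : 0 < E.
Hypothesis t0 : 0 < t.
Hypothesis lfk : forall k, landau B (fk k) (fk k.+1).
Hypothesis nfk : forall k, rip leb (fk k) (fk k) <= (E ^+ k) ^+ 2 * N0.

Let cfk k : csqint leb (fk k). Proof. by have [] := landauP (lfk k). Qed.

(** The component along the direction th of the complex value F(x): almost everywhere it is the real
    part of exp(-i th) f(x), as [heat_extension_ae] shows. *)
Definition heat_extension th x : R :=
  limn (series (fun k => exp_coeff t k * rip leb (heat B t th x) (fk k))).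

Let N00 : 0 <= N0.
Proof. by have := nfk 0%N; rewrite expr0 expr1n mul1r; apply: le_trans; exact: rip_ge0. Qed.

Lemma iterate_pairing_le k s th x : 0 < s ->
  `|rip leb (heat B s th x) (fk k)| <= Num.sqrt (hal B s) * Num.sqrt N0 * E ^+ k.
Proof.
move=> s0; apply: (le_trans (heat_pairing_le th x s0 (cfk k))).
rewrite -mulrA ler_wpM2l ?sqrtr_ge0//.
have e0 : 0 <= E ^+ k by rewrite exprn_ge0// ltW.
have -> : Num.sqrt N0 * E ^+ k = Num.sqrt ((E ^+ k) ^+ 2 * N0).
  by rewrite sqrtrM ?sqr_ge0// sqrtr_sqr ger0_norm// mulrC.
by rewrite ler_sqrt ?nfk// mulr_ge0// sqr_ge0.
Qed.

Lemma heat_extension_cvg s th x : 0 < s -> s <= t ->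
  cvgn (series (fun k => exp_coeff t k * rip leb (heat B t th x) (fk k))) /\
  `|rip leb (heat B s th x) (fk 0%N) - heat_extension th x| <=
    s * E * (Num.sqrt (hal B t) * Num.sqrt N0) * expR (E * t).
Proof.
move=> s0 st.
pose M := Num.sqrt ((1 + 2 * B * t) / (4 * s)) * Num.sqrt N0.
apply: (@heat_limit _ (fun k u => rip leb (heat B u th x) (fk k)) E M (ltW E0)) => //.
- by move=> k u u0; exact: heat_pairing_derive.
- move=> k u /andP[su ut]; have u0 : 0 < u by exact: lt_le_trans su.
  apply: (le_trans (iterate_pairing_le k th x u0)).
  rewrite ler_wpM2r ?exprn_ge0 ?(ltW E0)// ler_wpM2r ?sqrtr_ge0//.
  have p : 0 < (1 + 2 * B * t) / (4 * s) by rewrite divr_gt0 ?mulr_gt0// addr_gt0// !mulr_gt0.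
  rewrite ler_sqrt ?(ltW p)// (le_trans (hal_le B0 u0))//.
  rewrite ler_pM ?invr_ge0 ?mulr_ge0 ?(ltW u0) ?(ltW s0)//.
  + by rewrite addr_ge0// !mulr_ge0 ?(ltW B0) ?(ltW u0).
  + by rewrite lerD2l ler_wpM2l// mulr_ge0// ltW.
  + by rewrite lef_pV2 ?posrE ?mulr_gt0// ler_pM2l.
- by move=> k; exact: iterate_pairing_le.
Qed.

End Iterates.
End HeatNorms.

Lemma measurable_coordinates (R : realType) :
  [/\ measurable_fun setT (fun z : plane R * plane R => (z.1 : R * R).1),
      measurable_fun setT (fun z : plane R * plane R => (z.1 : R * R).2),
      measurable_fun setT (fun z : plane R * plane R => (z.2 : R * R).1) &
      measurable_fun setT (fun z : plane R * plane R => (z.2 : R * R).2)].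
Proof.
split.
- by apply: (measurableT_comp (measurable_plane measurable_fst) measurable_fst).
- by apply: (measurableT_comp (measurable_plane measurable_snd) measurable_fst).
- by apply: (measurableT_comp (measurable_plane measurable_fst) measurable_snd).
- by apply: (measurableT_comp (measurable_plane measurable_snd) measurable_snd).
Qed.

(** * Identification of the heat extension with f *)

Section HeatSmallTime.
Variables (R : realType) (B : R).
Hypothesis B0 : 0 < B.
Local Notation leb := (leb2 R).
Local Notation bplane := (measurableTypeR R * measurableTypeR R)%type.
Implicit Types (s t th c : R) (x y : R * R) (f g : plane R -> R[i]).

Lemma rdot_sqr_le (z w : R[i]) : rdot z w ^+ 2 <= rdot z z * rdot w w.
Proof.
case: z => a b; case: w => c d; rewrite /rdot /=.
by have := sqr_ge0 (a * d - b * c); nra.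
Qed.

(** Cauchy-Schwarz after the profile is split into two equal square roots [w]: one of them with the
    phase has squared norm equal to the mass of the profile, which is at most 1. *)
Lemma heat_pairing_sqr_le s th x g : 0 < s -> csqint leb g ->
  ((rip leb (heat B s th x) g ^+ 2)%:E <=
   \int[leb]_y (profile B s x y * rdot (g y) (g y))%:E)%E.
Proof.
move=> s0 cg; have a0 := hal_gt0 B0 s0; have p0 := ham_gt0 B0 s0.
have a2 : 0 < hal B s / 2 by rewrite divr_gt0.
pose w (y : R * R) : R := Num.sqrt (ham B s) * expR (- (hal B s / 2) * sqdist x y).
have ww y : w y * w y = profile B s x y.
  rewrite /w /profile.
  have -> : - hal B s * sqdist x y = - (hal B s / 2) * sqdist x y + - (hal B s / 2) * sqdist x y by field.
  rewrite expRD -[in RHS](sqr_sqrtr (ltW p0)); ring.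
have w0 y : 0 <= w y by rewrite mulr_ge0 ?sqrtr_ge0 ?expR_ge0.
have w1 y : w y <= Num.sqrt (ham B s).
  rewrite ler_piMr ?sqrtr_ge0// expR_le1 mulNr oppr_le0.
  exact: (mulr_ge0 (ltW a2) (sqdist_ge0 x y)).
have mw : measurable_fun setT (w : plane R -> R).
  exact: (measurable_funM (measurable_cst _) (measurable_plane (measurable_gauss2 (hal B s / 2) x))).
have [[m1 _] [m2 _]] := cg.
have cA := csqintZ (Num.sqrt (ham B s)) (csqint_gker B th x a2).
have wg (v : plane R -> R) : sqint leb v -> sqint leb (fun y => w y * v y).
  move=> sv; have [mv _] := sv.
  apply: (sqint_le _ (sqintZ (Num.sqrt (ham B s)) sv)); first exact: measurable_funM.
  move=> y; have -> : `|w y * v y| = w y * `|v y| by rewrite normrM ger0_norm.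
  rewrite normrM (ger0_norm (sqrtr_ge0 _)).
  by rewrite ler_wpM2r.
pose G (y : plane R) : R[i] := Complex (w y * Re (g y)) (w y * Im (g y)).
have cG : csqint leb G by split; apply: wg; [exact: cg.1|exact: cg.2].
have e1 : rip leb (heat B s th x) g = rip leb (fun y => (Num.sqrt (ham B s))%:C%C * gker B (hal B s / 2) th x y) G.
  apply: eq_Rintegral => y _; rewrite rdot_heat -ww /pol /G /w /gker /gcos /gsin /rdot /=; ring.
have e2 : rip leb (fun y => (Num.sqrt (ham B s))%:C%C * gker B (hal B s / 2) th x y)
   (fun y => (Num.sqrt (ham B s))%:C%C * gker B (hal B s / 2) th x y) = ham B s * pi / hal B s.
  rewrite -(Rintegral_profile B0 x s0); apply: eq_Rintegral => y _.
  rewrite -ww /w /gker /gcos /gsin /rdot /=; set e := expR _.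
  have h := cos2Dsin2 (phase B th x y).
  transitivity (Num.sqrt (ham B s) * e * (Num.sqrt (ham B s) * e) * (cos (phase B th x y) ^+ 2 + sin (phase B th x y) ^+ 2)).
    by ring.
  by rewrite h mulr1.
have e3 : (\int[leb]_y (profile B s x y * rdot (g y) (g y))%:E = (rip leb G G)%:E)%E.
  rewrite -rip_EFin//; apply: eq_integral => y _; congr EFin.
  by rewrite -ww /G /rdot /=; ring.
rewrite e3 lee_fin e1 (le_trans (rip_CS cA cG))// e2 ler_piMl ?rip_ge0//.
exact: ham_hal_le1.
Qed.

Lemma integral_sleb2 (f : plane R -> \bar R) : (\int[leb]_x f x = \int[@sleb2 R]_x f x)%E.
Proof. reflexivity. Qed.

Lemma measurable_sqdist2 : measurable_fun setT (fun z : plane R * plane R => sqdist (z.1 : R * R) (z.2 : R * R)).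
Proof.
have [m1 m2 m3 m4] := measurable_coordinates R.
by apply: measurable_funD; apply: measurable_funX; apply: measurable_funB.
Qed.

Lemma measurable_phase2 th :
  measurable_fun setT (fun z : plane R * plane R => phase B th (z.1 : R * R) (z.2 : R * R)).
Proof.
have [m1 m2 m3 m4] := measurable_coordinates R.
apply: measurable_funD; first exact: measurable_cst.
apply: measurable_funM; first exact: measurable_cst.
exact: (measurable_funB (measurable_funM m1 m4) (measurable_funM m2 m3)).
Qed.

Lemma measurable_profile2 s :
  measurable_fun setT (fun z : plane R * plane R => profile B s (z.1 : R * R) (z.2 : R * R)).
Proof.
apply: measurable_funM; first exact: measurable_cst.
apply: (measurableT_comp (@measurable_expR R)).
by apply: measurable_funM; [exact: measurable_cst|exact: measurable_sqdist2].
Qed.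

(** Tonelli's theorem gives measurability of parameter integrals of nonnegative functions, hence the
    split into positive and negative parts. *)
Lemma measurable_heat_pairing s th g : csqint leb g ->
  measurable_fun setT (fun x : plane R => rip leb (heat B s th x) g).
Proof.
move=> [[m1 _] [m2 _]].
pose h (z : plane R * plane R) : \bar R := (profile B s (z.1 : R * R) (z.2 : R * R) * pol B th (z.1 : R * R) g z.2)%:E.
have mh : measurable_fun setT h.
  apply/measurable_EFinP; apply: measurable_funM; first exact: measurable_profile2.
  apply: measurable_funD; apply: measurable_funM.
  - by apply: measurableT_comp; [exact: (continuous_measurable_fun (@continuous_cos R))|exact: measurable_phase2].
  - by apply: (measurableT_comp m1); exact: measurable_snd.
  - by apply: measurableT_comp; [exact: (continuous_measurable_fun (@continuous_sin R))|exact: measurable_phase2].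
  - by apply: (measurableT_comp m2); exact: measurable_snd.
have e : (fun x : plane R => rip leb (heat B s th x) g) =
    fine \o (fun x => \int[@sleb2 R]_y h^\+ (x, y) - \int[@sleb2 R]_y h^\- (x, y))%E.
  apply/funext => x; rewrite /rip /Rintegral integral_sleb2 integralE.
  congr (fine (_ - _)%E).
  - by congr (integral _ _ _); apply/funext => y; rewrite !unlock rdot_heat.
  - by congr (integral _ _ _); apply/funext => y; rewrite !unlock rdot_heat.
rewrite e; apply: measurableT_comp; first exact: fine_measurable.
apply: emeasurable_funB.
- apply: measurable_fun_fubini_tonelli_F; first exact: measurable_funepos.
  by move=> z; exact: funepos_ge0.
- apply: measurable_fun_fubini_tonelli_F; first exact: measurable_funeneg.
  by move=> z; exact: funeneg_ge0.
Qed.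

Lemma profileC s x y : profile B s x y = profile B s y x.
Proof. by rewrite /profile /sqdist; congr (_ * expR (_ * _)); ring. Qed.

(** Schur's test: the profile is symmetric with mass at most 1, so integrating [heat_pairing_sqr_le]
    over x first leaves at most the squared norm of g. *)
Lemma heat_schur s th g : 0 < s -> csqint leb g ->
  (\int[leb]_x (rip leb (heat B s th x) g ^+ 2)%:E <= (rip leb g g)%:E)%E.
Proof.
move=> s0 cg; have [[m1 _] [m2 _]] := cg.
pose h (z : plane R * plane R) : \bar R := (profile B s (z.1 : R * R) (z.2 : R * R) * rdot (g z.2) (g z.2))%:E.
have mr : measurable_fun setT (fun y : plane R => rdot (g y) (g y)).
  by apply: measurable_funD; apply: measurable_funM.
have mh : measurable_fun setT h.
  apply/measurable_EFinP; apply: measurable_funM; first exact: measurable_profile2.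
  by apply: (measurableT_comp mr); exact: measurable_snd.
have r0 y : 0 <= rdot (g y) (g y) by rewrite /rdot addr_ge0// -expr2 sqr_ge0.
have h0 z : (0 <= h z)%E by rewrite lee_fin mulr_ge0// profile_ge0.
have i0 : (\int[leb]_x (rip leb (heat B s th x) g ^+ 2)%:E <= \int[@sleb2 R]_x \int[@sleb2 R]_y h (x, y))%E.
  rewrite integral_sleb2; apply: ge0_le_integral.
  - exact: measurableT.
  - by move=> x _; rewrite lee_fin sqr_ge0.
  - by apply/measurable_EFinP; apply: measurable_funX; exact: measurable_heat_pairing.
  - exact: (measurable_fun_fubini_tonelli_F h mh h0).
  - by move=> x _; rewrite -integral_sleb2; exact: heat_pairing_sqr_le.
refine (le_trans i0 _).
rewrite (fubini_tonelli h mh h0) -(rip_EFin cg cg) integral_sleb2.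
apply: ge0_le_integral.
- exact: measurableT.
- by move=> y _; apply: integral_ge0 => x _; exact: h0.
- exact: (measurable_fun_fubini_tonelli_G h mh h0).
- exact/measurable_EFinP.
move=> y _; rewrite -integral_sleb2.
have -> : (\int[leb]_x h (x, y) = (rdot (g y) (g y))%:E * \int[leb]_x (profile B s y x)%:E)%E.
  rewrite -ge0_integralZl.
  - by apply: eq_integral => x _; rewrite /h /= -EFinM mulrC profileC.
  - exact: measurableT.
  - by have /integrableP[] := profile_integrable B0 y s0.
  - by move=> x _; rewrite lee_fin profile_ge0.
  - by rewrite lee_fin.
have i1 : (\int[leb]_x (profile B s y x)%:E = (ham B s * pi / hal B s)%:E)%E.
  rewrite -(Rintegral_profile B0 y s0) fineK//.
  exact: (integrable_fin_num measurableT (profile_integrable B0 y s0)).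
rewrite i1 -EFinM lee_fin ler_piMr//; exact: ham_hal_le1.
Qed.

End HeatSmallTime.

(** * The kernel as an approximate identity *)

Section HeatLimit.
Variables (R : realType) (B : R).
Hypothesis B0 : 0 < B.
Local Notation leb := (leb2 R).
Implicit Types (s t th c : R) (x y : R * R) (f g : plane R -> R[i]).

Lemma continuous_pol th x (phi : R * R -> R[i]) :
  continuous (fun y => Re (phi y)) -> continuous (fun y => Im (phi y)) ->
  continuous (pol B th x phi).
Proof.
move=> c1 c2; apply: continuous_addf; apply: continuous_mulf => //.
  by move=> y; exact: (continuous_comp (@continuous_phase _ B th x y) (@continuous_cos _ _)).
by move=> y; exact: (continuous_comp (@continuous_phase _ B th x y) (@continuous_sin _ _)).
Qed.

Lemma pol_diag th x f : pol B th x f x = rdot (Complex (cos th) (sin th)) (f x).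
Proof. by rewrite /pol /phase (mulrC x.2) subrr mulr0 addr0. Qed.

Lemma profile_moment s x : 0 < s ->
  leb.-integrable setT (EFin \o (fun y : plane R => profile B s x y * sqdist x y)) /\
  \int[leb]_y (profile B s x y * sqdist x y) <= 32 * s.
Proof.
move=> s0; have a0 := hal_gt0 B0 s0; have p0 := ham_gt0 B0 s0.
have a2 : 0 < hal B s / 2 by rewrite divr_gt0.
have mm : measurable_fun setT (fun y : plane R => profile B s x y * sqdist x y).
  apply: measurable_funM; last exact: (measurable_plane (measurable_sqdist x)).
  by have /integrableP[/measurable_EFinP] := profile_integrable B0 x s0.
pose G (y : plane R) := ham B s * (2 / hal B s) * expR (- (hal B s / 2) * sqdist x y).
have iG : leb.-integrable setT (EFin \o G).
  exact: (integrableZl measurableT (ham B s * (2 / hal B s)) (gauss_integrable x a2)).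
have n0 y : 0 <= profile B s x y * sqdist x y.
  by rewrite mulr_ge0 ?sqdist_ge0// profile_ge0.
have le y : profile B s x y * sqdist x y <= G y.
  have := ler_wpM2l (ltW p0) (mul_expRN_le a0 (sqdist_ge0 x y)).
  by rewrite /profile /G [sqdist x y * _]mulrC !mulrA.
have ii : leb.-integrable setT (EFin \o (fun y : plane R => profile B s x y * sqdist x y)).
  apply: (le_integrable measurableT _ _ iG); first exact/measurable_EFinP.
  move=> y _ /=; rewrite lee_fin ger0_norm//; apply: (le_trans (le y)); exact: ler_norm.
split=> //; apply: (@le_trans _ _ (\int[leb]_y G y)).
  by apply: le_Rintegral.
have -> : \int[leb]_y G y = ham B s * (2 / hal B s) * (pi / (hal B s / 2)).
  rewrite -(Rintegral_gauss x a2) -RintegralZl//; exact: (gauss_integrable x a2).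
have -> : ham B s * (2 / hal B s) * (pi / (hal B s / 2)) = (ham B s * pi / hal B s) * (4 / hal B s).
  by move: (@pi R) => c; field; rewrite gt_eqF.
apply: (@le_trans _ _ (1 * (4 / hal B s))).
  by rewrite ler_wpM2r ?ham_hal_le1// divr_ge0// ltW.
rewrite mul1r ler_pdivrMr//.
have -> : 32 * s * hal B s = 4 * (8 * s * hal B s) by ring.
have k0 : 0 < 8 * s by rewrite mulr_gt0.
have : 1 <= 8 * s * hal B s.
  have := ler_wpM2l (ltW k0) (hal_ge_inv B0 s0).
  by rewrite mulfV ?gt_eqF.
by lra.
Qed.

Lemma heat_test_cvg th x (phi : R * R -> R[i]) : test_function phi ->
  forall e : R, 0 < e -> exists2 d : R, 0 < d & forall s, 0 < s -> s < d ->
   `|rip leb (heat B s th x) phi - rdot (Complex (cos th) (sin th)) (phi x)| <= e.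
Proof.
move=> tphi e e0.
have [/cC1_cont[c1 c2] _ _ [b1 b2]] := test_function_C1 B tphi.
have [cphi _] := test_function_csqint B tphi.
have [M1 M10 M1P] := continuous_boxed_bounded c1 b1.
have [M2 M20 M2P] := continuous_boxed_bounded c2 b2.
pose M := M1 + M2; have M0 : 0 < M by rewrite addr_gt0.
pose p := pol B th x phi.
have pM y : `|p y| <= M by apply: (le_trans (norm_pol_le _ _ _ _ _)); rewrite lerD.
have e30 : 0 < e / 3 by rewrite divr_gt0.
have /cvgrPdist_le /(_ _ e30) := @continuous_pol th x phi c1 c2 x.
case/nbhs_ballP => r /= r0 hr.
(* Near x continuity gives e / 3; elsewhere [sqdist x y] is at least r^2 and the quadratic term
   alone is at least 2 M. The quadratic term is then controlled by the second moment of the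
   profile. *)
have pxy y : `|p y - p x| <= e / 3 + 2 * M / r ^+ 2 * sqdist x y.
  have q0 : 0 <= 2 * M / r ^+ 2 * sqdist x y.
    by rewrite mulr_ge0 ?sqdist_ge0// divr_ge0 ?sqr_ge0// mulr_ge0// ltW.
  have [h|h] := boolP ((`|x.1 - y.1| < r) && (`|x.2 - y.2| < r)).
    have /hr : ball x r y by move/andP: h => [? ?]; split.
    by rewrite /= distrC => h'; rewrite -[leLHS]addr0 lerD.
  have rs : r ^+ 2 <= sqdist x y.
    rewrite /sqdist; move: h; rewrite negb_and -!leNgt => /orP[] h.
      have : r ^+ 2 <= `|x.1 - y.1| ^+ 2 by rewrite lerXn2r ?nnegrE ?(ltW r0).
      by rewrite real_normK ?num_real//; have := sqr_ge0 (x.2 - y.2); lra.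
    have : r ^+ 2 <= `|x.2 - y.2| ^+ 2 by rewrite lerXn2r ?nnegrE ?(ltW r0).
    by rewrite real_normK ?num_real//; have := sqr_ge0 (x.1 - y.1); lra.
  have : 2 * M <= 2 * M / r ^+ 2 * sqdist x y.
    rewrite -mulrA ler_peMr//; first by rewrite mulr_ge0// ltW.
    by rewrite mulrC ler_pdivlMr ?mul1r// exprn_gt0.
  have : `|p y - p x| <= `|p y| + `|p x| by exact: ler_normB.
  have := pM y; have := pM x; have : 0 <= e / 3 by rewrite divr_ge0// ltW.
  by lra.
(* K s collects the errors linear in s: the second moment is at most 32 s, and the mass defect (B
   s)^2 is at most B^2 s because s < 1. *)
pose K := M * B ^+ 2 + 64 * M / r ^+ 2.
have K0 : 0 < K by rewrite addr_gt0// ?mulr_gt0 ?invr_gt0 ?exprn_gt0.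
exists (Num.min 1 (e / (3 * K))); first by rewrite lt_min ltr01/= divr_gt0// mulr_gt0.
move=> s s0; rewrite lt_min => /andP[s1 s2].
have ip := profile_integrable B0 x s0; have [im mo] := profile_moment x s0.
have ipp : leb.-integrable setT (EFin \o (fun y : plane R => profile B s x y * p y)).
  have := csqint_integrable (csqint_heat B0 th x s0) cphi.
  by congr (integrable _ _ (EFin \o _)); apply/funext => y; rewrite rdot_heat.
have ipx : leb.-integrable setT (EFin \o (fun y : plane R => p x * profile B s x y)).
  exact: (integrableZl measurableT (p x) ip).
have e1 : rip leb (heat B s th x) phi - p x * (ham B s * pi / hal B s) =
    \int[leb]_y (profile B s x y * (p y - p x)).
  rewrite -(Rintegral_profile B0 x s0) -RintegralZl// /rip.
  under eq_Rintegral do rewrite rdot_heat.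
  rewrite -RintegralB//; apply: eq_Rintegral => y _; rewrite -/p; ring.
have id : leb.-integrable setT (EFin \o (fun y : plane R => profile B s x y * (p y - p x))).
  have := integrableB measurableT ipp ipx.
  congr (integrable _ _ _); apply/funext => y /=; rewrite -EFinB; congr EFin; ring.
have iu : leb.-integrable setT (EFin \o (fun y : plane R => e / 3 * profile B s x y + 2 * M / r ^+ 2 * (profile B s x y * sqdist x y))).
  exact: (integrableD measurableT (integrableZl measurableT (e / 3) ip) (integrableZl measurableT (2 * M / r ^+ 2) im)).
have e2 : `|\int[leb]_y (profile B s x y * (p y - p x))| <= e / 3 + 64 * M / r ^+ 2 * s.
  apply: (le_trans (le_normr_Rintegral measurableT id)).
  apply: (@le_trans _ _ (\int[leb]_y (e / 3 * profile B s x y + 2 * M / r ^+ 2 * (profile B s x y * sqdist x y)))).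
    apply: le_Rintegral => //.
      by have := integrable_abse id.
    move=> y _; rewrite normrM (ger0_norm (profile_ge0 B0 x y s0)).
    apply: (le_trans (ler_wpM2l (profile_ge0 B0 x y s0) (pxy y))).
    by apply: eq_ler; ring.
  rewrite RintegralD//; last 2 first.
  - exact: (integrableZl measurableT (e / 3) ip).
  - exact: (integrableZl measurableT (2 * M / r ^+ 2) im).
  have q1 : \int[leb]_y (e / 3 * profile B s x y) = e / 3 * \int[leb]_y profile B s x y.
    exact: (RintegralZl (e / 3) measurableT ip).
  have q2 : \int[leb]_y (2 * M / r ^+ 2 * (profile B s x y * sqdist x y)) =
      2 * M / r ^+ 2 * \int[leb]_y (profile B s x y * sqdist x y).
    exact: (RintegralZl (2 * M / r ^+ 2) measurableT im).
  rewrite q1 q2 lerD//.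
    rewrite (Rintegral_profile B0 x s0) ler_piMr ?divr_ge0 ?(ltW e0)//; exact: ham_hal_le1.
  have -> : 64 * M / r ^+ 2 * s = 2 * M / r ^+ 2 * (32 * s) by ring.
  by rewrite ler_wpM2l// divr_ge0 ?sqr_ge0// mulr_ge0// ltW.
have e3 : `|p x * (ham B s * pi / hal B s) - p x| <= M * B ^+ 2 * s.
  have -> : p x * (ham B s * pi / hal B s) - p x = p x * (ham B s * pi / hal B s - 1) by ring.
  have h := ham_hal_ge B0 s0; have h1 := ham_hal_le1 B0 s0.
  move: h h1; rewrite exprMn; move: (ham B s * pi / hal B s) => q h h1.
  have h2 : B ^+ 2 * s ^+ 2 <= B ^+ 2 * s.
    by rewrite ler_wpM2l ?sqr_ge0// expr2 ler_piMl// ltW.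
  rewrite normrM -mulrA; apply: ler_pM => //.
  by rewrite ler0_norm ?subr_le0// opprB (le_trans _ h2)// lerBlDr addrC -lerBlDr.
have e4 : K * s <= e / 3.
  move: s2; rewrite ltr_pdivlMr ?mulr_gt0// => s2.
  by rewrite ler_pdivlMr//; apply/ltW; move: s2; congr (_ < _); ring.
rewrite -pol_diag -/p.
have -> : rip leb (heat B s th x) phi - p x =
  (rip leb (heat B s th x) phi - p x * (ham B s * pi / hal B s)) + (p x * (ham B s * pi / hal B s) - p x) by ring.
apply: (le_trans (ler_normD _ _)); rewrite e1.
apply: (le_trans (lerD e2 e3)).
have -> : e / 3 + 64 * M / r ^+ 2 * s + M * B ^+ 2 * s = e / 3 + K * s by rewrite /K; ring.
apply: (@le_trans _ _ (e / 3 + e / 3)); first by rewrite lerD2l.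
rewrite -mulrDl ler_pdivrMr// -[e + e]mulr2n -[e *+ 2]mulr_natr.
by rewrite ler_pM2l// ler_nat.
Qed.

End HeatLimit.

Section FatouBound.
Context d (T : measurableType d) (R : realType) (mu : {measure set T -> \bar R}).

Lemma integral_limit_le (h : nat -> T -> R) (l : T -> R) (D : \bar R) :
  (forall n, measurable_fun setT (h n)) -> (forall n x, 0 <= h n x) ->
  (forall x, h n x @[n --> \oo] --> l x) ->
  (forall n, (\int[mu]_x (h n x)%:E <= D)%E) -> (\int[mu]_x (l x)%:E <= D)%E.
Proof.
move=> mh h0 hl hD.
have -> : (\int[mu]_x (l x)%:E = \int[mu]_x limn_einf (fun n => (h n x)%:E))%E.
  apply: eq_integral => x _; apply/esym.
  have hx : (h n x)%:E @[n --> \oo] --> (l x)%:E.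
    by apply: cvg_EFin; [exact: nearW|exact: hl].
  by have [] := cvg_limn_einf_sup hx.
apply: (le_trans (fatou _ _ _ _)).
- exact: measurableT.
- by move=> n; apply/measurable_EFinP.
- by move=> n x _; rewrite lee_fin.
rewrite limn_einf_lim; apply: lime_le; first exact: is_cvg_einfs.
apply: nearW => n; apply: le_trans (hD n).
by apply: ereal_inf_lbound; exists n => /=.
Qed.

End FatouBound.

(** * The extension represents f almost everywhere *)

Section Identification.
Variables (R : realType) (B : R).
Hypothesis B0 : 0 < B.
Local Notation leb := (leb2 R).
Implicit Types (s th c : R) (x y : R * R) (f g : plane R -> R[i]).

Definition cis th : R[i] := Complex (cos th) (sin th).

Lemma rip_heat_cis s th x g : 0 < s -> csqint leb g ->
  rip leb (heat B s th x) g =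
    cos th * rip leb (heat B s 0 x) g + sin th * rip leb (heat B s (pi / 2) x) g.
Proof.
move=> s0 cg.
have c1 := csqint_heat B0 0 x s0; have c2 := csqint_heat B0 (pi / 2) x s0.
rewrite -(ripZl _ c1 cg) -(ripZl _ c2 cg) -(ripDl (csqintZ _ c1) (csqintZ _ c2) cg).
apply: eq_Rintegral => y _; rewrite /rdot /heat /gker /gcos /gsin /phase /=.
rewrite add0r !cosD !sinD cos_pihalf sin_pihalf; ring.
Qed.

Lemma csqint_rdot_cis th g : csqint leb g ->
  csqint leb (fun x => Complex (rdot (cis th) (g x)) 0) /\
  rip leb (fun x => Complex (rdot (cis th) (g x)) 0) (fun x => Complex (rdot (cis th) (g x)) 0)
   <= rip leb g g.
Proof.
move=> cg; have [[m1 _] [m2 _]] := cg.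
have le y : rdot (cis th) (g y) * rdot (cis th) (g y) <= rdot (g y) (g y).
  rewrite -expr2; apply: (le_trans (rdot_sqr_le _ _)).
  have -> : rdot (cis th) (cis th) = 1 by rewrite /rdot /= -!expr2 cos2Dsin2.
  by rewrite mul1r.
have mr : measurable_fun setT (fun x : plane R => rdot (cis th) (g x)).
  by apply: measurable_funD; apply: measurable_funM.
have ci : csqint leb (fun x => Complex (rdot (cis th) (g x)) 0).
  apply: csqintP => //=; apply: (@le_lt_trans _ _ (rip leb g g)%:E); last exact: ltry.
  rewrite -(rip_EFin cg cg); apply: ge0_le_integral.
  - exact: measurableT.
  - by move=> x _; rewrite lee_fin /rdot /= mul0r addr0 -expr2 sqr_ge0.
  - rewrite (_ : (fun x => _) = EFin \o (fun x : plane R => rdot (cis th) (g x) ^+ 2)).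
      exact/measurable_EFinP/(measurable_funX 2 mr).
    by apply/funext => x /=; rewrite {1}/rdot /= mul0r addr0 expr2.
  - exact/measurable_EFinP/(measurable_funD (measurable_funM m1 m1) (measurable_funM m2 m2)).
  - by move=> x _; rewrite lee_fin {1}/rdot /= mul0r addr0.
split=> //; apply: le_Rintegral; [exact: measurableT|exact: (csqint_integrable ci ci)|exact: (csqint_integrable cg cg)|].
by move=> x _; rewrite {1}/rdot /= mul0r addr0.
Qed.

Variables (fk : nat -> plane R -> R[i]) (E N0 t : R).
Hypothesis E0 : 0 < E.
Hypothesis t0 : 0 < t.
Hypothesis lfk : forall k, landau B (fk k) (fk k.+1).
Hypothesis nfk : forall k, rip leb (fk k) (fk k) <= (E ^+ k) ^+ 2 * N0.
Local Notation F := (heat_extension B fk t).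

Let cfk k : csqint leb (fk k). Proof. by have [] := landauP (lfk k). Qed.

Lemma heat_extension_series th x :
  series (fun k => exp_coeff t k * rip leb (heat B t th x) (fk k)) n @[n --> \oo] --> F th x.
Proof. by have [] := heat_extension_cvg B0 E0 t0 lfk nfk th x t0 (lexx t). Qed.

Lemma heat_extension_cis th x : F th x = cos th * F 0 x + sin th * F (pi / 2) x.
Proof.
pose u th n := series (fun k => exp_coeff t k * rip leb (heat B t th x) (fk k)) n.
have h : cos th * u 0 n + sin th * u (pi / 2) n @[n --> \oo] -->
    cos th * F 0 x + sin th * F (pi / 2) x.
  by apply: cvgD; apply: cvgM; try exact: cvg_cst; exact: heat_extension_series.
apply: (cvg_unique _ (@heat_extension_series th x)) => //.
rewrite (_ : (fun n => _) = (fun n => cos th * u 0 n + sin th * u (pi / 2) n)) //.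
apply/funext => n; rewrite /u.
rewrite /series /= !mulr_sumr -big_split /=; apply: eq_bigr => k _.
rewrite (rip_heat_cis th x t0 (cfk k)); ring.
Qed.

(** The components along th and th + pi / 2 are coordinates in a rotated orthonormal basis. Since th
    may depend on x, the gauge of a cell leaves |F| unchanged. *)
Lemma heat_extension_sqr th x :
  F th x ^+ 2 + F (th + pi / 2) x ^+ 2 = F 0 x ^+ 2 + F (pi / 2) x ^+ 2.
Proof.
rewrite (heat_extension_cis th) (heat_extension_cis (th + _)).
rewrite cosD sinD cos_pihalf sin_pihalf.
move: (F 0 x) (F (pi / 2) x) (cos th) (sin th) (cos2Dsin2 th) => a b c s h.
transitivity ((c ^+ 2 + s ^+ 2) * (a ^+ 2 + b ^+ 2)); first by ring.
by rewrite h mul1r.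
Qed.

Lemma measurable_heat_extension th : measurable_fun setT (fun x : plane R => F th x).
Proof.
apply: (@measurable_fun_cvg _ _ _ _ (fun n (x : plane R) => series (fun k => exp_coeff t k * rip leb (heat B t th x) (fk k)) n)).
- move=> n; rewrite /series /=; apply: measurable_sum => k.
  exact: (measurable_funM (measurable_cst _) (measurable_heat_pairing B t th (cfk k))).
- by move=> x _; exact: heat_extension_series.
Qed.

Let sn n : R := t / n.+1%:R.

(** Apply [heat_schur] to f - phi at times tending to 0, then Fatou's lemma. The pointwise limit
    exists because <K_s, f> tends to F by the Taylor bound and <K_s, phi> tends to a component of
    phi by continuity of phi. *)
Lemma heat_extension_test th (phi : R * R -> R[i]) : test_function phi ->
  (\int[leb]_x ((F th x - rdot (cis th) (phi x)) ^+ 2)%:E <=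
   (rip leb (fun x => fk 0%N x - phi x) (fun x => fk 0%N x - phi x))%:E)%E.
Proof.
move=> tphi; have [cphi _] := test_function_csqint B tphi.
have cB := csqintB (cfk 0) cphi.
have sn0 n : 0 < sn n by rewrite divr_gt0.
have snt n : sn n <= t by rewrite ler_pdivrMr// ler_peMr ?(ltW t0)// ler1n.
have sc : sn n @[n --> \oo] --> 0.
  by rewrite -(mulr0 t); exact: (cvgM (cvg_cst t) (@cvg_harmonic R)).
apply: (@integral_limit_le _ _ _ leb (fun n x => rip leb (heat B (sn n) th x) (fun x => fk 0%N x - phi x) ^+ 2)).
- by move=> n; apply: measurable_funX; exact: measurable_heat_pairing.
- by move=> n x; rewrite sqr_ge0.
- move=> x.
  have e n : rip leb (heat B (sn n) th x) (fun x => fk 0%N x - phi x) =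
     rip leb (heat B (sn n) th x) (fk 0%N) - rip leb (heat B (sn n) th x) phi.
    have ch := csqint_heat B0 th x (sn0 n).
    by rewrite (ripC leb _ (fun x => _ - _)) (ripBl (cfk 0) cphi ch) (ripC leb (fk 0%N)) (ripC leb phi).
  have h1 : rip leb (heat B (sn n) th x) (fk 0%N) @[n --> \oo] --> F th x.
    apply/subr_cvg0; apply: norm_cvg0.
    apply: (@squeeze_cvgr _ _ _ _ (cst 0) (fun n => sn n * (E * (Num.sqrt (hal B t) * Num.sqrt N0) * expR (E * t)))).
    + apply: nearW => n; rewrite normr_ge0 /= !mulrA.
      have := (heat_extension_cvg B0 E0 t0 lfk nfk th x (sn0 n) (snt n)).2.
      by rewrite !mulrA.
    + exact: cvg_cst.
    + rewrite -[X in _ --> X](mul0r (E * (Num.sqrt (hal B t) * Num.sqrt N0) * expR (E * t))).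
      exact: (cvgM sc (cvg_cst _)).
  have h2 : rip leb (heat B (sn n) th x) phi @[n --> \oo] --> rdot (cis th) (phi x).
    apply/cvgrPdist_le => e1 e10.
    have [d d0 hd] := heat_test_cvg B0 th x tphi e10.
    move/cvgrPdist_lt : sc => /(_ _ d0); apply: filterS => n.
    rewrite sub0r normrN ger0_norm ?(ltW (sn0 n))// => h.
    by rewrite distrC; exact: hd.
  have h3 : (rip leb (heat B (sn n) th x) (fk 0%N) - rip leb (heat B (sn n) th x) phi) ^+ 2 @[n --> \oo] -->
      (F th x - rdot (cis th) (phi x)) ^+ 2.
    by apply: cvgM; apply: cvgB.
  by under eq_fun do rewrite e.
- by move=> n; exact: heat_schur.
Qed.

(** F - f is the sum of F - phi_n and phi_n - f (components along th), both of norm at most |phi_n -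
    f|, which tends to 0 along the sequence provided by the core. *)
Lemma heat_extension_ae th :
  (fun x => Complex (F th x - rdot (cis th) (fk 0%N x)) 0) = (fun=> 0) %[ae leb].
Proof.
have [_ _ [phi [tphi hphi _]]] := landauP (lfk 0).
pose W n x : R[i] := Complex (F th x - rdot (cis th) (phi n x)) 0.
pose V n x : R[i] := Complex (rdot (cis th) (phi n x - fk 0%N x)) 0.
have cphi n : csqint leb (phi n) := (test_function_csqint B (tphi n)).1.
have rW n x : rdot (W n x) (W n x) = (F th x - rdot (cis th) (phi n x)) ^+ 2.
  by rewrite /rdot /= mul0r addr0 expr2.
have [cphi1 cphi2] : (forall n, measurable_fun setT (fun x : plane R => Re (phi n x))) /\
    (forall n, measurable_fun setT (fun x : plane R => Im (phi n x))).
  by split=> n; have [[m1 _] [m2 _]] := cphi n.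
have mW n : measurable_fun setT (fun x : plane R => F th x - rdot (cis th) (phi n x)).
  apply: measurable_funB; first exact: measurable_heat_extension.
  by apply: measurable_funD; apply: measurable_funM.
have e n : rip leb (fun x => fk 0%N x - phi n x) (fun x => fk 0%N x - phi n x) =
   rip leb (fun x => phi n x - fk 0%N x) (fun x => phi n x - fk 0%N x).
  by apply: eq_Rintegral => x _; rewrite /rdot; case: (fk 0%N x) => ? ?; case: (phi n x) => ? ? /=; ring.
have cW n : csqint leb (W n).
  apply: csqintP => //=; apply: (@le_lt_trans _ _ _ _ _ _ (ltry _)).
  apply: le_trans (heat_extension_test th (tphi n)).
  by under eq_integral do rewrite rW.
have nW n : rip leb (W n) (W n) <= rip leb (fun x => phi n x - fk 0%N x) (fun x => phi n x - fk 0%N x).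
  rewrite -lee_fin -(rip_EFin (cW n) (cW n)) -e; apply: le_trans (heat_extension_test th (tphi n)).
  by under eq_integral do rewrite rW.
have [cV nV] : (forall n, csqint leb (V n)) /\
   forall n, rip leb (V n) (V n) <= rip leb (fun x => phi n x - fk 0%N x) (fun x => phi n x - fk 0%N x).
  by split=> n; have [] := csqint_rdot_cis th (csqintB (cphi n) (cfk 0)).
have WV n : (fun x => Complex (F th x - rdot (cis th) (fk 0%N x)) 0 : R[i]) = (fun x => W n x + V n x).
  apply/funext => x; rewrite /W /V /rdot /cis /=; case: (fk 0%N x) => ? ?; case: (phi n x) => ? ? /=.
  apply/eqP; rewrite eq_complex /= addr0 eqxx andbT; apply/eqP; ring.
have cU : csqint leb (fun x => Complex (F th x - rdot (cis th) (fk 0%N x)) 0).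
  by rewrite (WV 0%N); exact: csqintD.
apply: (rip_eq0 cU); apply/eqP; rewrite eq_le rip_ge0 andbT.
have h4 : 4 * rip leb (fun x => phi n x - fk 0%N x) (fun x => phi n x - fk 0%N x) @[n --> \oo] --> (0 : R).
  by rewrite -[X in _ --> X](mulr0 (4 : R)); apply: cvgM => //; exact: cvg_cst.
rewrite -[leRHS](cvg_lim _ h4)//; apply: limr_ge.
  by apply/cvg_ex; eexists; exact: h4.
apply: nearW => n /=; rewrite (WV n).
apply: (le_trans (ripD_le (cW n) (cV n))).
have := nW n; have := nV n; lra.
Qed.

Lemma heat_extension_ae_sqr :
  {ae leb, forall x, F 0 x ^+ 2 + F (pi / 2) x ^+ 2 = rdot (fk 0%N x) (fk 0%N x)}.
Proof.
have h1 := heat_extension_ae 0; have h2 := heat_extension_ae (pi / 2).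
move: h1 h2; apply: (@filterS2 _ _ (ae_filter_ringOfSetsType leb)) => x /= h1 h2.
have /eqP := h1 I; rewrite eq_complex /= eqxx andbT subr_eq0 => /eqP ->.
have /eqP := h2 I; rewrite eq_complex /= eqxx andbT subr_eq0 => /eqP ->.
rewrite /rdot /cis /= cos0 sin0 cos_pihalf sin_pihalf; ring.
Qed.

End Identification.

(** * Lagrange interpolation on thick sets *)

Section Nodes.
Variable R : realType.
Local Notation mu := (@lebesgue_measure R).
Implicit Types (a L h : R).

Lemma finite_cover_measure (J : seq nat) (h a : R) (T : set (measurableTypeR R)) :
  0 <= h -> measurable T ->
  (forall x, T x -> exists2 j, j \in J & a + j%:R * h <= x <= a + j.+1%:R * h) ->
  (mu T <= ((size J)%:R * h)%:E)%E.
Proof.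
move=> h0; elim: J T => [|j J IH] T mT cov.
  have -> : T = set0 by apply/seteqP; split=> x // /cov[].
  by rewrite measure0 mul0r.
pose I : set (measurableTypeR R) := `[a + j%:R * h, a + j.+1%:R * h]%classic.
have mI : measurable I by exact: measurable_itv.
have mTI : measurable (T `\` I) by exact: measurableD.
have lI : (mu I = h%:E)%E.
  rewrite /I lebesgue_measure_itv /= lte_fin ltrD2l -natr1 mulrDl mul1r ltrDl.
  have [_|h0'] := ltP 0 h; first by rewrite EFinN -EFinD; congr EFin; ring.
  by congr EFin; apply/eqP; rewrite eq_le h0 h0'.
have s1 : (mu T <= mu (I `|` (T `\` I)))%E.
  apply: le_measure; rewrite ?inE//; first exact: measurableU.
  by move=> x Tx; have [Ix|Ix] := pselect (I x); [left|right].
apply: (le_trans s1); have s2 : (mu (I `|` (T `\` I)) <= mu I + mu (T `\` I))%E by exact: measureU2.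
apply: (le_trans s2); rewrite lI /= -natr1 mulrDl mul1r addrC EFinD leeD2r//.
apply: IH => // x [Tx nI]; have [i + xi] := cov x Tx.
rewrite inE => /orP[/eqP ij|iJ]; last by exists i.
by exfalso; apply: nI; rewrite /I /= in_itv /= -ij.
Qed.

Lemma sorted_ltn_gap (J : seq nat) i k : sorted ltn J -> (i <= k)%N -> (k < size J)%N ->
  (nth 0 J i + (k - i) <= nth 0 J k)%N.
Proof.
move=> sJ; elim: k => [|k IH]; first by rewrite leqn0 => /eqP ->; rewrite addn0.
rewrite leq_eqVlt => /orP[/eqP ->|]; first by rewrite subnn addn0.
rewrite ltnS => ik kJ; rewrite subSn// addnS.
apply: (leq_ltn_trans (IH ik (ltnW kJ))).
by apply: (sorted_ltn_nth ltn_trans 0%N sJ) => //; rewrite inE // ltnW.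
Qed.

(* Every other bin is used, so that points of distinct chosen bins are separated. *)
Lemma separated_points (a L dl : R) (T : set (measurableTypeR R)) (D M : nat) :
  0 < L -> 0 < dl -> measurable T -> T `<=` `[a, a + L] -> (dl%:E <= mu T)%E ->
  (0 < M)%N -> 2 * D.+1%:R * L <= M%:R * dl ->
  exists x : 'I_D.+1 -> R, (forall i, T (x i)) /\
    forall i k : 'I_D.+1, (i < k)%N -> (k - i)%:R * (L / M%:R) <= x k - x i.
Proof.
move=> L0 d0 mT sT dT M0 hM; pose h := L / M%:R.
have M0' : 0 < M%:R :> R by rewrite ltr0n.
have h0 : 0 < h by rewrite divr_gt0.
pose bin j x := a + j%:R * h <= x <= a + j.+1%:R * h.
pose P j := `[< exists x, T x /\ bin j x >].
pose J := [seq j <- iota 0 M | P j].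
have sJ : sorted ltn J by apply: sorted_filter; [exact: ltn_trans|exact: iota_ltn_sorted].
(* The occupied bins, of width L / M each, cover a set of measure at least dl, so there are at least
   M dl / L of them. *)
have szJ : (2 * D.+1 <= size J)%N.
  have : (mu T <= ((size J)%:R * h)%:E)%E.
    apply: (@finite_cover_measure J h a T (ltW h0) mT) => x Tx.
    have := sT x Tx; rewrite /= in_itv /= => /andP[ax xL].
    pose y := (x - a) / h.
    have y0 : 0 <= y by rewrite divr_ge0 ?subr_ge0// ltW.
    have yM : y <= M%:R.
      by rewrite ler_pdivrMr// /h mulrCA mulfV ?gt_eqF// mulr1 lerBlDl.
    have xy : x = a + y * h by rewrite /y -mulrA mulVf ?gt_eqF// mulr1 addrC subrK.
    (* The right endpoint of the segment, where y = M, is assigned to the last bin. *)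
    pose j := if (y < M%:R) then Num.truncn y else M.-1.
    have [jM [jy yj]] : (j < M)%N /\ j%:R <= y /\ y <= j.+1%:R.
      rewrite /j; have [yM'|My] := ltP y M%:R.
        have /andP[t1 t2] := truncn_itv y0.
        split; last by split=> //; exact: ltW.
        by rewrite -(ltr_nat R); apply: le_lt_trans yM'.
      rewrite prednK// leqnn; split=> //; split=> //.
      by apply: le_trans My; rewrite ler_nat leq_pred.
    have bj : bin j x by rewrite /bin xy !lerD2l !ler_pM2r// jy yj.
    exists j => //; rewrite mem_filter mem_iota /= jM andbT.
    by apply/asboolP; exists x.
  move=> /(le_trans dT); rewrite lee_fin => dJ.
  have : M%:R * dl <= (size J)%:R * L.
    rewrite -(@ler_pM2l _ M%:R) // in dJ; apply: (le_trans dJ).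
    by rewrite /h mulrCA [X in _ * X]mulrC divfK// gt_eqF.
  move/(le_trans hM); rewrite ler_pM2r// => h2.
  by rewrite -(ler_nat R) natrM.
have /choice[x hx] : forall i : 'I_D.+1, exists x, T x /\ bin (nth 0%N J (2 * i)) x.
  move=> i; have lt : (2 * i < size J)%N.
    by apply: leq_trans szJ; rewrite ltn_pmul2l.
  by have := mem_nth 0%N lt; rewrite {2}/J mem_filter => /andP[/asboolP].
exists x; split=> [i|i k ik]; first by have [] := hx i.
have [_ /andP[_ xi]] := hx i; have [_ /andP[xk _]] := hx k.
have kJ : (2 * k < size J)%N by apply: leq_trans szJ; rewrite ltn_pmul2l.
have ik2 : (2 * i <= 2 * k)%N by rewrite leq_pmul2l// ltnW.
have := sorted_ltn_gap sJ ik2 kJ.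
set ji := nth _ _ _ in xi *; set jk := nth _ _ _ in xk * => g.
have g' : (ji.+1 + (k - i) <= jk)%N by move: g ik; lia.
have g2 : ji.+1%:R + (k - i)%:R <= jk%:R :> R by rewrite -natrD ler_nat.
have : (ji.+1%:R + (k - i)%:R) * h <= jk%:R * h by rewrite ler_pM2r.
by rewrite -/h mulrDl; lra.
Qed.

End Nodes.

(** * Lagrange weights at separated nodes *)

Section Lagrange.
Variable R : realType.

(** The factors on the two sides of i multiply to M^i / i! and M^(D-i) / (D-i)!, each a term of the
    series of exp M. *)
Lemma prod_dist_le (M : R) D (i : 'I_D.+1) : 0 <= M ->
  \prod_(k < D.+1 | k != i) (M / `|k%:R - i%:R|) <= expR (2 * M).
Proof.
move=> M0.
have e : \prod_(k < D.+1 | k != i) (M / `|k%:R - i%:R|) =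
   M ^+ i / i`!%:R * (M ^+ (D - i) / (D - i)`!%:R).
  have p1 n : \prod_(0 <= k < n) (M / (n - k)%:R) = M ^+ n / n`!%:R.
    elim: n => [|n IH]; first by rewrite big_geq// expr0 fact0 divr1.
    rewrite big_nat_recl// subn0 exprS factS natrM invfM.
    under eq_bigr do rewrite subSS.
    by rewrite IH; ring.
  have p2 n : \prod_(0 <= k < n) (M / k.+1%:R) = M ^+ n / n`!%:R.
    elim: n => [|n IH]; first by rewrite big_geq// expr0 fact0 divr1.
    rewrite big_nat_recr// IH exprSr factS natrM invfM.
    by rewrite /=; move: (M ^+ n) (_`!%:R^-1) (_.+1%:R^-1) => u v w; ring.
  rewrite (eq_bigl (fun k : 'I_D.+1 => (k : nat) != i)); last by [].
  rewrite -(big_mkord (fun k => k != i :> nat) (fun k => M / `|k%:R - i%:R|)).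
  have iD : (i <= D.+1)%N by rewrite ltnW.
  rewrite (big_cat_nat (leq0n i) iD) /= -p1 -p2; congr (_ * _).
    rewrite big_nat_cond [RHS]big_nat_cond; apply: eq_big => k.
      by case: ltngtP.
    move=> /andP[/andP[_ ki] _].
    by rewrite distrC -natrB 1?ltnW// ger0_norm.
  rewrite (big_ltn_cond (ltn_ord i)) eqxx /=.
  rewrite -{1}[i.+1]add0n big_addn subSS.
  rewrite big_nat_cond [RHS]big_nat_cond; apply: eq_big => k.
    by case: eqP => //; rewrite ?andbT ?andbF//; lia.
  move=> _; rewrite -natrB; last by lia.
  by rewrite ger0_norm//; congr (_ / _%:R); lia.
rewrite e; have -> : 2 * M = M + M by ring.
by rewrite expRD ler_pM ?exp_coeff_le_exp// divr_ge0// exprn_ge0.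
Qed.

Variables (D : nat) (x : 'I_D.+1 -> R).
Hypothesis x_inj : forall i k, i != k -> x i - x k != 0.

Definition lagrange_weight i (u : R) : R :=
  \prod_(k < D.+1 | k != i) ((u - x k) / (x i - x k)).

Lemma lagrange_exact (p : {poly R}) u : (size p <= D.+1)%N ->
  p.[u] = \sum_i lagrange_weight i u * p.[x i].
Proof.
move=> sp.
pose l i : {poly R} := (\prod_(k < D.+1 | k != i) (x i - x k))^-1 *: \prod_(k < D.+1 | k != i) ('X - (x k)%:P).
have lE i v : (l i).[v] = lagrange_weight i v.
  rewrite /l /lagrange_weight hornerZ horner_prod mulrC -prodf_div.
  by under eq_bigr do rewrite hornerXsubC.
have sl i : (size (l i) <= D.+1)%N.
  apply: (leq_trans (size_scale_leq _ _)).
  apply: (leq_trans (size_prod_leq _ _)).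
  under eq_bigr do rewrite size_XsubC.
  by rewrite sum_nat_const cardC1 card_ord /=; lia.
pose q := p - \sum_i p.[x i] *: l i.
have q0 : q = 0.
  apply: (@roots_geq_poly_eq0 _ q [seq x i | i <- enum 'I_D.+1]).
  - apply/allP => _ /mapP[i _ ->]; apply/rootP.
    rewrite /q hornerD hornerN horner_sum (bigD1 i)//= hornerZ lE.
    rewrite [lagrange_weight i _]big1 => [|k ki]; last by rewrite mulfV// x_inj// eq_sym.
    rewrite mulr1 big1 ?addr0 ?subrr// => j ji.
    by rewrite hornerZ lE /lagrange_weight (bigD1 i) 1?eq_sym//= subrr mul0r mul0r mulr0.
  - rewrite map_inj_uniq ?enum_uniq// => i k e; apply/eqP/negPn/negP => ik.
    by have := x_inj ik; rewrite e subrr eqxx.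
  - rewrite size_map size_enum_ord; apply: (leq_trans (size_polyD _ _)).
    rewrite geq_max sp size_polyN; apply: (leq_trans (size_sum _ _ _)).
    by apply/bigmax_leqP => i _; apply: (leq_trans (size_scale_leq _ _)).
have : q.[u] = 0 by rewrite q0 horner0.
rewrite /q hornerD hornerN horner_sum => /eqP; rewrite subr_eq0 => /eqP ->.
by apply: eq_bigr => i _; rewrite hornerZ lE mulrC.
Qed.

(** Every numerator is at most L and the denominator with index k is at least |k - i| L / M, so the
    factors are those of [prod_dist_le]. *)
Lemma lagrange_weight_le (a L : R) (M : nat) i u : 0 < L -> (0 < M)%N ->
  (forall i, a <= x i <= a + L) -> a <= u <= a + L ->
  (forall i k : 'I_D.+1, (i < k)%N -> (k - i)%:R * (L / M%:R) <= x k - x i) ->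
  `|lagrange_weight i u| <= expR (2 * M%:R).
Proof.
move=> L0 M0 xL /andP[u1 u2] sep; apply: le_trans (prod_dist_le i (ler0n _ _)).
rewrite normr_prod; apply: ler_prod => k ki; rewrite normr_ge0 /= normrM normfV.
have M0' : 0 < M%:R :> R by rewrite ltr0n.
have h0 : 0 < L / M%:R by rewrite divr_gt0.
have ki0 : 0 < `|k%:R - i%:R : R|.
  by rewrite normr_gt0 subr_eq0 eqr_nat.
have d : `|k%:R - i%:R| * (L / M%:R) <= `|x i - x k|.
  case: (ltngtP k i) => kI.
  - rewrite distrC -natrB ?(ltnW kI)// ger0_norm ?ler0n//.
    by apply: (le_trans (sep _ _ kI)); exact: ler_norm.
  - rewrite -natrB ?(ltnW kI)// ger0_norm ?ler0n// [leRHS]distrC.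
    by apply: (le_trans (sep _ _ kI)); exact: ler_norm.
  - by move: ki; rewrite -(inj_eq val_inj) /= kI eqxx.
have n : `|u - x k| <= L.
  by have /andP[x1 x2] := xL k; rewrite ler_norml; apply/andP; split; lra.
have d0 : 0 < `|x i - x k| by apply: lt_le_trans d; rewrite mulr_gt0.
rewrite ler_pdivrMr// mulrAC ler_pdivlMr//.
apply: (@le_trans _ _ (L * `|k%:R - i%:R|)); first by rewrite ler_wpM2r.
have := ler_wpM2l (ltW M0') d.
by congr (_ <= _); field; rewrite gt_eqF.
Qed.

End Lagrange.

Section Interpolation.
Variable R : realType.
Local Notation mu := (@lebesgue_measure R).

Lemma interpolation (a L dl : R) (T : set (measurableTypeR R)) (D M : nat) :
  0 < L -> 0 < dl -> dl <= L -> measurable T -> T `<=` `[a, a + L] -> (dl%:E <= mu T)%E ->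
  2 * D.+1%:R * L <= M%:R * dl ->
  exists x : 'I_D.+1 -> R, (forall i, T (x i)) /\
    forall u, a <= u <= a + L -> exists w : 'I_D.+1 -> R,
      \sum_i `|w i| <= expR (3 * M%:R) /\
      forall p : {poly R}, (size p <= D.+1)%N -> p.[u] = \sum_i w i * p.[x i].
Proof.
move=> L0 d0 dL mT sT dT hM.
have DM : D.+1%:R <= M%:R :> R.
  have : 2 * D.+1%:R * L <= M%:R * L by apply: (le_trans hM); rewrite ler_wpM2l.
  rewrite ler_pM2r//; apply: le_trans; rewrite ler_peMl// ler1n//.
have M0 : (0 < M)%N by move: DM; rewrite ler_nat; apply: leq_trans.
have [x [Tx sep]] := separated_points L0 d0 mT sT dT M0 hM.
have xL i : a <= x i <= a + L by have := sT _ (Tx i); rewrite /= in_itv.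
have h0 : 0 < L / M%:R :> R by rewrite divr_gt0// ltr0n.
have x_inj i k : i != k -> x i - x k != 0.
  have lt (i' k' : 'I_D.+1) : (i' < k')%N -> x i' < x k'.
    move=> ik; rewrite -subr_gt0; apply: lt_le_trans (sep _ _ ik).
    by rewrite mulr_gt0// ltr0n subn_gt0.
  case: (ltngtP i k) => [/lt ik _|/lt ik _|/val_inj -> /eqP//].
    by rewrite lt_eqF// subr_lt0.
  by rewrite gt_eqF// subr_gt0.
exists x; split=> // u uL; exists (fun i => lagrange_weight x i u); split; last first.
  by move=> p sp; exact: lagrange_exact.
apply: (@le_trans _ _ (\sum_(i < D.+1) expR (2 * M%:R))).
  by apply: ler_sum => i _; exact: (lagrange_weight_le i L0 M0 xL uL sep).
rewrite sumr_const card_ord -[_ *+ _]mulr_natl.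
(* There are D + 1 <= M <= exp M weights, each at most exp(2 M). *)
have -> : 3 * M%:R = M%:R + 2 * M%:R :> R by ring.
rewrite expRD ler_wpM2r ?expR_ge0//; apply: (le_trans DM).
by have := expR_ge1Dx (M%:R : R); lra.
Qed.

Definition expcos (A C p b v : R) : R := expR (p * v) * (A * cos (b * v) + C * sin (b * v)).

(** Coefficients of the k-th power of minus the derivative applied to [expcos]. The sign makes this
    family an instance of the recursion in [HeatTaylor]. *)
Fixpoint expcos_coef (A C p b : R) k : R * R :=
  if k is k'.+1 then
    let z := expcos_coef A C p b k' in (- (p * z.1 + b * z.2), - (p * z.2 - b * z.1))
  else (A, C).

Lemma expcos_coef_le A C p b k :
  `|(expcos_coef A C p b k).1| + `|(expcos_coef A C p b k).2| <= (`|A| + `|C|) * (`|p| + `|b|) ^+ k.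
Proof.
elim: k => [|k IH]; first by rewrite expr0 mulr1.
rewrite exprSr mulrA /=; set z := expcos_coef A C p b k in IH *.
have r0 : 0 <= `|p| + `|b| by rewrite addr_ge0.
apply: le_trans (ler_wpM2r r0 IH); rewrite !normrN.
have := ler_normD (p * z.1) (b * z.2); have := ler_normB (p * z.2) (b * z.1).
rewrite !normrM => h1 h2; apply: (le_trans (lerD h2 h1)).
by apply: eq_ler; ring.
Qed.

Lemma expcos_le A C p b v L : 0 <= v <= L -> `|expcos A C p b v| <= (`|A| + `|C|) * expR (`|p| * L).
Proof.
move=> /andP[v0 vL]; rewrite /expcos normrM ger0_norm ?expR_ge0// mulrC.
apply: ler_pM; rewrite ?expR_ge0//.
  apply: (le_trans (ler_normD _ _)); rewrite !normrM lerD// ler_piMr//.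
    by rewrite ler_norml cos_geN1 cos_le1.
  by rewrite ler_norml sin_geN1 sin_le1.
rewrite ler_expR; apply: (@le_trans _ _ (`|p| * v)); last by rewrite ler_wpM2l.
by rewrite ler_wpM2r// ler_norm.
Qed.

Lemma expcos_poly A C p b a L D : 0 < L ->
  exists P : {poly R}, (size P <= D.+1)%N /\ forall u, a <= u <= a + L ->
    `|expcos A C p b (u - a) - P.[u]| <=
    (`|A| + `|C|) * expR (`|p| * L) * ((`|p| + `|b|) * L) * exp_coeff ((`|p| + `|b|) * L) D.
Proof.
move=> L0; set r := `|p| + `|b|; have r0 : 0 <= r by rewrite addr_ge0.
pose z k := expcos_coef A C p b k.
(* [heat_taylor] works at positive times; the shift by L sends the segment to [L, 2 L], and the
   expansion is based at its right end 2 L. *)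
pose e k s := expcos (z k).1 (z k).2 p b (s - L).
have de k (s : R) : 0 < s -> is_derive s 1 (e k) (- e k.+1 s).
  move=> _; rewrite /e /= -/(z k); move: (z k).1 (z k).2 => A' C'; rewrite /expcos.
  by apply: is_derive_eq; rewrite /GRing.scale /=; ring.
pose P : {poly R} := \sum_(k < D.+1) (e k (2 * L) / k`!%:R) *: ((a + L)%:P - 'X) ^+ k.
have sP : (size P <= D.+1)%N.
  apply: (leq_trans (size_sum _ _ _)); apply/bigmax_leqP => k _.
  apply: (leq_trans (size_scale_leq _ _)); apply: (leq_trans (size_poly_exp_leq _ _)).
  by rewrite -size_polyN opprB size_XsubC mul1n.
exists P; split=> // u /andP[u1 u2].
have s0 : 0 < u - a + L by lra.
have st : u - a + L <= 2 * L by lra.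
have bd k v : u - a + L <= v <= 2 * L -> `|e k v| <= (`|A| + `|C|) * expR (`|p| * L) * r ^+ k.
  move=> /andP[v1 v2]; have vL : 0 <= v - L <= L by apply/andP; split; lra.
  apply: (le_trans (expcos_le _ _ _ _ vL)).
  by rewrite mulrAC ler_wpM2r ?expR_ge0// expcos_coef_le.
have := heat_taylor de D s0 st bd.
have -> : P.[u] = \sum_(k < D.+1) exp_coeff (2 * L - (u - a + L)) k * e k (2 * L).
  rewrite /P horner_sum; apply: eq_bigr => k _.
  rewrite hornerZ horner_exp hornerD hornerN hornerC hornerX /exp_coeff /=.
  have -> : 2 * L - (u - a + L) = a + L - u by ring.
  by move: (e k _) (_`!%:R^-1) (_ ^+ k) => c1 c2 c3; ring.
rewrite {1}/e /= addrK => h; apply: (le_trans h).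
have tL : 2 * L - (u - a + L) <= L by lra.
have t0 : 0 <= 2 * L - (u - a + L) by lra.
rewrite -!mulrA ler_wpM2l ?addr_ge0// ler_wpM2l ?expR_ge0// [leLHS]mulrA [leRHS]mulrA.
apply: ler_pM.
- exact: mulr_ge0.
- by rewrite exp_coeff_ge0// mulr_ge0.
- by rewrite ler_wpM2l.
rewrite /exp_coeff /= ler_wpM2r ?invr_ge0// lerXn2r ?nnegrE ?mulr_ge0// ?(ltW L0)//.
by rewrite ler_wpM2l.
Qed.

Lemma expcos_interpolation A C p b a L D Lam lam (x w : 'I_D.+1 -> R) u :
  0 < L -> 0 < lam -> (forall i, a <= x i <= a + L) -> a <= u <= a + L ->
  \sum_i `|w i| <= Lam ->
  (forall q : {poly R}, (size q <= D.+1)%N -> q.[u] = \sum_i w i * q.[x i]) ->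
  `|expcos A C p b (u - a) - \sum_i w i * expcos A C p b (x i - a)| <=
   (1 + Lam) * ((`|A| + `|C|) * (expR ((lam + 2) * ((`|p| + `|b|) * L)) / lam ^+ D)).
Proof.
move=> L0 lam0 xL uL wL wP; have [P [sP hP]] := expcos_poly A C p b a D L0.
set bnd := (`|A| + `|C|) * (_ / _).
have hb v : a <= v <= a + L -> `|expcos A C p b (v - a) - P.[v]| <= bnd.
  move=> /hP h; apply: (le_trans h); rewrite /bnd -!mulrA ler_wpM2l ?addr_ge0//.
  set r := `|p| + `|b|; set y := r * L.
  have y0 : 0 <= y by rewrite !mulr_ge0 ?addr_ge0// ltW.
  (* One y is for the exponential growth over the segment, one for the prefactor y <= exp y, and y^D
     / D! <= exp(lam y) / lam^D uses the rest. *)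
  have -> : (lam + 2) * y = y + (y + lam * y) by ring.
  rewrite !expRD -!mulrA; apply: ler_pM.
  - exact: expR_ge0.
  - by rewrite mulrA mulr_ge0// exp_coeff_ge0.
  - by rewrite ler_expR ler_wpM2r ?(ltW L0)// lerDl.
  rewrite mulrA; apply: ler_pM => //.
  - exact: exp_coeff_ge0.
  - by have := expR_ge1Dx y; rewrite -/r -/y; lra.
  rewrite ler_pdivlMr ?exprn_gt0// /exp_coeff /= mulrAC -exprMn [y * _]mulrC.
  by rewrite exp_coeff_le_exp// mulr_ge0// ltW.
(* Interpolation is exact on the Taylor polynomial P, so only the error to P is interpolated: hence
   the factor 1 + Lam. *)
have -> : expcos A C p b (u - a) - \sum_i w i * expcos A C p b (x i - a) =
   (expcos A C p b (u - a) - P.[u]) - \sum_i w i * (expcos A C p b (x i - a) - P.[x i]).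
  have -> : \sum_i w i * (expcos A C p b (x i - a) - P.[x i]) =
      \sum_i w i * expcos A C p b (x i - a) - P.[u].
    by rewrite (wP _ sP) -sumrB; apply: eq_bigr => i _; rewrite mulrBr.
  by ring.
apply: (le_trans (ler_normB _ _)); rewrite mulrDl mul1r lerD ?hb//.
apply: (le_trans (ler_norm_sum _ _ _)).
have b0 : 0 <= bnd by apply: le_trans (hb _ uL).
apply: le_trans (ler_wpM2r b0 wL); rewrite mulr_suml; apply: ler_sum => i _.
by rewrite normrM ler_wpM2l// hb.
Qed.

End Interpolation.

(** * Large slices of a planar set *)

Section ThickSlices.
Variable R : realType.
Local Notation mu := (@lebesgue_measure R).
Local Notation mR := (measurableTypeR R).
Local Notation bplane := (mR * mR)%type.
Implicit Types (c l : R * R).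

Definition box c l : set (R * R) := `[c.1, c.1 + l.1] `*` `[c.2, c.2 + l.2].

Lemma measurable_segment (a b : R) : measurable (`[a, b]%classic : set mR).
Proof. exact: measurable_itv. Qed.

Lemma lebesgue_segment (a L : R) : 0 <= L -> mu (`[a, a + L]%classic : set mR) = L%:E.
Proof.
move=> L0; rewrite lebesgue_measure_itv /= lte_fin ltrDl.
have [L0'|L0'] := ltP 0 L; first by rewrite EFinN -EFinD; congr EFin; ring.
by congr EFin; apply/eqP; rewrite eq_le L0 L0'.
Qed.

Lemma measurable_box_borel c l : measurable (box c l : set bplane).
Proof. by apply: measurableX; exact: measurable_segment. Qed.

Lemma borel_leb2_box c l : 0 <= l.1 -> 0 <= l.2 -> borel_leb2 R (box c l) = (l.1 * l.2)%:E.
Proof.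
move=> l1 l2; rewrite EFinM -(lebesgue_segment c.1 l1) -(lebesgue_segment c.2 l2).
by apply: borel_leb2X; exact: measurable_segment.
Qed.

Lemma measurable_box c l : measurable (box c l : set (plane R)).
Proof. exact: (measurable_borel_plane (measurable_box_borel c l)). Qed.

Lemma leb2_box c l : 0 <= l.1 -> 0 <= l.2 -> leb2 R (box c l) = (l.1 * l.2)%:E.
Proof.
by move=> l1 l2; rewrite (leb2E (measurable_box_borel c l)); exact: borel_leb2_box.
Qed.

Lemma leb2_outer (X : set (plane R)) : leb2 R X =
  ereal_inf [set \big[+%E/0%E]_(0 <= k <oo) borel_leb2 R (A k) |
    A in @measurable_cover _ bplane X].
Proof. rewrite -/(mu_ext (borel_leb2 R) X). reflexivity. Qed.

(** A slice of a Lebesgue measurable set is guaranteed to be measurable for almost every slice only,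
    so Fubini's theorem is applied to a Borel subset. It is the box minus a Borel cover of the
    complement of [E] whose total measure exceeds the infimum by less than m / 2. *)
Lemma borel_inner_half c l (E : set (plane R)) (m : R) : 0 <= l.1 -> 0 <= l.2 ->
  measurable E -> E `<=` box c l -> 0 < m -> (m%:E <= leb2 R E)%E ->
  exists E0 : set bplane, [/\ measurable E0, E0 `<=` E & ((m / 2)%:E <= borel_leb2 R E0)%E].
Proof.
move=> l1 l2 mE sE m0 hE; have mQ := measurable_box c l.
have Qfin : leb2 R (box c l) = (l.1 * l.2)%:E by exact: leb2_box.
have hD : (leb2 R (box c l `\` E) <= (l.1 * l.2 - m)%:E)%E.
  have e : leb2 R (box c l `\` E) = (leb2 R (box c l) - leb2 R (box c l `&` E))%E.
    by apply: measureD => //; rewrite [ltLHS]Qfin ltry.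
  rewrite e Qfin (setIidr sE) EFinB; exact: leeB.
have eD := leb2_outer (box c l `\` E).
have : leb2 R (box c l `\` E) \is a fin_num.
  rewrite fin_numElt; apply/andP; split.
    apply: (@lt_le_trans _ _ 0%E); first exact: ltNy0.
    exact: (measure_ge0 (leb2 R)).
  by apply: (le_lt_trans hD); rewrite ltry.
rewrite eD in hD *.
have m2 : 0 < m / 2 by rewrite divr_gt0.
move=> /(lb_ereal_inf_adherent m2)[_ [F [mF sF] <-] hF].
have mU : measurable (\bigcup_k F k : set bplane) by exact: bigcup_measurable.
have hU : (borel_leb2 R (\bigcup_k F k) <= (l.1 * l.2 - m / 2)%:E)%E.
  apply: (@le_trans _ _ (\big[+%E/0%E]_(0 <= k <oo) borel_leb2 R (F k))).
    by apply: measure_sigma_subadditive.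
  apply: (le_trans (ltW hF)).
  have -> : (l.1 * l.2 - m / 2)%:E = ((l.1 * l.2 - m)%:E + (m / 2)%:E)%E.
    by rewrite -EFinD; congr EFin; field.
  by rewrite leeD2r.
exists (box c l `\` \bigcup_k F k); split.
- by apply: measurableD => //; exact: measurable_box_borel.
- move=> x [Qx nFx]; apply: contrapT => nE; apply: nFx; exact: sF.
have mQb := measurable_box_borel c l.
have Qb : borel_leb2 R (box c l) = (l.1 * l.2)%:E by exact: borel_leb2_box.
have s1 : (borel_leb2 R (box c l) <= borel_leb2 R (\bigcup_k F k `|` (box c l `\` \bigcup_k F k)))%E.
  apply: le_measure; rewrite ?inE//.
    by apply: measurableU => //; exact: measurableD.
  by move=> x Qx; have [?|?] := pselect ((\bigcup_k F k) x); [left|right].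
have s2 : (borel_leb2 R (\bigcup_k F k `|` (box c l `\` \bigcup_k F k)) <=
   borel_leb2 R (\bigcup_k F k) + borel_leb2 R (box c l `\` \bigcup_k F k))%E.
  by apply: measureU2 => //; exact: measurableD.
have := le_trans s1 (le_trans s2 (leeD2r _ hU)); rewrite Qb.
case: (borel_leb2 R _) => [r| |]; rewrite ?leey//=.
  by rewrite -EFinD !lee_fin -addrA lerDl addrC subr_ge0.
Qed.

Lemma large_slices c l (E : set (plane R)) (m : R) : 0 < l.1 -> 0 < l.2 ->
  measurable E -> E `<=` box c l -> 0 < m -> (m%:E <= leb2 R E)%E ->
  exists T1 : set mR, [/\ measurable T1, T1 `<=` `[c.1, c.1 + l.1],
     ((m / (4 * l.2))%:E <= mu T1)%E &
     forall u1, T1 u1 -> exists T2 : set mR, [/\ measurable T2, T2 `<=` `[c.2, c.2 + l.2],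
     ((m / (4 * l.1))%:E <= mu T2)%E & forall u2, T2 u2 -> E (u1, u2)]].
Proof.
move=> l1 l2 mE sE m0 hE.
have [E0 [mE0 sE0 hE0]] := borel_inner_half (ltW l1) (ltW l2) mE sE m0 hE.
pose g (u : mR) := mu (xsection E0 u).
have mg : measurable_fun setT g := measurable_fun_xsection mu mE0.
have E0g : borel_leb2 R E0 = (\int[mu]_u g u)%E by [].
(* Slices of length at least s contribute at most l.2 times the measure of [T1], the others at most
   s l.1 = m / 4, out of a total of at least m / 2. *)
pose s := m / (4 * l.1); have s0 : 0 < s by rewrite divr_gt0// mulr_gt0.
have sec u v : xsection E0 u v -> E (u, v).
  by move=> h; apply: sE0; move: h; rewrite /xsection /= inE.
pose T1 : set mR := [set u | (s%:E <= g u)%E].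
have mT1 : measurable T1.
  by have := emeasurable_fun_c_infty measurableT mg s%:E; rewrite setTI.
have s2 u : xsection E0 u `<=` `[c.2, c.2 + l.2] by move=> v /sec /sE[].
have T1sub : T1 `<=` `[c.1, c.1 + l.1].
  move=> u; rewrite /T1 /= => h.
  have [v hv] : xsection E0 u !=set0.
    by apply/set0P/negP => /eqP e; move: h; rewrite /g e measure0 lee_fin leNgt s0.
  by have [] := sE _ (sec _ _ hv).
exists T1; split => //; last first.
  move=> u uT; exists (xsection E0 u); split => //; [exact: measurable_xsection|exact: sec].
pose I1 : set mR := `[c.1, c.1 + l.1]%classic.
have mI1 : measurable I1 by exact: measurable_segment.
have gle u : (g u <= l.2%:E * (\1_T1 u)%:E + s%:E * (\1_I1 u)%:E)%E.
  have [uT|uT] := pselect (T1 u).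
    have uI : I1 u by exact: T1sub.
    rewrite !indicE !mem_set// !mule1; apply: (@le_trans _ _ l.2%:E); last by rewrite leeDl// lee_fin ltW.
    pose I2 : set mR := `[c.2, c.2 + l.2]%classic.
    have le1 : (mu (xsection E0 u) <= mu I2)%E.
      by apply: le_measure; [rewrite inE; exact: measurable_xsection|rewrite inE; exact: measurable_segment|exact: s2].
    by move: le1; rewrite /I2 (lebesgue_segment c.2 (ltW l2)).
  have [uI|uI] := pselect (I1 u).
    rewrite !indicE memNset// mem_set// mule0 add0e mule1.
    by move/negP: uT; rewrite -ltNge => /ltW.
  have -> : g u = 0%E.
    rewrite /g (_ : xsection E0 u = set0) ?measure0//.
    by apply/seteqP; split=> v // /sec /sE[/uI].
  by rewrite adde_ge0// mule_ge0// lee_fin// ltW.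
have : ((m / 2)%:E <= l.2%:E * mu T1 + (s * l.1)%:E)%E.
  apply: (le_trans hE0); rewrite E0g.
  apply: (@le_trans _ _ (\int[mu]_u (l.2%:E * (\1_T1 u)%:E + s%:E * (\1_I1 u)%:E))%E).
    apply: ge0_le_integral => //.
    apply: emeasurable_funD; apply: measurable_funeM; apply/measurable_EFinP; exact: measurable_indic.
  rewrite ge0_integralD//; last 4 first.
  - by move=> u _; rewrite mule_ge0// lee_fin ltW.
  - by apply: measurable_funeM; apply/measurable_EFinP; exact: measurable_indic.
  - by move=> u _; rewrite mule_ge0// lee_fin ltW.
  - by apply: measurable_funeM; apply/measurable_EFinP; exact: measurable_indic.
  have z (A : set mR) (a : R) : measurable A -> 0 <= a ->
      (\int[mu]_u (a%:E * (\1_A u)%:E) = a%:E * mu A)%E.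
    move=> mA a0; rewrite ge0_integralZl//; first by rewrite integral_indic// setIT.
    by apply/measurable_EFinP; exact: measurable_indic.
  by rewrite (z _ _ mT1 (ltW l2)) (z _ _ mI1 (ltW s0)) /I1 (lebesgue_segment c.1 (ltW l1)).
have -> : s * l.1 = m / 4 by rewrite /s; field; rewrite gt_eqF.
case: (mu T1) => [r| |]; rewrite ?leey//.
  rewrite -EFinM -EFinD !lee_fin => h.
  by rewrite ler_pdivrMr ?mulr_gt0//; lra.
by rewrite mulrNy gtr0_sg// mul1e addNye.
Qed.

End ThickSlices.

(** * Estimates on one cell *)

Section CellKernel.
Variables (R : realType) (B t : R).
Hypothesis B0 : 0 < B.
Hypothesis t0 : 0 < t.
Local Notation leb := (leb2 R).
Implicit Types (c l x y : R * R).
Local Notation al := (hal B t).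
Local Notation am := (ham B t).

(* In this gauge the phase of the kernel at c + u, c + v is an affine function of u
   whose slope only involves v, however large c is. *)
Definition gauge (om : R) c x : R := om - B / 2 * ((x.1 - c.1) * c.2 - (x.2 - c.2) * c.1).

(** The prefactor cancels the part of the Gaussian exponent that is quadratic in x; what remains is
    the exponential of a function affine in x. *)
Definition cell_kernel om c x y : R[i] := (expR (al * sqdist c x))%:C%C * heat B t (gauge om c x) x y.

Definition cell_phase om c x y : R :=
  om + B / 2 * (c.1 * (y.2 - c.2) - c.2 * (y.1 - c.1)) +
  B / 2 * ((x.1 - c.1) * (y.2 - c.2) - (x.2 - c.2) * (y.1 - c.1)).

Definition cell_amplitude c x y : R :=
  am * expR (- al * sqdist c y) *
  (expR (2 * al * (y.1 - c.1) * (x.1 - c.1)) * expR (2 * al * (y.2 - c.2) * (x.2 - c.2))).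

Lemma cell_kernelE om c x y : cell_kernel om c x y =
  Complex (cell_amplitude c x y * cos (cell_phase om c x y))
          (cell_amplitude c x y * sin (cell_phase om c x y)).
Proof.
have ep : phase B (gauge om c x) x y = cell_phase om c x y.
  by rewrite /phase /gauge /cell_phase; field.
rewrite /cell_kernel /heat /gker /gcos /gsin ep.
have ea : expR (al * sqdist c x) * (am * expR (- al * sqdist x y)) = cell_amplitude c x y.
  have e1 : expR (al * sqdist c x) * expR (- al * sqdist x y) = expR (- al * sqdist c y) *
      (expR (2 * al * (y.1 - c.1) * (x.1 - c.1)) * expR (2 * al * (y.2 - c.2) * (x.2 - c.2))).
    by rewrite -!expRD; congr expR; rewrite /sqdist; move: (hal B t) => a; ring.
  rewrite /cell_amplitude; move: (ham B t) => a; rewrite [LHS]mulrCA e1; exact: mulrA.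
by apply/eqP; rewrite eq_complex /= -ea; apply/andP; split; apply/eqP;
  move: (ham B t) (hal B t) (expR (al * sqdist c x)) => u v w; ring.
Qed.

Lemma csqint_cell_kernel om c x : csqint leb (cell_kernel om c x).
Proof. exact: (csqintZ _ (csqint_heat B0 _ x t0)). Qed.

Lemma quad_exp_le (H v1 v2 : R) : 0 <= H ->
  H * (`|v1| + `|v2|) <= H ^+ 2 + (v1 ^+ 2 + v2 ^+ 2) / 2.
Proof.
move=> H0; rewrite -(real_normK (num_real v1)) -(real_normK (num_real v2)).
have := normr_ge0 v1; have := normr_ge0 v2; move: (`|v1|) (`|v2|) => a b _ _.
by have := sqr_ge0 (H - (a + b) / 2); have := sqr_ge0 (a - b); lra.
Qed.

(** Completing the square: half of the Gaussian decay in v absorbs the exponential growth in v, at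
    the price of the constant a (2 (lam + 2)(l1 + l2))^2. The bound is thus uniform in the source
    point y. *)
Lemma exponent_le (a lam l1 l2 v1 v2 u b L v : R) : 0 < a -> 0 < l1 -> 0 < l2 -> 0 < lam ->
  `|u| <= L -> 0 <= L -> b <= (2 * a * (`|v1| + `|v2|)) * (lam + 2) * (l1 + l2 - L) ->
  `|v| <= `|v1| + `|v2| ->
  - a * (v1 ^+ 2 + v2 ^+ 2) + (2 * a * v * u + b) <=
  a * (2 * (lam + 2) * (l1 + l2)) ^+ 2 + - (a / 2) * (v1 ^+ 2 + v2 ^+ 2).
Proof.
move=> a0 l10 l20 lam0 uL L0 hb hv.
set s := `|v1| + `|v2| in hb hv *.
have s0 : 0 <= s by rewrite addr_ge0.
have e1 : 2 * a * v * u <= 2 * a * s * ((lam + 2) * L).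
  have -> : 2 * a * v * u = (2 * a) * (v * u) by ring.
  have -> : 2 * a * s * ((lam + 2) * L) = (2 * a) * (s * ((lam + 2) * L)) by ring.
  rewrite ler_pM2l ?mulr_gt0//.
  apply: (le_trans (ler_norm _)); rewrite normrM; apply: ler_pM => //.
  by apply: (le_trans uL); rewrite ler_peMl//; lra.
pose H := 2 * (lam + 2) * (l1 + l2).
have H0 : 0 <= H by rewrite !mulr_ge0 ?addr_ge0// ltW.
have := ler_wpM2l (ltW a0) (quad_exp_le v1 v2 H0); rewrite -/s -/H => h.
have e2 : 2 * a * s * ((lam + 2) * L) + 2 * a * s * (lam + 2) * (l1 + l2 - L) = a * (H * s).
  by rewrite /H; ring.
lra.
Qed.

(** The half of the Gaussian decay of the kernel that [exponent_le] leaves over. *)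
Definition spread c y : R := am * expR (- (al / 2) * sqdist c y).

Definition cell_error (Lam lam : R) l D : R :=
  2 * (1 + Lam) * expR (al * (2 * (lam + 2) * (l.1 + l.2)) ^+ 2) / lam ^+ D.

Let al0 : 0 < al := hal_gt0 B0 t0.
Let am0 : 0 < am := ham_gt0 B0 t0.

Lemma cell_exponent_le lam l c y (u b : R) L : 0 < l.1 -> 0 < l.2 -> 0 < lam ->
  `|u| <= L -> 0 <= L -> b <= (2 * al * (`|y.1 - c.1| + `|y.2 - c.2|)) * (lam + 2) * (l.1 + l.2 - L) ->
  forall v, `|v| <= `|y.1 - c.1| + `|y.2 - c.2| ->
  am * expR (- al * sqdist c y) * (expR (2 * al * v * u) * expR b) <=
  expR (al * (2 * (lam + 2) * (l.1 + l.2)) ^+ 2) * spread c y.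
Proof.
move=> l1 l2 lam0 uL L0 hb v hv.
rewrite /spread [leRHS]mulrCA -[leLHS](mulrA am) (ler_pM2l am0) -!expRD ler_expR.
have -> : sqdist c y = (y.1 - c.1) ^+ 2 + (y.2 - c.2) ^+ 2 by rewrite /sqdist; ring.
exact: (exponent_le al0 l1 l2 lam0 uL L0 hb hv).
Qed.

(** The addition formulas turn both functions into [expcos] with coefficients cos q and sin q up to
    sign and order. Their absolute values add up to at most 2, which is the factor 2 in the
    bound. *)
Lemma wave_interpolation (P0 q p b a L : R) D Lam lam (z w : 'I_D.+1 -> R) u :
  0 <= P0 -> 0 < L -> 0 < lam -> (forall i, a <= z i <= a + L) -> a <= u <= a + L ->
  \sum_i `|w i| <= Lam ->
  (forall p : {poly R}, (size p <= D.+1)%N -> p.[u] = \sum_i w i * p.[z i]) ->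
  let bound := 2 * (1 + Lam) / lam ^+ D * (P0 * expR ((lam + 2) * ((`|p| + `|b|) * L))) in
  let f := fun s => P0 * (expR (p * (s - a)) * cos (q + b * (s - a))) in
  let g := fun s => P0 * (expR (p * (s - a)) * sin (q + b * (s - a))) in
  `|f u - \sum_i w i * f (z i)| <= bound /\ `|g u - \sum_i w i * g (z i)| <= bound.
Proof.
move=> P00 L0 lam0 zL uL wL wP /=.
have Lam0 : 0 <= Lam by apply: le_trans wL; apply: sumr_ge0.
have key A C : `|A| + `|C| <= 2 ->
   `|P0 * expcos A C p b (u - a) - \sum_i w i * (P0 * expcos A C p b (z i - a))| <=
   2 * (1 + Lam) / lam ^+ D * (P0 * expR ((lam + 2) * ((`|p| + `|b|) * L))).
  move=> AC.
  have -> : P0 * expcos A C p b (u - a) - \sum_i w i * (P0 * expcos A C p b (z i - a)) =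
     P0 * (expcos A C p b (u - a) - \sum_i w i * expcos A C p b (z i - a)).
    by rewrite mulrBr mulr_sumr; congr (_ - _); apply: eq_bigr => i _; rewrite mulrCA.
  rewrite normrM (ger0_norm P00).
  apply: (le_trans (ler_wpM2l P00 (expcos_interpolation A C p b L0 lam0 zL uL wL wP))).
  set e := expR _; have e0 : 0 <= e by exact: expR_ge0.
  have -> : P0 * ((1 + Lam) * ((`|A| + `|C|) * (e / lam ^+ D))) =
    (P0 * (1 + Lam) * (e / lam ^+ D)) * (`|A| + `|C|) by ring.
  have -> : 2 * (1 + Lam) / lam ^+ D * (P0 * e) = (P0 * (1 + Lam) * (e / lam ^+ D)) * 2 by ring.
  by rewrite ler_wpM2l// !mulr_ge0 ?addr_ge0 ?invr_ge0 ?exprn_ge0// ltW.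
have ec s : expR (p * (s - a)) * cos (q + b * (s - a)) = expcos (cos q) (- sin q) p b (s - a).
  by rewrite /expcos cosD mulNr.
have es s : expR (p * (s - a)) * sin (q + b * (s - a)) = expcos (sin q) (cos q) p b (s - a).
  by rewrite /expcos sinD.
have c1 : `|cos q| <= 1 by rewrite ler_norml cos_geN1 cos_le1.
have s1 : `|sin q| <= 1 by rewrite ler_norml sin_geN1 sin_le1.
split.
- rewrite ec; under eq_bigr do rewrite ec.
  by apply: key; rewrite normrN; lra.
- rewrite es; under eq_bigr do rewrite es.
  by apply: key; lra.
Qed.

Definition small_kernel (e : R) c (k : R * R -> R[i]) : Prop :=
  forall y, `|Re (k y)| <= e * spread c y /\ `|Im (k y)| <= e * spread c y.

Definition kernel_defect om c D (z : R * R) (zs : 'I_D.+1 -> R * R) (w : 'I_D.+1 -> R) y : R[i] :=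
  Complex (Re (cell_kernel om c z y) - \sum_i w i * Re (cell_kernel om c (zs i) y))
          (Im (cell_kernel om c z y) - \sum_i w i * Im (cell_kernel om c (zs i) y)).

Let slope_le (v1 v2 : R) : `|2 * al * v1| + `|B / 2 * v2| <= 2 * al * (`|v1| + `|v2|).
Proof.
have h1 : 0 <= 2 * al by rewrite mulr_ge0// ltW.
have h2 : 0 <= B / 2 by rewrite divr_ge0// ltW.
have h3 : B / 2 <= 2 * al by have := hal_ge B0 t0; lra.
rewrite (normrM (2 * al)) (normrM (B / 2)) (ger0_norm h1) (ger0_norm h2) mulrDr lerD2l.
exact: ler_wpM2r.
Qed.

(** For fixed y the kernel on an axis-parallel line is a constant times an exponential wave. Since B
    / 4 <= al, its rate and frequency add up to at most 2 al (|v1| + |v2|) ([slope_le]), which is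
    what [cell_exponent_le] can absorb. *)
Lemma cell_kernel_line om c l D (z w : 'I_D.+1 -> R) (r u : R) Lam lam :
  0 < l.1 -> 0 < l.2 -> 0 < lam -> \sum_i `|w i| <= Lam ->
  (forall p : {poly R}, (size p <= D.+1)%N -> p.[u] = \sum_i w i * p.[z i]) ->
  (c.1 <= r <= c.1 + l.1 -> (forall i, c.2 <= z i <= c.2 + l.2) -> c.2 <= u <= c.2 + l.2 ->
   small_kernel (cell_error Lam lam l D) c (kernel_defect om c (r, u) (fun i => (r, z i)) w)) /\
  (c.2 <= r <= c.2 + l.2 -> (forall i, c.1 <= z i <= c.1 + l.1) -> c.1 <= u <= c.1 + l.1 ->
   small_kernel (cell_error Lam lam l D) c (kernel_defect om c (u, r) (fun i => (z i, r)) w)).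
Proof.
move=> l1 l2 lam0 wL wP.
have Lam0 : 0 <= Lam by apply: le_trans wL; apply: sumr_ge0.
have P1 y : 0 <= am * expR (- al * sqdist c y) by rewrite mulr_ge0 ?expR_ge0// ltW.
have fin y X : X <= expR (al * (2 * (lam + 2) * (l.1 + l.2)) ^+ 2) * spread c y ->
   2 * (1 + Lam) / lam ^+ D * X <= cell_error Lam lam l D * spread c y.
  move=> hX; rewrite /cell_error.
  have -> : 2 * (1 + Lam) * expR (al * (2 * (lam + 2) * (l.1 + l.2)) ^+ 2) / lam ^+ D * spread c y =
     2 * (1 + Lam) / lam ^+ D * (expR (al * (2 * (lam + 2) * (l.1 + l.2)) ^+ 2) * spread c y).
    by move: (expR _) (spread _ _) => e0 s0; ring.
  by rewrite ler_wpM2l// !mulr_ge0 ?addr_ge0 ?invr_ge0 ?exprn_ge0// ltW.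
split=> /andP[r1 r2] zL uL y.
- pose v1 := y.1 - c.1; pose v2 := y.2 - c.2.
  pose P0 := am * expR (- al * sqdist c y) * expR (2 * al * v1 * (r - c.1)).
  pose q := om + B / 2 * (c.1 * v2 - c.2 * v1) + B / 2 * ((r - c.1) * v2).
  have P00 : 0 <= P0 by rewrite mulr_ge0 ?expR_ge0.
  have [h1 h2] := wave_interpolation q (2 * al * v2) (- (B / 2 * v1)) P00 l2 lam0 zL uL wL wP.
  have eph s : cell_phase om c (r, s) y = q + - (B / 2 * v1) * (s - c.2).
    by rewrite /cell_phase /q /v1 /v2 /=; ring.
  have eam s : cell_amplitude c (r, s) y = P0 * expR (2 * al * v2 * (s - c.2)).
    by rewrite /cell_amplitude /P0 /v1 /v2 mulrA.
  have hb : 2 * (1 + Lam) / lam ^+ D * (P0 * expR ((lam + 2) * ((`|2 * al * v2| + `|- (B / 2 * v1)|) * l.2)))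
     <= cell_error Lam lam l D * spread c y.
    apply: fin; rewrite /P0 -[leLHS]mulrA.
    apply: (@cell_exponent_le lam l c y (r - c.1) _ l.1) => //; [|exact: ltW| |by rewrite lerDl].
    + by rewrite ger0_norm ?subr_ge0// lerBlDl.
    + rewrite [l.1 + l.2]addrC addrK normrN -/v1 -/v2 [`|v1| + _]addrC.
      have := slope_le v2 v1 => h.
      have -> : 2 * al * (`|v2| + `|v1|) * (lam + 2) * l.2 = (lam + 2) * (2 * al * (`|v2| + `|v1|) * l.2).
        by move: (hal B t) => a; ring.
      by rewrite ler_pM2l ?addr_gt0// ler_pM2r.
  have hR s : Re (cell_kernel om c (r, s) y) = P0 * (expR (2 * al * v2 * (s - c.2)) * cos (q + - (B / 2 * v1) * (s - c.2))).
    by rewrite cell_kernelE /complex.Re eph eam -[LHS]mulrA.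
  have hI s : Im (cell_kernel om c (r, s) y) = P0 * (expR (2 * al * v2 * (s - c.2)) * sin (q + - (B / 2 * v1) * (s - c.2))).
    by rewrite cell_kernelE /complex.Im eph eam -[LHS]mulrA.
  split; apply: le_trans hb.
  + have -> : Re (kernel_defect om c (r, u) (fun i => (r, z i)) w y) =
      Re (cell_kernel om c (r, u) y) - \sum_i w i * Re (cell_kernel om c (r, z i) y) by [].
    by rewrite hR; under eq_bigr do rewrite hR.
  + have -> : Im (kernel_defect om c (r, u) (fun i => (r, z i)) w y) =
      Im (cell_kernel om c (r, u) y) - \sum_i w i * Im (cell_kernel om c (r, z i) y) by [].
    by rewrite hI; under eq_bigr do rewrite hI.
- pose v1 := y.1 - c.1; pose v2 := y.2 - c.2.
  pose P0 := am * expR (- al * sqdist c y) * expR (2 * al * v2 * (r - c.2)).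
  pose q := om + B / 2 * (c.1 * v2 - c.2 * v1) - B / 2 * ((r - c.2) * v1).
  have P00 : 0 <= P0 by rewrite mulr_ge0 ?expR_ge0.
  have [h1 h2] := wave_interpolation q (2 * al * v1) (B / 2 * v2) P00 l1 lam0 zL uL wL wP.
  have eph s : cell_phase om c (s, r) y = q + B / 2 * v2 * (s - c.1).
    by rewrite /cell_phase /q /v1 /v2 /=; ring.
  have eam s : cell_amplitude c (s, r) y = P0 * expR (2 * al * v1 * (s - c.1)).
    by rewrite /cell_amplitude /P0 /v1 /v2 -[RHS]mulrA [X in _ = _ * X]mulrC.
  have hb : 2 * (1 + Lam) / lam ^+ D * (P0 * expR ((lam + 2) * ((`|2 * al * v1| + `|B / 2 * v2|) * l.1)))
     <= cell_error Lam lam l D * spread c y.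
    apply: fin; rewrite /P0 -[leLHS]mulrA.
    apply: (@cell_exponent_le lam l c y (r - c.2) _ l.2) => //; [|exact: ltW| |by rewrite lerDr].
    + by rewrite ger0_norm ?subr_ge0// lerBlDl.
    + rewrite addrK -/v1 -/v2.
      have := slope_le v1 v2 => h.
      have -> : 2 * al * (`|v1| + `|v2|) * (lam + 2) * l.1 = (lam + 2) * (2 * al * (`|v1| + `|v2|) * l.1).
        by move: (hal B t) => a; ring.
      by rewrite ler_pM2l ?addr_gt0// ler_pM2r.
  have hR s : Re (cell_kernel om c (s, r) y) = P0 * (expR (2 * al * v1 * (s - c.1)) * cos (q + B / 2 * v2 * (s - c.1))).
    by rewrite cell_kernelE /complex.Re eph eam -[LHS]mulrA.
  have hI s : Im (cell_kernel om c (s, r) y) = P0 * (expR (2 * al * v1 * (s - c.1)) * sin (q + B / 2 * v2 * (s - c.1))).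
    by rewrite cell_kernelE /complex.Im eph eam -[LHS]mulrA.
  split; apply: le_trans hb.
  + have -> : Re (kernel_defect om c (u, r) (fun i => (z i, r)) w y) =
      Re (cell_kernel om c (u, r) y) - \sum_i w i * Re (cell_kernel om c (z i, r) y) by [].
    by rewrite hR; under eq_bigr do rewrite hR.
  + have -> : Im (kernel_defect om c (u, r) (fun i => (z i, r)) w y) =
      Im (cell_kernel om c (u, r) y) - \sum_i w i * Im (cell_kernel om c (z i, r) y) by [].
    by rewrite hI; under eq_bigr do rewrite hI.
Qed.

End CellKernel.

Section RipSum.
Context d (T : measurableType d) (R : realType) (mu : {measure set T -> \bar R}).

Lemma rip_suml (I : Type) (s : seq I) (a : I -> R) (f : I -> T -> R[i]) g :
  (forall i, csqint mu (f i)) -> csqint mu g ->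
  csqint mu (fun y => \sum_(i <- s) (a i)%:C%C * f i y) /\
  rip mu (fun y => \sum_(i <- s) (a i)%:C%C * f i y) g = \sum_(i <- s) a i * rip mu (f i) g.
Proof.
move=> cf cg; elim: s => [|i s [IH1 IH2]].
  have -> : (fun y => \sum_(i <- [::]) (a i)%:C%C * f i y) = (fun y => 0%:C%C * g y).
    by apply/funext => y; rewrite big_nil mul0r.
  by split; [exact: csqintZ|rewrite (ripZl _ cg cg) mul0r big_nil].
have -> : (fun y => \sum_(j <- i :: s) (a j)%:C%C * f j y) =
    (fun y => (a i)%:C%C * f i y + \sum_(j <- s) (a j)%:C%C * f j y).
  by apply/funext => y; rewrite big_cons.
have ci := csqintZ (a i) (cf i).
split; first exact: csqintD.
by rewrite (ripDl ci IH1 cg) (ripZl _ (cf i) cg) IH2 big_cons.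
Qed.

End RipSum.

Section WeightedSums.
Variable R : realType.

(** The weights E^k fit the size of the k-th iterate: for a k = t^k / k! the first factor is a
    partial sum of exp(E t), and the second stays of that order when b k is comparable to E^k. *)
Lemma sum_weighted_CS (a b : nat -> R) (E : R) n : 0 < E -> (forall k, 0 <= a k) ->
  (\sum_(0 <= k < n) a k * b k) ^+ 2 <=
  (\sum_(0 <= k < n) a k * E ^+ k) * (\sum_(0 <= k < n) a k / E ^+ k * b k ^+ 2).
Proof.
move=> E0 a0; elim: n => [|n IH]; first by rewrite !big_geq// expr0n /= mul0r.
rewrite !big_nat_recr//=; set X := \sum_(0 <= k < n) a k * b k in IH *.
set P := \sum_(0 <= k < n) a k * E ^+ k in IH *; set Q := \sum_(0 <= k < n) _ / _ * _ in IH *.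
have e0 : 0 < E ^+ n by rewrite exprn_gt0.
have P0 : 0 <= P by apply: sumr_ge0 => k _; rewrite mulr_ge0// exprn_ge0// ltW.
have Q0 : 0 <= Q.
  by apply: sumr_ge0 => k _; rewrite mulr_ge0 ?sqr_ge0// divr_ge0// exprn_ge0// ltW.
move: (E ^+ n) e0 (a n) (a0 n) (b n) => e e0 w w0 v.
have X2 : 2 * (X * v) <= P * v ^+ 2 / e + Q * e.
  have h1 : `|X * v| <= Num.sqrt (P * v ^+ 2 / e * (Q * e)).
    have -> : P * v ^+ 2 / e * (Q * e) = (P * Q) * v ^+ 2 by field; rewrite gt_eqF.
    rewrite -sqrtr_sqr ler_sqrt; last by rewrite mulr_ge0 ?sqr_ge0 ?mulr_ge0.
    by rewrite exprMn ler_wpM2r ?sqr_ge0.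
  have p0 : 0 <= P * v ^+ 2 / e := divr_ge0 (mulr_ge0 P0 (sqr_ge0 v)) (ltW e0).
  have q0 : 0 <= Q * e := mulr_ge0 Q0 (ltW e0).
  move: h1; rewrite sqrtrM//; set p := Num.sqrt _; set q := Num.sqrt _ => h1.
  have ep : P * v ^+ 2 / e = p ^+ 2 by rewrite sqr_sqrtr.
  have eq : Q * e = q ^+ 2 by rewrite sqr_sqrtr.
  rewrite ep eq; have := ler_norm (X * v); have := sqr_ge0 (p - q); move: h1.
  by move: (X * v) => z; lra.
have -> : (X + w * v) ^+ 2 = X ^+ 2 + w * (2 * (X * v)) + w ^+ 2 * v ^+ 2 by ring.
have -> : (P + w * e) * (Q + w / e * v ^+ 2) =
   P * Q + w * (P * v ^+ 2 / e + Q * e) + w ^+ 2 * v ^+ 2 by field; rewrite gt_eqF.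
by rewrite lerD2r lerD// ler_wpM2l.
Qed.

Lemma limit_sqr_le (u : R^nat) (l : R) (X : \bar R) : u n @[n --> \oo] --> l ->
  (forall n, ((u n ^+ 2)%:E <= X)%E) -> ((l ^+ 2)%:E <= X)%E.
Proof.
move=> ul; case: X => [X| |] h; first last.
- by have := h 0%N.
- by rewrite leey.
have h2 : u n ^+ 2 @[n --> \oo] --> l ^+ 2 by apply: cvgM.
rewrite lee_fin -(cvg_lim _ h2)//; apply: limr_le; first by apply/cvg_ex; eexists; exact: h2.
by apply: nearW => n; have := h n; rewrite lee_fin.
Qed.

End WeightedSums.

Lemma complex_defect (R : realType) (I : Type) (r : seq I) (w : I -> R) (z : R[i]) (zs : I -> R[i]) :
  Complex (Re z - \sum_(i <- r) w i * Re (zs i)) (Im z - \sum_(i <- r) w i * Im (zs i)) =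
  z - \sum_(i <- r) (w i)%:C%C * zs i.
Proof.
have -> : \sum_(i <- r) (w i)%:C%C * zs i =
    Complex (\sum_(i <- r) w i * Re (zs i)) (\sum_(i <- r) w i * Im (zs i)).
  elim: r => [|i r IH]; first by rewrite !big_nil.
  rewrite !big_cons IH; case: (zs i) => a b; apply/eqP; rewrite eq_complex /=.
  by apply/andP; split; apply/eqP; ring.
by case: z.
Qed.

(** * Pairing of small kernels with the iterates *)

Section CellPairing.
Variables (R : realType) (B t : R).
Hypothesis B0 : 0 < B.
Hypothesis t0 : 0 < t.
Local Notation leb := (leb2 R).
Local Notation al := (hal B t).
Local Notation am := (ham B t).
Implicit Types (c l x y : R * R) (g : plane R -> R[i]).

Definition local_mass c g : \bar R := (\int[leb]_y (spread B t c y * rdot (g y) (g y))%:E)%E.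

Let al0 : 0 < al := hal_gt0 B0 t0.
Let am0 : 0 < am := ham_gt0 B0 t0.

(** Cauchy-Schwarz with [spread] split as w^2: k / w is bounded by e w in each component, so its
    squared norm is at most 2 e^2 times the integral of [spread], itself at most 2. *)
Lemma small_kernel_pairing e c k g : 0 <= e -> csqint leb k -> csqint leb g ->
  small_kernel B t e c k -> ((rip leb k g ^+ 2)%:E <= (4 * e ^+ 2)%:E * local_mass c g)%E.
Proof.
move=> e0 ck cg hk.
have a4 : 0 < al / 4 by rewrite divr_gt0.
have a2 : 0 < al / 2 by rewrite divr_gt0.
pose w (y : R * R) : R := Num.sqrt am * expR (- (al / 4) * sqdist c y).
pose wi (y : R * R) : R := (Num.sqrt am)^-1 * expR (- - (al / 4) * sqdist c y).
have sam : 0 < Num.sqrt am by rewrite sqrtr_gt0.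
have ww y : w y * w y = spread B t c y.
  rewrite /w /spread.
  have -> : - (al / 2) * sqdist c y = - (al / 4) * sqdist c y + - (al / 4) * sqdist c y by field.
  rewrite expRD -[in RHS](sqr_sqrtr (ltW am0)); move: (Num.sqrt am) => s; ring.
have wwi y : wi y * w y = 1.
  rewrite /w /wi.
  have : expR (- - (al / 4) * sqdist c y) * expR (- (al / 4) * sqdist c y) = 1.
    by rewrite -expRD -[RHS]expR0; congr expR; ring.
  move: (expR _) (expR _) (Num.sqrt am) sam => a b s s0 ab.
  by have -> : s^-1 * b * (s * a) = b * a by field; rewrite gt_eqF.
have w0 y : 0 <= w y by rewrite mulr_ge0 ?expR_ge0 ?sqrtr_ge0.
have wi0 y : 0 <= wi y by rewrite mulr_ge0 ?expR_ge0 ?invr_ge0 ?sqrtr_ge0.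
have w1 y : w y <= Num.sqrt am.
  rewrite ler_piMr ?sqrtr_ge0// expR_le1 mulNr oppr_le0.
  exact: (mulr_ge0 (ltW a4) (sqdist_ge0 c y)).
have mw : measurable_fun setT (w : plane R -> R).
  exact: (measurable_funM (measurable_cst _) (measurable_plane (measurable_gauss2 (al / 4) c))).
have mwi : measurable_fun setT (wi : plane R -> R).
  exact: (measurable_funM (measurable_cst _) (measurable_plane (measurable_gauss2 (- (al / 4)) c))).
have wk (v : plane R -> R) : measurable_fun setT v -> (forall y, `|v y| <= e * spread B t c y) ->
    sqint leb (fun y => wi y * v y) /\ forall y, `|wi y * v y| <= e * w y.
  move=> mv hv.
  have b y : `|wi y * v y| <= e * w y.
    have -> : `|wi y * v y| = wi y * `|v y| by rewrite normrM ger0_norm.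
    apply: (le_trans (ler_wpM2l (wi0 y) (hv y))); rewrite -ww.
    have -> : wi y * (e * (w y * w y)) = (wi y * w y) * (e * w y) by ring.
    by rewrite wwi mul1r.
  split; last exact: b.
  have M0 : 0 <= e * Num.sqrt am by rewrite mulr_ge0// sqrtr_ge0.
  apply: (sqint_gauss_le a4 (measurable_funM mwi mv) M0 (x := c)) => y.
  by apply: (le_trans (b y)); rewrite /w mulrA.
have [[mk1 _] [mk2 _]] := ck.
have [s1 b1] := wk _ mk1 (fun y => (hk y).1); have [s2 b2] := wk _ mk2 (fun y => (hk y).2).
pose K (y : plane R) : R[i] := Complex (wi y * Re (k y)) (wi y * Im (k y)).
pose G (y : plane R) : R[i] := Complex (w y * Re (g y)) (w y * Im (g y)).
have cK : csqint leb K by split.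
have wg (v : plane R -> R) : sqint leb v -> sqint leb (fun y => w y * v y).
  move=> sv; have [mv _] := sv.
  apply: (sqint_le _ (sqintZ (Num.sqrt am) sv)); first exact: measurable_funM.
  move=> y; have -> : `|w y * v y| = w y * `|v y| by rewrite normrM ger0_norm.
  rewrite normrM (ger0_norm (sqrtr_ge0 _)).
  by rewrite ler_wpM2r.
have cG : csqint leb G by split; apply: wg; [exact: cg.1|exact: cg.2].
have e1 : rip leb k g = rip leb K G.
  apply: eq_Rintegral => y _; rewrite /K /G /rdot /=.
  have := wwi y; move: (wi y) (w y) (Re (k y)) (Im (k y)) (Re (g y)) (Im (g y)) => a b p q r s ab.
  transitivity ((a * b) * (p * r + q * s)); last by ring.
  by rewrite ab mul1r.
have KK : rip leb K K <= 4 * e ^+ 2.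
  have iS : leb.-integrable setT (EFin \o (fun y : plane R => 2 * e ^+ 2 * am * expR (- (al / 2) * sqdist c y))).
    exact: (integrableZl measurableT (2 * e ^+ 2 * am) (gauss_integrable c a2)).
  apply: (@le_trans _ _ (\int[leb]_y (2 * e ^+ 2 * am * expR (- (al / 2) * sqdist c y)))).
    apply: le_Rintegral; [exact: measurableT|exact: (csqint_integrable cK cK)|exact: iS|].
    move=> y _; have -> : 2 * e ^+ 2 * am * expR (- (al / 2) * sqdist c y) = (e * w y) ^+ 2 + (e * w y) ^+ 2.
      have := ww y; rewrite /spread; move: (w y) (ham B t) (expR _) => u a v uv.
      have -> : 2 * e ^+ 2 * a * v = 2 * e ^+ 2 * (a * v) by ring.
      by rewrite -uv; ring.
    have sq (p q : R) : `|p| <= q -> p ^+ 2 <= q ^+ 2.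
      by move=> h; rewrite -[p ^+ 2]real_normK ?num_real// lerXn2r ?nnegrE// (le_trans _ h).
    rewrite /rdot -!expr2; apply: lerD; apply: sq; [exact: b1|exact: b2].
  rewrite (RintegralZl (2 * e ^+ 2 * am) measurableT (gauss_integrable c a2)) (Rintegral_gauss c a2).
  have -> : 2 * e ^+ 2 * am * (pi / (al / 2)) = 4 * e ^+ 2 * (am * pi / al).
    by move: (hal B t) al0 (ham B t) (@pi R) => a h b p; field; rewrite gt_eqF.
  rewrite ler_piMr ?mulr_ge0 ?sqr_ge0//; exact: ham_hal_le1.
have GG : local_mass c g = (rip leb G G)%:E.
  rewrite -(rip_EFin cG cG); apply: eq_integral => y _; congr EFin.
  by rewrite -ww /G /rdot /=; move: (w y) => a; ring.
rewrite GG -EFinM lee_fin e1 (le_trans (rip_CS cK cG))// ler_wpM2r ?rip_ge0//.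
Qed.

Variables (fk : nat -> plane R -> R[i]) (E N0 : R).
Hypothesis E0 : 0 < E.
Hypothesis lfk : forall k, landau B (fk k) (fk k.+1).
Hypothesis nfk : forall k, rip leb (fk k) (fk k) <= (E ^+ k) ^+ 2 * N0.
Local Notation F := (heat_extension B fk t).

Let cfk k : csqint leb (fk k). Proof. by have [] := landauP (lfk k). Qed.

Definition cell_extension om c x : R := expR (al * sqdist c x) * F (gauge B om c x) x.

(** A local mass is quadratic in the iterate, so of size E^(2k); divided by E^k it still leaves the
    terms of the series of exp(E t) after integration over c ([integral_total_mass]). *)
Definition total_mass c : \bar R :=
  (\sum_(0 <= k <oo) (exp_coeff t k / E ^+ k)%:E * local_mass c (fk k))%E.

Lemma local_mass_ge0 c g : (0 <= local_mass c g)%E.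
Proof.
apply: integral_ge0 => y _; rewrite lee_fin mulr_ge0//.
  by rewrite mulr_ge0 ?expR_ge0// ltW.
by rewrite /rdot -!expr2 addr_ge0 ?sqr_ge0.
Qed.

Let wt0 k : 0 <= exp_coeff t k / E ^+ k.
Proof. by rewrite divr_ge0 ?exp_coeff_ge0 ?exprn_ge0// ltW. Qed.

(** The series of pairings is linear in the kernel, so the defect of the extension is the series of
    pairings of the defect of the kernel. The weighted Cauchy-Schwarz inequality then splits off
    exp(E t) from the local masses. *)
Lemma cell_extension_defect om c D (z : R * R) (zs : 'I_D.+1 -> R * R) (w : 'I_D.+1 -> R) e :
  0 <= e -> small_kernel B t e c (kernel_defect B t om c z zs w) ->
  (((cell_extension om c z - \sum_i w i * cell_extension om c (zs i)) ^+ 2)%:E <=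
   (4 * e ^+ 2 * expR (E * t))%:E * total_mass c)%E.
Proof.
move=> e0 hk; set K := kernel_defect B t om c z zs w in hk.
have KE : K = (fun y => cell_kernel B t om c z y - \sum_(i <- index_enum 'I_D.+1) (w i)%:C%C * cell_kernel B t om c (zs i) y).
  by apply/funext => y; exact: complex_defect.
have cz om' c' z' := csqint_cell_kernel B0 t0 om' c' z'.
have [csum _] := rip_suml (index_enum 'I_D.+1) w (fun i => cz om c (zs i)) (cfk 0%N).
have cK : csqint leb K by rewrite KE; exact: csqintB.
have ripK k : rip leb K (fk k) = rip leb (cell_kernel B t om c z) (fk k) -
    \sum_i w i * rip leb (cell_kernel B t om c (zs i)) (fk k).
  rewrite KE (ripBl (cz om c z) csum (cfk k)).
  by rewrite (rip_suml (index_enum 'I_D.+1) w (fun i => cz om c (zs i)) (cfk k)).2.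
have ser x : series (fun k => exp_coeff t k * rip leb (cell_kernel B t om c x) (fk k)) n @[n --> \oo]
    --> cell_extension om c x.
  have h := @heat_extension_series R B B0 fk E N0 t E0 t0 lfk nfk (gauge B om c x) x.
  have h2 : expR (al * sqdist c x) * series (fun k => exp_coeff t k * rip leb (heat B t (gauge B om c x) x) (fk k)) n
     @[n --> \oo] --> cell_extension om c x.
    by apply: cvgM; [exact: cvg_cst|exact: h].
  rewrite (_ : (fun n => _) = (fun n => expR (al * sqdist c x) *
     series (fun k => exp_coeff t k * rip leb (heat B t (gauge B om c x) x) (fk k)) n))//.
  apply/funext => n; rewrite /series /= mulr_sumr; apply: eq_bigr => k _.
  by rewrite (ripZl _ (csqint_heat B0 _ x t0) (cfk k)) mulrCA.
have serK : series (fun k => exp_coeff t k * rip leb K (fk k)) n @[n --> \oo] -->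
    cell_extension om c z - \sum_i w i * cell_extension om c (zs i).
  have h : series (fun k => exp_coeff t k * rip leb (cell_kernel B t om c z) (fk k)) n -
    \sum_i w i * series (fun k => exp_coeff t k * rip leb (cell_kernel B t om c (zs i)) (fk k)) n @[n --> \oo] -->
    cell_extension om c z - \sum_i w i * cell_extension om c (zs i).
    apply: cvgB; first exact: ser.
    elim: (index_enum _) => [|i r IH].
      by under eq_fun do rewrite big_nil; rewrite big_nil; exact: cvg_cst.
    under eq_fun do rewrite big_cons; rewrite big_cons.
    by apply: cvgD; [apply: cvgM; [exact: cvg_cst|exact: ser]|exact: IH].
  rewrite (_ : (fun n => _) = (fun n => series (fun k => exp_coeff t k * rip leb (cell_kernel B t om c z) (fk k)) n -
    \sum_i w i * series (fun k => exp_coeff t k * rip leb (cell_kernel B t om c (zs i)) (fk k)) n))//.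
  apply/funext => n; rewrite /series /=.
  have -> : \sum_(i < D.+1) w i * (\sum_(0 <= k < n) exp_coeff t k * rip leb (cell_kernel B t om c (zs i)) (fk k)) =
      \sum_(0 <= k < n) \sum_(i < D.+1) w i * (exp_coeff t k * rip leb (cell_kernel B t om c (zs i)) (fk k)).
    by rewrite exchange_big /=; apply: eq_bigr => i _; rewrite mulr_sumr.
  rewrite -sumrB; apply: eq_bigr => k _.
  rewrite ripK mulrBr mulr_sumr; congr (_ - _); apply: eq_bigr => i _; ring.
apply: (limit_sqr_le serK) => n.
have ec0 k : 0 <= exp_coeff t k by rewrite exp_coeff_ge0// ltW.
have CS := sum_weighted_CS (fun k => rip leb K (fk k)) n E0 ec0.
have s1 : \sum_(0 <= k < n) exp_coeff t k * E ^+ k <= expR (E * t).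
  apply: le_trans (series_exp_coeff_le n _); last by rewrite mulr_ge0// ltW.
  rewrite /series /=; apply: ler_sum => k _; rewrite /exp_coeff /= exprMn.
  by apply: eq_ler; ring.
apply: (@le_trans _ _ ((expR (E * t))%:E * (\sum_(0 <= k < n) exp_coeff t k / E ^+ k * rip leb K (fk k) ^+ 2)%:E)%E).
  rewrite -EFinM lee_fin; apply: (le_trans CS); rewrite ler_wpM2r//.
  by apply: sumr_ge0 => k _; rewrite mulr_ge0 ?sqr_ge0.
have -> : (4 * e ^+ 2 * expR (E * t))%:E = ((expR (E * t))%:E * (4 * e ^+ 2)%:E)%E.
  by rewrite -EFinM; congr EFin; ring.
rewrite -muleA lee_wpmul2l ?lee_fin ?expR_ge0// /total_mass -nneseriesZl; last first.
  by move=> k _; rewrite mule_ge0 ?local_mass_ge0// lee_fin.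
apply: (@le_trans _ _ (\sum_(0 <= k < n) ((4 * e ^+ 2)%:E * ((exp_coeff t k / E ^+ k)%:E * local_mass c (fk k))))%E).
  rewrite -sumEFin; apply: lee_sum => k _.
  rewrite EFinM muleCA lee_wpmul2l ?lee_fin//.
  exact: small_kernel_pairing.
apply: nneseries_lim_ge => k _ _.
apply: mule_ge0; first by rewrite lee_fin mulr_ge0// sqr_ge0.
by apply: mule_ge0; [rewrite lee_fin; exact: wt0|exact: local_mass_ge0].
Qed.

End CellPairing.

Section CellEstimate.
Variables (R : realType) (B t : R).
Hypothesis B0 : 0 < B.
Hypothesis t0 : 0 < t.
Local Notation leb := (leb2 R).
Local Notation al := (hal B t).
Implicit Types (c x y : R * R).
Variables (fk : nat -> plane R -> R[i]) (E N0 : R).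
Hypothesis E0 : 0 < E.
Hypothesis lfk : forall k, landau B (fk k) (fk k.+1).
Hypothesis nfk : forall k, rip leb (fk k) (fk k) <= (E ^+ k) ^+ 2 * N0.
Local Notation F := (heat_extension B fk t).
Variable l : R * R.
Hypothesis l1 : 0 < l.1.
Hypothesis l2 : 0 < l.2.

Let al0 : 0 < al := hal_gt0 B0 t0.

Lemma combination_le (I : finType) (w g : I -> R) (g0 Lam tau e : R) :
  0 <= tau -> \sum_i `|w i| <= Lam -> (forall i, `|g i| <= tau) ->
  `|g0 - \sum_i w i * g i| <= e -> `|g0| <= Lam * tau + e.
Proof.
move=> tau0 wL gt ge.
have -> : g0 = \sum_i w i * g i + (g0 - \sum_i w i * g i) by ring.
apply: (le_trans (ler_normD _ _)); rewrite lerD//.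
apply: (le_trans (ler_norm_sum _ _ _)).
apply: le_trans (ler_wpM2r tau0 wL); rewrite mulr_suml; apply: ler_sum => i _.
by rewrite normrM ler_wpM2l.
Qed.

Lemma sqr_le_norm (d e : R) : 0 <= e -> d ^+ 2 <= e -> `|d| <= Num.sqrt e.
Proof. by move=> e0 de; rewrite -sqrtr_sqr ler_sqrt. Qed.

Lemma double_sqr_le (p q : R) : (p + q) ^+ 2 + (p + q) ^+ 2 <= 4 * p ^+ 2 + 4 * q ^+ 2.
Proof.
rewrite -subr_ge0.
have -> : 4 * p ^+ 2 + 4 * q ^+ 2 - ((p + q) ^+ 2 + (p + q) ^+ 2) = 2 * (p - q) ^+ 2 by ring.
by rewrite mulr_ge0// sqr_ge0.
Qed.

Definition cell_defect Lam lam D c : R :=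
  Num.sqrt (4 * cell_error B t Lam lam l D ^+ 2 * expR (E * t) * fine (total_mass B t fk E c)).

Lemma total_mass_ge0 c : (0 <= total_mass B t fk E c)%E.
Proof.
apply: nneseries_ge0 => k _ _; apply: mule_ge0; last exact: local_mass_ge0.
by rewrite lee_fin divr_ge0 ?exp_coeff_ge0 ?exprn_ge0// ltW.
Qed.

(** The bound on [A] is asked for all phases because the gauge inside [cell_extension] varies with
    the point. Each of the two interpolations multiplies the bound by Lam and adds one defect. *)
Lemma cell_extension_bound om c (A : set (plane R)) (m tau lam : R) (D M : nat) :
  measurable A -> A `<=` box c l -> 0 < m -> m <= 4 * (l.1 * l.2) -> (m%:E <= leb A)%E ->
  0 <= tau -> (forall th x, A x -> `|F th x| <= tau) ->
  2 * D.+1%:R * (4 * (l.1 * l.2)) <= M%:R * m -> 0 < lam ->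
  (total_mass B t fk E c < +oo)%E ->
  let Lam := expR (3 * M%:R) in
  forall x, box c l x -> `|cell_extension B t fk om c x| <=
    Lam * (Lam * (expR (al * (l.1 ^+ 2 + l.2 ^+ 2)) * tau) + cell_defect Lam lam D c) + cell_defect Lam lam D c.
Proof.
move=> mA sA m0 ml hA tau0 At hM lam0 Sfin Lam.
set tau' := expR _ * tau; set eps := cell_defect _ _ _ _.
have tau'0 : 0 <= tau' by rewrite mulr_ge0 ?expR_ge0.
have Lam0 : 0 <= Lam by exact: expR_ge0.
have ce0 : 0 <= cell_error B t Lam lam l D.
  by rewrite /cell_error !mulr_ge0 ?expR_ge0 ?invr_ge0 ?exprn_ge0 ?addr_ge0// ltW.
have eps0 : 0 <= eps by exact: sqrtr_ge0.
pose G x := cell_extension B t fk om c x.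
have defect (z : R * R) (zs : 'I_D.+1 -> R * R) w :
    small_kernel B t (cell_error B t Lam lam l D) c (kernel_defect B t om c z zs w) ->
    `|G z - \sum_i w i * G (zs i)| <= eps.
  move=> hk; have := cell_extension_defect B0 t0 E0 lfk nfk ce0 hk.
  have Sn : total_mass B t fk E c \is a fin_num by rewrite ge0_fin_numE// total_mass_ge0.
  rewrite -[X in (_ <= _ * X)%E]fineK// -EFinM lee_fin => h.
  apply: sqr_le_norm => //; rewrite mulr_ge0 ?fine_ge0 ?total_mass_ge0//.
  by rewrite mulr_ge0 ?expR_ge0// mulr_ge0 ?sqr_ge0.
have GA x : A x -> `|G x| <= tau'.
  move=> Ax; have [] := sA _ Ax; rewrite /= !in_itv /= => /andP[x1 x2] /andP[x3 x4].
  rewrite /G /cell_extension normrM ger0_norm ?expR_ge0// ler_pM ?expR_ge0 ?At//.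
  rewrite ler_expR ler_pM2l// /sqdist.
  have sq (p q : R) : 0 <= p -> p <= q -> p ^+ 2 <= q ^+ 2.
    by move=> p0 pq; rewrite lerXn2r ?nnegrE// (le_trans p0).
  by apply: lerD; apply: sq; rewrite ?subr_ge0// lerBlDl.
have [T1 [mT1 sT1 hT1 HT1]] := large_slices l1 l2 mA sA m0 hA.
have d1 : m / (4 * l.2) <= l.1.
  by rewrite ler_pdivrMr ?mulr_gt0//; apply: (le_trans ml); apply: eq_ler; ring.
have d2 : m / (4 * l.1) <= l.2.
  by rewrite ler_pdivrMr ?mulr_gt0//; apply: (le_trans ml); apply: eq_ler; ring.
have M1 : 2 * D.+1%:R * l.1 <= M%:R * (m / (4 * l.2)).
  rewrite mulrA ler_pdivlMr ?mulr_gt0//; apply: le_trans hM; apply: eq_ler; ring.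
have M2 : 2 * D.+1%:R * l.2 <= M%:R * (m / (4 * l.1)).
  rewrite mulrA ler_pdivlMr ?mulr_gt0//; apply: le_trans hM; apply: eq_ler; ring.
have m1p : 0 < m / (4 * l.2) by rewrite divr_gt0// mulr_gt0.
have m2p : 0 < m / (4 * l.1) by rewrite divr_gt0// mulr_gt0.
have seg (T : set R) (a L : R) (n : nat) (z : 'I_n -> R) : T `<=` `[a, a + L] -> (forall i, T (z i)) ->
    forall i, a <= z i <= a + L.
  by move=> sT Tz i; have := sT _ (Tz i); rewrite /= in_itv.
have step1 u1 u2 : T1 u1 -> c.2 <= u2 <= c.2 + l.2 -> `|G (u1, u2)| <= Lam * tau' + eps.
  move=> Tu1 hu2; have [T2 [mT2 sT2 hT2 HT2]] := HT1 _ Tu1.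
  have [z [Tz hz]] := interpolation l2 m2p d2 mT2 sT2 hT2 M2.
  have [w [wL wP]] := hz _ hu2.
  have u1i : c.1 <= u1 <= c.1 + l.1 by have := sT1 _ Tu1; rewrite /= in_itv.
  apply: (@combination_le _ w (fun i => G (u1, z i))) => //.
  - by move=> i; apply: GA; exact: HT2.
  - apply: (@defect (u1, u2) (fun i => (u1, z i))).
    exact: ((cell_kernel_line B0 t0 om c u1 l1 l2 lam0 wL wP).1 u1i (seg _ _ _ _ _ sT2 Tz) hu2).
case=> u1 u2 [] /=; rewrite !in_itv /= => hu1 hu2.
have [z [Tz hz]] := interpolation l1 m1p d1 mT1 sT1 hT1 M1.
have [w [wL wP]] := hz _ hu1.
apply: (@combination_le _ w (fun i => G (z i, u2))) => //.
- by rewrite addr_ge0// mulr_ge0.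
- by move=> i; exact: step1.
- apply: (@defect (u1, u2) (fun i => (z i, u2))).
  exact: ((cell_kernel_line B0 t0 om c u2 l1 l2 lam0 wL wP).2 hu2 (seg _ _ _ _ _ sT1 Tz) hu1).
Qed.

Definition extension_sqr x : R := F 0 x ^+ 2 + F (pi / 2) x ^+ 2.

Lemma extension_sqr_ge0 x : 0 <= extension_sqr x.
Proof. by rewrite addr_ge0 ?sqr_ge0. Qed.

Lemma measurable_extension_sqr : measurable_fun setT (extension_sqr : plane R -> R).
Proof.
exact: (measurable_funD (measurable_funX 2 (measurable_heat_extension B0 E0 t0 lfk nfk 0))
  (measurable_funX 2 (measurable_heat_extension B0 E0 t0 lfk nfk (pi / 2)))).
Qed.

Lemma cell_sqr_bound c (A : set (plane R)) (m tau lam : R) (D M : nat) :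
  measurable A -> A `<=` box c l -> 0 < m -> m <= 4 * (l.1 * l.2) -> (m%:E <= leb A)%E ->
  0 <= tau -> (forall x, A x -> extension_sqr x <= tau) ->
  2 * D.+1%:R * (4 * (l.1 * l.2)) <= M%:R * m -> 0 < lam ->
  (total_mass B t fk E c < +oo)%E ->
  let Lam := expR (3 * M%:R) in
  forall x, box c l x -> extension_sqr x <=
    4 * Lam ^+ 4 * expR (2 * (al * (l.1 ^+ 2 + l.2 ^+ 2))) * tau +
    16 * (Lam + 1) ^+ 2 * cell_error B t Lam lam l D ^+ 2 * expR (E * t) * fine (total_mass B t fk E c).
Proof.
move=> mA sA m0 ml hA tau0 At hM lam0 Sfin Lam x bx.
have At' th y : A y -> `|F th y| <= Num.sqrt tau.
  move=> /At h; apply: sqr_le_norm => //; apply: le_trans h.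
  rewrite /extension_sqr -(heat_extension_sqr B0 E0 t0 lfk nfk th y) lerDl; exact: sqr_ge0.
have bnd om := cell_extension_bound om mA sA m0 ml hA (sqrtr_ge0 tau) At' hM lam0 Sfin bx.
have b0 := bnd 0; have b1 := bnd (pi / 2).
rewrite -/Lam in b0 b1.
set eps := cell_defect _ _ _ _ in b0 b1; set P := expR (al * _) in b0 b1.
have eps2 : eps ^+ 2 = 4 * cell_error B t Lam lam l D ^+ 2 * expR (E * t) * fine (total_mass B t fk E c).
  rewrite sqr_sqrtr// mulr_ge0 ?fine_ge0 ?total_mass_ge0//.
  by rewrite mulr_ge0 ?expR_ge0// mulr_ge0 ?sqr_ge0.
have P2 : expR (2 * (al * (l.1 ^+ 2 + l.2 ^+ 2))) = P ^+ 2 by rewrite mulrC expRM_natr.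
have t2 : tau = Num.sqrt tau ^+ 2 by rewrite sqr_sqrtr.
rewrite [X in _ <= _ * X + _]t2 P2.
have -> : 16 * (Lam + 1) ^+ 2 * cell_error B t Lam lam l D ^+ 2 * expR (E * t) * fine (total_mass B t fk E c) =
  4 * (Lam + 1) ^+ 2 * eps ^+ 2 by rewrite eps2; move: (cell_error _ _ _ _ _ _) (fine _) => u v; ring.
have gle om : F (gauge B om c x) x ^+ 2 <= (Lam * (Lam * (P * Num.sqrt tau) + eps) + eps) ^+ 2.
  have : `|F (gauge B om c x) x| <= Lam * (Lam * (P * Num.sqrt tau) + eps) + eps.
    apply: le_trans (bnd om); rewrite /cell_extension normrM [X in _ <= X * _]ger0_norm ?expR_ge0//.
    rewrite ler_peMl// -expR0 ler_expR mulr_ge0 ?sqdist_ge0// ltW//.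
  move=> h; rewrite -[leLHS]real_normK ?num_real// lerXn2r ?nnegrE//.
  by apply: le_trans h.
(* The offsets 0 and pi / 2 of the gauge give at x two phases that differ by pi / 2, hence two
   orthogonal components of F(x). *)
have -> : extension_sqr x = F (gauge B 0 c x) x ^+ 2 + F (gauge B (pi / 2) c x) x ^+ 2.
  have h := heat_extension_sqr B0 E0 t0 lfk nfk (gauge B 0 c x) x.
  have eg : gauge B 0 c x + pi / 2 = gauge B (pi / 2) c x.
    by rewrite /gauge; move: (@pi R) => p; ring.
  rewrite eg in h; exact: (esym h).
apply: (le_trans (lerD (gle 0) (gle (pi / 2)))).
set a := Lam * Lam * (P * Num.sqrt tau); set b := (Lam + 1) * eps.
have -> : Lam * (Lam * (P * Num.sqrt tau) + eps) + eps = a + b by rewrite /a /b; ring.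
have -> : 4 * Lam ^+ 4 * P ^+ 2 * Num.sqrt tau ^+ 2 = 4 * a ^+ 2 by rewrite /a; ring.
have -> : 4 * (Lam + 1) ^+ 2 * eps ^+ 2 = 4 * b ^+ 2 by rewrite /b; ring.
exact: double_sqr_le.
Qed.

End CellEstimate.

(** * From thickness to a bound on a cell *)

Section ThickCell.
Variables (R : realType) (B t : R).
Hypothesis B0 : 0 < B.
Hypothesis t0 : 0 < t.
Local Notation leb := (leb2 R).
Local Notation al := (hal B t).
Implicit Types (c x y : R * R).
Variables (fk : nat -> plane R -> R[i]) (E N0 : R).
Hypothesis E0 : 0 < E.
Hypothesis lfk : forall k, landau B (fk k) (fk k.+1).
Hypothesis nfk : forall k, rip leb (fk k) (fk k) <= (E ^+ k) ^+ 2 * N0.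
Variables (l : R * R) (rho : R) (S : set (plane R)).
Hypothesis hS : thick l rho S.
Local Notation ext := (extension_sqr B t fk).

Definition main_const (Lam : R) : R :=
  8 * Lam ^+ 4 * expR (2 * (al * (l.1 ^+ 2 + l.2 ^+ 2))) / (rho * (l.1 * l.2)).

Definition error_const (Lam lam : R) D : R :=
  16 * (Lam + 1) ^+ 2 * cell_error B t Lam lam l D ^+ 2 * expR (E * t).

Lemma main_const_gt0 Lam : 0 < Lam -> 0 < main_const Lam.
Proof.
have [_ [l1 l2] /andP[rho0 _] _] := hS; move=> Lam0.
by rewrite divr_gt0 ?mulr_gt0 ?exprn_gt0 ?expR_gt0.
Qed.

Lemma error_const_gt0 Lam lam D : 0 < Lam -> 0 < lam -> 0 < error_const Lam lam D.
Proof.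
have [_ [l1 l2] /andP[rho0 _] _] := hS; move=> Lam0 lam0.
have ce0 : 0 < cell_error B t Lam lam l D.
  by rewrite /cell_error !mulr_gt0 ?expR_gt0 ?invr_gt0 ?exprn_gt0 ?addr_gt0.
rewrite /error_const; apply: mulr_gt0; last exact: expR_gt0.
apply: mulr_gt0; last exact: exprn_gt0.
by apply: mulr_gt0 => //; rewrite exprn_gt0// addr_gt0.
Qed.

(** Chebyshev's inequality: the part of S in the cell where the squared extension exceeds the
    threshold tau has measure at most half of rho l.1 l.2, so [A], where it does not, keeps at least
    the other half, and [cell_sqr_bound] applies to it. *)
Lemma cell_thick_bound c (lam : R) (D M : nat) :
  16 * D.+1%:R <= M%:R * rho -> 0 < lam ->
  let Lam := expR (3 * M%:R) in let K1 := main_const Lam in let K2 := error_const Lam lam D in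
  forall x, box c l x ->
    ((ext x)%:E <= K1%:E * (\int[leb]_(y in S `&` box c l) (ext y)%:E)%E + K2%:E * total_mass B t fk E c)%E.
Proof.
have [mS [l1 l2] /andP[rho0 rho1] thickS] := hS.
move=> hM lam0 Lam K1 K2 x bx.
have ll0 : 0 < l.1 * l.2 by rewrite mulr_gt0.
have Lam0 : 0 < Lam by exact: expR_gt0.
have K10 : 0 < K1 := main_const_gt0 Lam0.
have K20 : 0 < K2 := error_const_gt0 D Lam0 lam0.
have mQ := measurable_box c l.
have mSQ : measurable (S `&` box c l) by exact: measurableI.
have mext := measurable_extension_sqr B0 t0 E0 lfk nfk.
have mextE (U : set (plane R)) : measurable_fun U (fun y : plane R => (ext y)%:E).
  by apply/measurable_EFinP; exact: measurable_funS mext.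
have ext0 := extension_sqr_ge0 B t fk.
have I0 : (0 <= \int[leb]_(y in S `&` box c l) (ext y)%:E)%E.
  by apply: integral_ge0 => y _; rewrite lee_fin.
have S0 := @total_mass_ge0 _ B t B0 t0 fk E E0 c.
(* If one of the two quantities is infinite, so is the right-hand side, because both constants are
   strictly positive. *)
case eI : (\int[leb]_(y in S `&` box c l) (ext y)%:E)%E I0 => [r| |] // r0; last first.
  rewrite gt0_muley ?lte_fin//; apply: (le_trans (leey _)).
  by rewrite leeDl// mule_ge0// lee_fin ltW.
case eS : (total_mass B t fk E c) S0 => [s| |] // s0; last first.
  rewrite gt0_muley ?lte_fin//; apply: (le_trans (leey _)).
  by rewrite leeDr// mule_ge0// lee_fin ltW.
rewrite -!EFinM -EFinD lee_fin; rewrite !lee_fin in r0 s0.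
apply/ler_addgt0Pr => d d0.
pose P2 := expR (2 * (al * (l.1 ^+ 2 + l.2 ^+ 2))).
have P20 : 0 < P2 by exact: expR_gt0.
pose q := 4 * Lam ^+ 4 * P2.
have q0 : 0 < q by rewrite !mulr_gt0 ?exprn_gt0.
(* A positive margin, which keeps tau positive even when the integral over the thick set vanishes;
   it costs q dl = d in the conclusion. *)
pose dl := d / q; have dl0 : 0 < dl by rewrite divr_gt0.
pose tau := 2 / (rho * (l.1 * l.2)) * r + dl.
have rl0 : 0 < rho * (l.1 * l.2) by rewrite mulr_gt0.
have tau0 : 0 < tau by rewrite ltr_wpDl// mulr_ge0// divr_ge0// ltW.
pose A : set (plane R) := (S `&` box c l) `&` [set y | ext y <= tau].
pose Bad : set (plane R) := (S `&` box c l) `\` A.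
have mA : measurable A.
  have -> : A = (S `&` box c l) `&` (ext @^-1` `]-oo, tau]).
    by apply/seteqP; split=> y [? h]; split=> //; move: h; rewrite /= in_itv.
  by apply: (measurable_funS measurableT (@subsetT _ _) mext mSQ); exact: measurable_itv.
have mBad : measurable Bad by exact: measurableD.
have Bgt y : Bad y -> tau <= ext y.
  by move=> [ySQ nA]; rewrite leNgt; apply/negP => h; apply: nA; split=> //=; exact: ltW.
have hbox : leb (box c l) = (l.1 * l.2)%:E by apply: leb2_box; exact: ltW.
have hth : ((rho * (l.1 * l.2))%:E <= leb (S `&` box c l))%E.
  have h : (rho%:E * leb (box c l) <= leb (S `&` box c l))%E := thickS c.
  by move: h; rewrite hbox -EFinM.
have tB : (tau%:E * leb Bad <= r%:E)%E.
  rewrite -(integral_cst leb mBad tau%:E) -eI.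
  have le1 : (\int[leb]_(y in Bad) tau%:E <= \int[leb]_(y in Bad) (ext y)%:E)%E.
    apply: ge0_le_integral; [exact: mBad| | | |].
    - by move=> y _; rewrite lee_fin ltW.
    - exact: measurable_cst.
    - exact: mextE.
    - by move=> y By; rewrite lee_fin; exact: Bgt.
  apply: (le_trans le1); apply: ge0_subset_integral; [exact: mBad|exact: mSQ|exact: mextE| |].
  - by move=> y _; rewrite lee_fin.
  - by move=> y [].
have hBad : (leb Bad <= (rho / 2 * (l.1 * l.2))%:E)%E.
  case: (leb Bad) tB => [b| |]; last by rewrite leNye.
    rewrite -EFinM !lee_fin => tB.
    rewrite -(ler_pM2l tau0); apply: (le_trans tB).
    have -> : tau * (rho / 2 * (l.1 * l.2)) = r + dl * (rho / 2 * (l.1 * l.2)).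
      by rewrite /tau; move: (l.1 * l.2) ll0 => z z0; field; rewrite !gt_eqF.
    by rewrite lerDl ltW// mulr_gt0// mulr_gt0// divr_gt0.
  by rewrite gt0_muley ?lte_fin.
have hA : ((rho / 2 * (l.1 * l.2))%:E <= leb A)%E.
  have sAS : A `<=` S `&` box c l by move=> y [].
  have le1 : (leb (S `&` box c l) <= leb A + leb Bad)%E.
    have -> : S `&` box c l = A `|` Bad.
      apply/seteqP; split=> y; last by case=> [/sAS|[]].
      by move=> ySQ; have [Ay|Ay] := pselect (A y); [left|right].
    exact: measureU2.
  have := le_trans hth (le_trans le1 (leeD2l _ hBad)).
  case: (leb A) => [a| |] //; rewrite ?leey//.
  rewrite -EFinD !lee_fin -lerBlDr; apply: le_trans.
  by apply: eq_ler; field.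
have ml : rho / 2 * (l.1 * l.2) <= 4 * (l.1 * l.2) by rewrite ler_pM2r// ler_pdivrMr// (le_trans rho1)// -natrM ler1n.
have mp : 0 < rho / 2 * (l.1 * l.2) by rewrite mulr_gt0// divr_gt0.
have hM' : 2 * D.+1%:R * (4 * (l.1 * l.2)) <= M%:R * (rho / 2 * (l.1 * l.2)).
  have -> : 2 * D.+1%:R * (4 * (l.1 * l.2)) = (16 * D.+1%:R) * ((l.1 * l.2) / 2) by field.
  have -> : M%:R * (rho / 2 * (l.1 * l.2)) = (M%:R * rho) * ((l.1 * l.2) / 2) by field.
  by rewrite ler_pM2r// divr_gt0.
have sfin : (total_mass B t fk E c < +oo)%E by rewrite eS ltry.
have At y : A y -> ext y <= tau by move=> [].
have sA : A `<=` box c l by move=> y [[]].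
have := cell_sqr_bound B0 t0 E0 lfk nfk l1 l2 mA sA mp ml hA (ltW tau0) At hM' lam0 sfin bx.
rewrite eS -[fine _]/s -/Lam -/P2 -/q -/(error_const Lam lam D) -/K2 => h; apply: (le_trans h).
have -> : q * tau = K1 * r + d.
  rewrite /tau mulrDr [q * dl]mulrC /dl divfK ?gt_eqF//; congr (_ + _).
  have -> : K1 = 2 * q / (rho * (l.1 * l.2)).
    by rewrite /K1 /main_const -/P2 /q; move: (_^-1) (Lam ^+ 4) => u v; ring.
  by move: (_^-1) => u; ring.
by rewrite addrAC.
Qed.

Lemma cell_integral_bound c (lam : R) (D M : nat) :
  16 * D.+1%:R <= M%:R * rho -> 0 < lam ->
  (\int[leb]_(x in box c l) (ext x)%:E <=
   ((main_const (expR (3 * M%:R)))%:E * (\int[leb]_(y in S `&` box c l) (ext y)%:E)%E +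
    (error_const (expR (3 * M%:R)) lam D)%:E * total_mass B t fk E c) * (l.1 * l.2)%:E)%E.
Proof.
move=> hM lam0; have [mS [l1 l2] /andP[rho0 rho1] _] := hS.
have mQ := measurable_box c l.
have hbox : leb (box c l) = (l.1 * l.2)%:E by apply: leb2_box; exact: ltW.
rewrite -hbox -(integral_cst leb mQ _).
apply: ge0_le_integral; [exact: mQ| | | |].
- by move=> x _; rewrite lee_fin extension_sqr_ge0.
- by apply/measurable_EFinP; apply: measurable_funS (measurable_extension_sqr B0 t0 E0 lfk nfk).
- exact: measurable_cst.
- by move=> x bx; exact: cell_thick_bound.
Qed.

End ThickCell.

(** * Averaging over cells *)

Section AveragingCells.
Variable R : realType.
Local Notation leb := (leb2 R).
Implicit Types (c l x y : R * R).

Definition box_indic l (z : plane R * plane R) : R :=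
  \1_(`[0, l.1]%classic : set (measurableTypeR R)) ((z.2 : R * R).1 - (z.1 : R * R).1) *
  \1_(`[0, l.2]%classic : set (measurableTypeR R)) ((z.2 : R * R).2 - (z.1 : R * R).2).

Lemma measurable_box_indic l : measurable_fun setT (box_indic l).
Proof.
have [m1 m2 m3 m4] := measurable_coordinates R.
apply: measurable_funM.
- apply: (measurableT_comp (measurable_indic (measurable_segment 0 l.1))).
  exact: measurable_funB.
- apply: (measurableT_comp (measurable_indic (measurable_segment 0 l.2))).
  exact: measurable_funB.
Qed.

Lemma box_indicE l c x : box_indic l (c, x) = \1_(box c l) x.
Proof.
rewrite /box_indic /= !indicE -natrM mulnb; congr (_%:R); congr nat_of_bool.
apply/idP/idP.
- move=> /andP[]; rewrite !inE /= !in_itv /= => /andP[a b] /andP[d e].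
  by split; rewrite /= in_itv /=; apply/andP; split; lra.
- rewrite inE => -[] /=; rewrite !in_itv /= => /andP[a b] /andP[d e].
  by apply/andP; split; apply/mem_set; rewrite /= in_itv /=; apply/andP; split; lra.
Qed.

Lemma box_indic_sym l c x : box_indic l (c, x) = \1_(box (x.1 - l.1, x.2 - l.2) l) c.
Proof.
rewrite box_indicE !indicE; congr (nat_of_bool _)%:R.
by apply/idP/idP; rewrite !inE => -[] /=; rewrite !in_itv /= => /andP[a b] /andP[d e];
  split; rewrite /= in_itv /=; apply/andP; split; lra.
Qed.

Lemma integral_box_indic l x : 0 <= l.1 -> 0 <= l.2 ->
  (\int[leb]_c (box_indic l (c, x))%:E = (l.1 * l.2)%:E)%E.
Proof.
move=> l1 l2; under eq_integral do rewrite box_indic_sym.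
rewrite (integral_indic leb measurableT (measurable_box _ l)) setIT.
exact: leb2_box.
Qed.

(** Tonelli's theorem: a point is counted with the area of the set of corners whose cell contains
    it, and this set is a box of the same size. Letting the corner range over the whole plane makes
    the average exact. *)
Lemma integral_cells l (U : set (plane R)) (g : plane R -> R) : 0 <= l.1 -> 0 <= l.2 ->
  measurable U -> measurable_fun setT g -> (forall x, 0 <= g x) ->
  measurable_fun setT (fun c : plane R => \int[leb]_(x in U `&` box c l) (g x)%:E)%E /\
  (\int[leb]_c \int[leb]_(x in U `&` box c l) (g x)%:E = (l.1 * l.2)%:E * \int[leb]_(x in U) (g x)%:E)%E.
Proof.
move=> l1 l2 mU mg g0.
pose h (z : plane R * plane R) : \bar R := (g z.2 * \1_U z.2 * box_indic l z)%:E.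
have mh : measurable_fun setT h.
  apply/measurable_EFinP; apply: measurable_funM; last exact: measurable_box_indic.
  apply: measurable_funM; first exact: (measurableT_comp mg measurable_snd).
  exact: (measurableT_comp (measurable_indic mU) measurable_snd).
have bi0 z : 0 <= box_indic l z by rewrite mulr_ge0.
have h0 z : (0 <= h z)%E by rewrite lee_fin mulr_ge0// mulr_ge0.
have e c : (\int[leb]_(x in U `&` box c l) (g x)%:E = \int[@sleb2 R]_x h (c, x))%E.
  rewrite -integral_sleb2 integral_mkcond; apply: eq_integral => x _.
  rewrite /patch /h /= box_indicE !indicE in_setI.
  by case: (x \in U); case: (x \in box c l) => /=; rewrite ?(mulr0, mulr1, mul0r).
have eF : (fun c : plane R => \int[leb]_(x in U `&` box c l) (g x)%:E)%E =
    (fun c => \int[@sleb2 R]_x h (c, x))%E by apply/funext.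
split; first by rewrite eF; exact: (measurable_fun_fubini_tonelli_F h mh h0).
transitivity (\int[@sleb2 R]_c \int[@sleb2 R]_x h (c, x))%E.
  by rewrite integral_sleb2; congr (integral _ _ _); exact: eF.
rewrite (fubini_tonelli h mh h0).
have i x : (\int[@sleb2 R]_c h (c, x) = (l.1 * l.2)%:E * (g x * \1_U x)%:E)%E.
  rewrite -(integral_box_indic x l1 l2) integral_sleb2 muleC -ge0_integralZl.
  - by apply: eq_integral => c _; rewrite /h /= -EFinM.
  - exact: measurableT.
  - apply/measurable_EFinP.
    have -> : (fun c : plane R => box_indic l (c, x)) = \1_(box (x.1 - l.1, x.2 - l.2) l).
      by apply/funext => c; exact: box_indic_sym.
    exact: (measurable_indic (measurable_box _ l)).
  - by move=> c _; rewrite lee_fin.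
  - by rewrite lee_fin mulr_ge0.
transitivity (\int[@sleb2 R]_x ((l.1 * l.2)%:E * (g x * \1_U x)%:E))%E.
  by apply: eq_integral => x _; exact: i.
rewrite ge0_integralZl.
- congr (_ * _)%E; rewrite -integral_sleb2 [RHS]integral_mkcond; apply: eq_integral => x _.
  rewrite /patch indicE.
  by case: (x \in U) => /=; rewrite ?(mulr0, mulr1).
- exact: measurableT.
- apply/measurable_EFinP; apply: measurable_funM; [exact: mg|exact: measurable_indic].
- by move=> x _; rewrite lee_fin mulr_ge0.
- by rewrite lee_fin mulr_ge0.
Qed.

Variables (B t : R).
Hypothesis B0 : 0 < B.
Hypothesis t0 : 0 < t.
Local Notation al := (hal B t).
Local Notation am := (ham B t).

Lemma integral_local_mass (g : plane R -> R[i]) : csqint leb g ->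
  measurable_fun setT (fun c : plane R => local_mass B t c g) /\
  (\int[leb]_c local_mass B t c g <= (2 * rip leb g g)%:E)%E.
Proof.
move=> cg; have [[m1 _] [m2 _]] := cg.
have am0 := ham_gt0 B0 t0; have al0 := hal_gt0 B0 t0.
have a2 : 0 < al / 2 by rewrite divr_gt0.
pose h (z : plane R * plane R) : \bar R := (spread B t (z.1 : R * R) (z.2 : R * R) * rdot (g z.2) (g z.2))%:E.
have mr : measurable_fun setT (fun y : plane R => rdot (g y) (g y)).
  exact: (measurable_funD (measurable_funM m1 m1) (measurable_funM m2 m2)).
have ms : measurable_fun setT (fun z : plane R * plane R => spread B t (z.1 : R * R) (z.2 : R * R)).
  apply: measurable_funM; first exact: measurable_cst.
  apply: measurableT_comp; first exact: measurable_expR.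
  by apply: measurable_funM; [exact: measurable_cst|exact: measurable_sqdist2].
have mh : measurable_fun setT h.
  apply/measurable_EFinP; apply: measurable_funM; first exact: ms.
  exact: (measurableT_comp mr measurable_snd).
have r0 y : 0 <= rdot (g y) (g y) by rewrite /rdot addr_ge0// -expr2 sqr_ge0.
have s0 c y : 0 <= spread B t c y by rewrite mulr_ge0 ?expR_ge0// ltW.
have h0 z : (0 <= h z)%E by rewrite lee_fin mulr_ge0.
have eF : (fun c : plane R => local_mass B t c g) = (fun c => \int[@sleb2 R]_x h (c, x))%E by [].
split; first by rewrite eF; exact: (measurable_fun_fubini_tonelli_F h mh h0).
have -> : (\int[leb]_c local_mass B t c g = \int[@sleb2 R]_c \int[@sleb2 R]_x h (c, x))%E by [].
rewrite (fubini_tonelli h mh h0).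
have i y : (\int[@sleb2 R]_c h (c, y) = (am * (pi / (al / 2)))%:E * (rdot (g y) (g y))%:E)%E.
  have -> : ((am * (pi / (al / 2)))%:E = \int[leb]_c (spread B t y c)%:E)%E.
    rewrite EFinM -(integral_gauss2 y a2) -ge0_integralZl.
    - by apply: eq_integral => c _; rewrite -EFinM.
    - exact: measurableT.
    - by have /integrableP[] := gauss_integrable y a2.
    - by move=> c _; rewrite lee_fin expR_ge0.
    - by rewrite lee_fin ltW.
  rewrite integral_sleb2 muleC -ge0_integralZl.
  - apply: eq_integral => c _; rewrite /h /= -EFinM mulrC /spread.
    by congr (_ * (_ * expR (_ * _)))%:E; rewrite /sqdist; ring.
  - exact: measurableT.
  - by have /integrableP[] := integrableZl measurableT am (gauss_integrable y a2).
  - by move=> c _; rewrite lee_fin.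
  - by rewrite lee_fin.
have -> : (\int[@sleb2 R]_y \int[@sleb2 R]_c h (c, y) = (am * (pi / (al / 2)))%:E * (rip leb g g)%:E)%E.
  rewrite -(rip_EFin cg cg) integral_sleb2 -ge0_integralZl.
  - by apply: eq_integral => y _; exact: i.
  - exact: measurableT.
  - exact/measurable_EFinP.
  - by move=> y _; rewrite lee_fin.
  - by rewrite lee_fin mulr_ge0// ?(ltW am0)// divr_ge0 ?pi_ge0// ltW.
rewrite -EFinM lee_fin ler_wpM2r ?rip_ge0//.
(* Halving the Gaussian exponent doubles the mass in the plane. *)
have -> : am * (pi / (al / 2)) = 2 * (am * pi / al).
  by move: (hal B t) al0 (ham B t) (@pi R) => a a0 b p; field; rewrite gt_eqF.
by have := ham_hal_le1 B0 t0; lra.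
Qed.

Variables (fk : nat -> plane R -> R[i]) (E N0 : R).
Hypothesis E0 : 0 < E.
Hypothesis lfk : forall k, landau B (fk k) (fk k.+1).
Hypothesis nfk : forall k, rip leb (fk k) (fk k) <= (E ^+ k) ^+ 2 * N0.

Let cfk k : csqint leb (fk k). Proof. by have [] := landauP (lfk k). Qed.

Lemma integral_total_mass :
  measurable_fun setT (fun c : plane R => total_mass B t fk E c) /\
  (\int[leb]_c total_mass B t fk E c <= (2 * expR (E * t) * N0)%:E)%E.
Proof.
have wt0 k : 0 <= exp_coeff t k / E ^+ k.
  by rewrite divr_ge0 ?exp_coeff_ge0 ?exprn_ge0// ltW.
have mk k : measurable_fun setT (fun c : plane R => (exp_coeff t k / E ^+ k)%:E * local_mass B t c (fk k))%E.
  by apply: measurable_funeM; exact: (integral_local_mass (cfk k)).1.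
have k0 k (c : plane R) : (0 <= (exp_coeff t k / E ^+ k)%:E * local_mass B t c (fk k))%E.
  by apply: mule_ge0; [rewrite lee_fin; exact: wt0|exact: local_mass_ge0].
split; first by apply: ge0_emeasurable_sum => // k x _ _; exact: k0.
rewrite /total_mass (integral_nneseries leb measurableT); [|by move=> n; exact: mk|by move=> n x _; exact: k0].
have N00 : 0 <= N0.
  by have := nfk 0%N; rewrite expr0 expr1n mul1r; apply: le_trans; exact: rip_ge0.
have le1 k : (\int[leb]_c ((exp_coeff t k / E ^+ k)%:E * local_mass B t c (fk k)) <=
    (2 * N0 * exp_coeff (E * t) k)%:E)%E.
  rewrite ge0_integralZl.
  - apply: (@le_trans _ _ ((exp_coeff t k / E ^+ k)%:E * (2 * rip leb (fk k) (fk k))%:E)%E).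
      by rewrite lee_wpmul2l ?lee_fin//; exact: (integral_local_mass (cfk k)).2.
    rewrite -EFinM lee_fin; apply: (@le_trans _ _ (exp_coeff t k / E ^+ k * (2 * ((E ^+ k) ^+ 2 * N0)))).
      by rewrite ler_wpM2l// ler_pM2l.
    apply: eq_ler; rewrite /exp_coeff /= exprMn.
    have e0 : E ^+ k != 0 by rewrite gt_eqF// exprn_gt0.
    by move: (E ^+ k) e0 (t ^+ k) (k`!%:R^-1) => a a0 b d; field.
  - exact: measurableT.
  - exact: (integral_local_mass (cfk k)).1.
  - by move=> c _; exact: local_mass_ge0.
  - by rewrite lee_fin.
apply: (@le_trans _ _ (\sum_(0 <= k <oo) (2 * N0 * exp_coeff (E * t) k)%:E)%E).
  apply: lee_nneseries => k _; last exact: le1.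
  by move=> _; apply: integral_ge0 => c _; exact: k0.
have Et0 : 0 <= E * t by rewrite mulr_ge0// ltW.
apply: lime_le.
  by apply: is_cvg_nneseries => n _ _; rewrite lee_fin; apply: mulr_ge0; [exact: mulr_ge0|exact: exp_coeff_ge0].
apply: nearW => n; rewrite sumEFin lee_fin -mulr_sumr.
have -> : 2 * expR (E * t) * N0 = 2 * N0 * expR (E * t) by ring.
by rewrite ler_wpM2l ?mulr_ge0//; exact: series_exp_coeff_le.
Qed.

End AveragingCells.

(** * Absorption of the error *)

Section GlobalEstimate.
Variables (R : realType) (B t : R).
Hypothesis B0 : 0 < B.
Hypothesis t0 : 0 < t.
Local Notation leb := (leb2 R).
Variables (fk : nat -> plane R -> R[i]) (E : R).
Hypothesis E0 : 0 < E.
Hypothesis lfk : forall k, landau B (fk k) (fk k.+1).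
Hypothesis nfk : forall k, rip leb (fk k) (fk k) <= (E ^+ k) ^+ 2 * rip leb (fk 0%N) (fk 0%N).
Variables (l : R * R) (rho : R) (S : set (plane R)).
Hypothesis hS : thick l rho S.
Local Notation ext := (extension_sqr B t fk).
Local Notation f := (fk 0%N).

Let cf : csqint leb f. Proof. by have [] := landauP (lfk 0%N). Qed.

Lemma integral_extension_sqr (U : set (plane R)) : measurable U ->
  (\int[leb]_(x in U) (ext x)%:E = \int[leb]_(x in U) (rdot (f x) (f x))%:E)%E.
Proof.
move=> mU; have [[m1 _] [m2 _]] := cf.
apply: ae_eq_integral.
- exact: mU.
- by apply/measurable_EFinP; apply: measurable_funS (measurable_extension_sqr B0 t0 E0 lfk nfk).
- apply/measurable_EFinP; apply: measurable_funS (measurable_funD (measurable_funM m1 m1) (measurable_funM m2 m2)) => //.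
have := heat_extension_ae_sqr B0 E0 t0 lfk nfk.
by apply: (@filterS _ _ (ae_filter_ringOfSetsType leb)) => x /= h _; congr EFin.
Qed.

Lemma half_absorb (n a b : R) : n <= b + a -> a <= n / 2 -> n <= 2 * b.
Proof. lra. Qed.

Lemma global_estimate (lam : R) (D M : nat) :
  16 * D.+1%:R <= M%:R * rho -> 0 < lam ->
  4 * error_const B t E l (expR (3 * M%:R)) lam D * expR (E * t) <= 1 ->
  ((rip leb f f)%:E <= (2 * main_const B t l rho (expR (3 * M%:R)) * (l.1 * l.2))%:E *
     \int[leb]_(x in S) (rdot (f x) (f x))%:E)%E.
Proof.
move=> hM lam0 small; have [mS [l1 l2] /andP[rho0 rho1] _] := hS.
set K1 := main_const _ _ _ _ _; set K2 := error_const _ _ _ _ _ _ _ in small.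
have K10 : 0 < K1 by apply: (main_const_gt0 B t hS); exact: expR_gt0.
have K20 : 0 < K2 by apply: (error_const_gt0 B t E hS D); [exact: expR_gt0|exact: lam0].
have ll0 : 0 < l.1 * l.2 by rewrite mulr_gt0.
have mext := measurable_extension_sqr B0 t0 E0 lfk nfk.
have ext0 := extension_sqr_ge0 B t fk.
have [mL iL] := integral_cells (ltW l1) (ltW l2) measurableT mext ext0.
have [mX iX] := integral_cells (ltW l1) (ltW l2) mS mext ext0.
have [mT iT] := integral_total_mass B0 t0 E0 lfk nfk.
set X := (fun c : plane R => \int[leb]_(x in S `&` box c l) (ext x)%:E)%E in mX iX.
have X0 c : (0 <= X c)%E by apply: integral_ge0 => x _; rewrite lee_fin.
have T0 c := @total_mass_ge0 _ B t B0 t0 fk E E0 c.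
have s1 : ((l.1 * l.2)%:E * \int[leb]_x (ext x)%:E <=
    ((K1%:E * ((l.1 * l.2)%:E * \int[leb]_(x in S) (ext x)%:E) + K2%:E * (2 * expR (E * t) * rip leb f f)%:E)) * (l.1 * l.2)%:E)%E.
  rewrite -iL -iX.
  have mKX : measurable_fun setT (fun c : plane R => (K1%:E * X c)%E) by exact: measurable_funeM.
  have mKT : measurable_fun setT (fun c : plane R => (K2%:E * total_mass B t fk E c)%E) by exact: measurable_funeM.
  have KX0 c : (0 <= K1%:E * X c)%E by rewrite mule_ge0// lee_fin ltW.
  have KT0 c : (0 <= K2%:E * total_mass B t fk E c)%E by rewrite mule_ge0// lee_fin ltW.
  have le1 : (\int[leb]_c \int[leb]_(x in setT `&` box c l) (ext x)%:E <=
      \int[leb]_c ((K1%:E * X c + K2%:E * total_mass B t fk E c) * (l.1 * l.2)%:E))%E.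
    apply: ge0_le_integral; [exact: measurableT| |exact: mL| |].
    - by move=> c _; apply: integral_ge0 => x _; rewrite lee_fin.
    - under eq_fun do rewrite muleC.
      by apply: measurable_funeM; exact: emeasurable_funD.
    - by move=> c _; rewrite setTI; exact: (cell_integral_bound B0 t0 E0 lfk nfk hS c hM lam0).
  apply: (le_trans le1).
  under eq_integral do rewrite muleC.
  rewrite ge0_integralZl; [|exact: measurableT|exact: emeasurable_funD|by move=> c _; exact: adde_ge0|by rewrite lee_fin ltW].
  rewrite muleC; apply: lee_wpmul2r; first by rewrite lee_fin ltW.
  rewrite ge0_integralD; [|exact: measurableT|by move=> c _; exact: KX0|exact: mKX|by move=> c _; exact: KT0|exact: mKT].
  apply: leeD.
    rewrite ge0_integralZl; [exact: lexx|exact: measurableT|exact: mX|by move=> c _; exact: X0|by rewrite lee_fin ltW].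
  rewrite ge0_integralZl; [|exact: measurableT|exact: mT|by move=> c _; exact: T0|by rewrite lee_fin ltW].
  by apply: lee_wpmul2l; [rewrite lee_fin ltW|exact: iT].
move: s1; rewrite (integral_extension_sqr measurableT) (integral_extension_sqr mS) (rip_EFin cf cf).
have Y0 : (0 <= \int[leb]_(x in S) (rdot (f x) (f x))%:E)%E.
  by apply: integral_ge0 => x _; rewrite lee_fin /rdot addr_ge0// -expr2 sqr_ge0.
case: (integral _ _ _) Y0 => [y| |] // y0; last first.
  move=> _; rewrite gt0_muley ?leey// lte_fin.
  by apply: mulr_gt0 => //; exact: mulr_gt0.
move=> h0; have h1 : l.1 * l.2 * rip leb f f <=
   (K1 * (l.1 * l.2 * y) + K2 * (2 * expR (E * t) * rip leb f f)) * (l.1 * l.2) := h0.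
move: h1; rewrite [leLHS]mulrC ler_pM2r// => h.
rewrite -EFinM lee_fin.
have N00 := rip_ge0 leb f.
(* The 4 in the smallness assumption is the 2 of [integral_total_mass] times the 2 that leaves half
   of the squared norm on the left. *)
have : K2 * (2 * expR (E * t) * rip leb f f) <= rip leb f f / 2.
  have -> : K2 * (2 * expR (E * t) * rip leb f f) = (4 * K2 * expR (E * t)) * (rip leb f f / 2) by field.
  by rewrite ler_piMl// divr_ge0.
have -> : 2 * K1 * (l.1 * l.2) * y = 2 * (K1 * (l.1 * l.2 * y)) by ring.
exact: half_absorb h.
Qed.

End GlobalEstimate.

(** * Numerical inequalities for the constants *)

Section Constants.
Variable R : realType.

Lemma expR1_ge2 : 2 <= expR 1 :> R.
Proof. by have := expR_ge1Dx (1 : R); lra. Qed.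

(** One factor [a] of the power is kept as a prefactor; the remaining exponent x - 1 >= W - 1 is
    turned into an exponential by ln a >= 1. *)
Lemma powR_ge_expR (a x W : R) : 1 <= W -> expR 1 <= a -> W <= x -> a * expR (W - 1) <= a `^ x.
Proof.
move=> W1 ea Wx; have a0 : 0 < a by apply: lt_le_trans ea; exact: expR_gt0.
rewrite /powR gt_eqF//.
have la : 1 <= ln a by rewrite -(expRK (1 : R)) ler_ln ?posrE ?expR_gt0.
rewrite -{1}[a]lnK ?posrE// -expRD ler_expR.
have -> : x * ln a = ln a + (x - 1) * ln a by ring.
rewrite lerD2l; apply: (@le_trans _ _ (x - 1)); first by rewrite lerD2r.
by rewrite ler_peMr// subr_ge0 (le_trans W1).
Qed.

(* The exponent 12 mu + 1 lets the power D beat the Lebesgue constants exp(3 M),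
   and the 7 absorbs the remaining numerical factors. *)
Lemma error_absorbed (al a H mu r Lam : R) (D M : nat) :
  0 <= a -> 1 <= r -> al <= a * r -> (1 <= D)%N -> 0 <= mu -> M%:R <= mu * D.+1%:R ->
  (a * H ^+ 2 + 7) * r <= D%:R -> Lam = expR (3 * M%:R) ->
  4 * (16 * (Lam + 1) ^+ 2 * (2 * (1 + Lam) * expR (al * H ^+ 2) / expR (12 * mu + 1) ^+ D) ^+ 2 * expR r) * expR r <= 1.
Proof.
move=> a0 r1 hal D1 mu0 hM hD ->.
have D1' : 1 <= D%:R :> R by rewrite ler1n.
have MD : M%:R <= 2 * mu * D%:R.
  apply: (le_trans hM); rewrite -natr1; have := ler_wpM2l mu0 D1'.
  by rewrite mulr1; lra.
set e := expR (3 * M%:R).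
have e1 : 1 <= e by rewrite -expR0 ler_expR mulr_ge0.
have e2 : 1 + e <= expR (6 * mu * D%:R + 1).
  rewrite expRD mulrC; apply: (@le_trans _ _ (2 * e)); first by lra.
  apply: ler_pM => //; [by rewrite expR_ge0|exact: expR1_ge2|].
  by rewrite /e ler_expR; lra.
rewrite -expRM_natr.
have -> : 4 * (16 * (e + 1) ^+ 2 * (2 * (1 + e) * expR (al * H ^+ 2) / expR ((12 * mu + 1) * D%:R)) ^+ 2 * expR r) * expR r =
  256 * (1 + e) ^+ 4 * (expR (al * H ^+ 2) / expR ((12 * mu + 1) * D%:R) * expR r) ^+ 2.
  by move: (_^-1) (expR (al * H ^+ 2)) (expR r) => u v w; ring.
have e4 : (1 + e) ^+ 4 <= expR (4 * (6 * mu * D%:R + 1)).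
  by rewrite [4 * _]mulrC expRM_natr lerXn2r ?nnegrE ?expR_ge0//; lra.
have e256 : 256 <= expR 8 :> R.
  have -> : (8 : R) = 1 * 8%:R by rewrite mul1r.
  rewrite expRM_natr; have -> : (256 : R) = 2 ^+ 8 by ring.
  by rewrite lerXn2r ?nnegrE ?expR_ge0// expR1_ge2.
rewrite -expRN -!expRD -expRM_natr.
apply: (@le_trans _ _ (expR 8 * expR (4 * (6 * mu * D%:R + 1)) * expR ((al * H ^+ 2 - (12 * mu + 1) * D%:R + r) * 2%:R))).
  apply: ler_wpM2r; first exact: expR_ge0.
  by apply: ler_pM => //; rewrite exprn_ge0// addr_ge0// (le_trans ler01 e1).
rewrite -!expRD expR_le1.
(* The terms 24 mu D cancel and the exponent is at most 12 + 2 a r H^2 + 2 r - 2 D, with 12 = 8 + 4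
   from the two numerical factors. The lower bound on D makes it at most 12 - 12 r, and r >= 1. *)
have : al * H ^+ 2 <= a * r * H ^+ 2 by rewrite ler_wpM2r ?sqr_ge0.
by lra.
Qed.

End Constants.

(** * The choice of the scale *)

Section EnergyScale.
Variables (R : realType) (B : R).
Hypothesis B0 : 0 < B.
Variables (l : R * R) (rho : R) (S : set (plane R)).
Hypothesis hS : thick l rho S.

(** Constants independent of E. With r = sqrt E >= 1 and t = 1 / r, [a * r] bounds [hal B t],
    [mu * D.+1%:R] bounds the number M of bins, [lam] is the base prescribed by [error_absorbed],
    [H] is the quantity squared in the exponent of [cell_error], and D is taken just above
    [kap * r]. *)
Let a : R := (1 + 2 * B) / 4.
Let mu : R := 16 / rho + 1.
Let lam : R := expR (12 * mu + 1).
Let H : R := 2 * (lam + 2) * (l.1 + l.2).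
Let kap : R := a * H ^+ 2 + 7.

(** The fourth power of the Lebesgue constant exp(3 M) gives 12 M, with M <= mu (kap + 2) sqrt E;
    the last term bounds the Gaussian factor of [main_const]. *)
Definition growth_rate : R := 12 * mu * (kap + 2) + 2 * a * (l.1 ^+ 2 + l.2 ^+ 2).

Let a0 : 0 < a. Proof. by rewrite divr_gt0// addr_gt0// mulr_gt0. Qed.
Let mu0 : 0 < mu.
Proof. by have [_ _ /andP[r0 _] _] := hS; rewrite addr_gt0// divr_gt0. Qed.
Let kap0 : 0 < kap. Proof. by rewrite /kap ltr_wpDl// mulr_ge0 ?sqr_ge0// ltW. Qed.

Lemma growth_rate_gt0 : 0 < growth_rate.
Proof.
rewrite /growth_rate ltr_pwDl//; first by rewrite mulr_gt0 ?mulr_gt0// addr_gt0.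
by rewrite mulr_ge0 ?addr_ge0 ?sqr_ge0// mulr_ge0// ltW.
Qed.

Lemma thick_estimate_iterates (fk : nat -> plane R -> R[i]) (E : R) : 1 <= E ->
  (forall k, landau B (fk k) (fk k.+1)) ->
  (forall k, rip (leb2 R) (fk k) (fk k) <= (E ^+ k) ^+ 2 * rip (leb2 R) (fk 0%N) (fk 0%N)) ->
  ((rip (leb2 R) (fk 0%N) (fk 0%N))%:E <=
   (16 / rho * expR (growth_rate * Num.sqrt E))%:E *
   \int[leb2 R]_(x in S) (rdot (fk 0%N x) (fk 0%N x))%:E)%E.
Proof.
move=> E1 lfk nfk; have [mS [l1 l2] /andP[rho0 rho1] _] := hS.
have E0 : 0 < E by apply: lt_le_trans E1.
set r := Num.sqrt E; have r1 : 1 <= r by rewrite -sqrtr1 ler_sqrt// ltW.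
have r0 : 0 < r by apply: lt_le_trans r1.
have rr : E = r * r by rewrite -expr2 sqr_sqrtr// ltW.
pose t := r^-1; have t0 : 0 < t by rewrite invr_gt0.
have t1 : t <= 1 by rewrite invf_le1.
have Et : E * t = r by rewrite rr /t mulfK// gt_eqF.
(* D lies just above kap r, as the absorption requires, and M just above 16 (D + 1) / rho, as the
   choice of nodes requires; each rounding costs at most 1. *)
pose D := (Num.truncn (kap * r)).+1; pose M := (Num.truncn (16 * D.+1%:R / rho)).+1.
have kr0 : 0 <= kap * r by rewrite mulr_ge0// ltW.
have Dr0 : 0 <= 16 * D.+1%:R / rho by rewrite divr_ge0 ?mulr_ge0// ltW.
have /andP[D1 D2] := truncn_itv kr0; have /andP[M1 M2] := truncn_itv Dr0.
have Dle : D%:R <= kap * r + 1 by rewrite /D -natr1 lerD2r.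
have Mle : M%:R <= mu * D.+1%:R.
  have -> : M%:R = (Num.truncn (16 * D.+1%:R / rho))%:R + 1 :> R by rewrite /M natr1.
  have -> : mu * D.+1%:R = 16 * D.+1%:R / rho + D.+1%:R.
    by rewrite /mu; move: (rho^-1) (D.+1%:R : R) => u v; ring.
  by rewrite lerD// ler1n.
have hM : 16 * D.+1%:R <= M%:R * rho by rewrite -ler_pdivrMr//; exact: ltW.
have lam0 : 0 < lam by exact: expR_gt0.
have hal_a : hal B t <= a * r.
  apply: (le_trans (hal_le B0 t0)).
  have -> : (1 + 2 * B * t) / (4 * t) = (1 + 2 * B * t) / 4 * r.
    by rewrite invfM [t^-1]invrK mulrA.
  have BB : 0 <= 2 * B by rewrite mulr_ge0// ltW.
  by rewrite ler_pM2r// ler_pM2r ?invr_gt0// lerD2l ler_piMr.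
have small : 4 * error_const B t E l (expR (3 * M%:R)) lam D * expR (E * t) <= 1.
  rewrite /error_const /cell_error Et.
  exact: (error_absorbed (ltW a0) r1 hal_a (ltn0Sn _) (ltW mu0) Mle (ltW D2) (erefl _)).
have Y0 : (0 <= \int[leb2 R]_(x in S) (rdot (fk 0%N x) (fk 0%N x))%:E)%E.
  by apply: integral_ge0 => x _; rewrite lee_fin /rdot addr_ge0// -expr2 sqr_ge0.
apply: (le_trans (global_estimate B0 t0 E0 lfk nfk hS hM lam0 small)).
apply: lee_wpmul2r => //; rewrite lee_fin /main_const.
have -> : 2 * (8 * expR (3 * M%:R) ^+ 4 * expR (2 * (hal B t * (l.1 ^+ 2 + l.2 ^+ 2))) / (rho * (l.1 * l.2))) * (l.1 * l.2) =
   16 / rho * (expR (3 * M%:R) ^+ 4 * expR (2 * (hal B t * (l.1 ^+ 2 + l.2 ^+ 2)))).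
  have : l.1 * l.2 != 0 by rewrite gt_eqF// mulr_gt0.
  move: (l.1 * l.2) (_ ^+ 4) (expR (2 * _)) => z u v z0; field.
  by rewrite z0 gt_eqF.
rewrite ler_pM2l ?divr_gt0// -expRM_natr -expRD ler_expR /growth_rate.
have DM : M%:R <= mu * (kap + 2) * r.
  apply: (le_trans Mle); rewrite -mulrA ler_pM2l// -natr1.
  have r2 : 2 * 1 <= 2 * r by rewrite ler_pM2l.
  apply: (@le_trans _ _ (kap * r + 1 + 1)); first by rewrite lerD2r.
  rewrite [leRHS]mulrDl -addrA lerD2l; apply: le_trans r2.
  by apply: eq_ler; ring.
have al1 : hal B t * (l.1 ^+ 2 + l.2 ^+ 2) <= a * r * (l.1 ^+ 2 + l.2 ^+ 2).
  by rewrite ler_wpM2r// addr_ge0 ?sqr_ge0.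
have -> : (12 * mu * (kap + 2) + 2 * a * (l.1 ^+ 2 + l.2 ^+ 2)) * r =
  12 * (mu * (kap + 2) * r) + 2 * (a * r * (l.1 ^+ 2 + l.2 ^+ 2)) by ring.
move: DM al1; move: (mu * _ * _) (a * r * _) (hal B t * _) (M%:R : R) => p q u m mp uq.
have -> : 3 * m * 4 = 12 * m by ring.
by rewrite lerD// ler_pM2l.
Qed.

End EnergyScale.

Theorem theorem3 (R : realType) (B : R) (hB : 0 < B)
    (l : R * R) (rho : R) (S : set (plane R)) (hS : thick l rho S) :
  exists C1 C2 C3 C4 : R,
    [/\ 0 < C1, 0 < C2, 0 < C3 & 0 < C4] /\
    forall E : R, 0 < E ->
    forall f : plane R -> complex R,
      spectral_range (landau B) `]-oo, E] f ->
      (L2sqnorm setT f <=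
       ((C1 / rho) `^ (C2 + C3 * norm1 l * Num.sqrt E
                       + C4 * (norm1 l ^+ 2 * B)))%:E * L2sqnorm S f)%E.
Proof.
have [_ [l1 l2] /andP[rho0 rho1] _] := hS.
have l0 : 0 < norm1 l by rewrite addr_gt0.
pose W := growth_rate B l rho; have W0 : 0 < W := growth_rate_gt0 hB hS.
(* The factor [expR 1] makes the base at least e, and 16 covers the prefactor 16 / rho. In C2 the 1
   pays for this prefactor and W for replacing E by max(E, 1); dividing W by [norm1 l] cancels the
   factor of C3. *)
exists (16 * expR 1), (1 + W), (W / norm1 l), 1; split.
  by split; [rewrite mulr_gt0// expR_gt0|rewrite addr_gt0|rewrite divr_gt0|exact: ltr01].
move=> E E0 f hf.
have [cf [s [s0 ls ns]]] := spectral_range_iterates E0 hf.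
(* The bounds on the iterates weaken as E grows, so an energy below 1 may be treated as 1, where the
   scale t = E^(-1/2) <= 1 is admissible. *)
pose E' := Num.max E 1.
have E'1 : 1 <= E' by rewrite le_max lexx orbT.
have ns' k : rip (leb2 R) (s k) (s k) <= (E' ^+ k) ^+ 2 * rip (leb2 R) (s 0%N) (s 0%N).
  rewrite s0; apply: (le_trans (ns k)); rewrite ler_wpM2r ?rip_ge0//.
  have E'0 : 0 <= E' by apply: le_trans E'1.
  have EE' : E <= E' by rewrite le_max lexx.
  by rewrite !lerXn2r ?nnegrE ?exprn_ge0// ltW.
have := thick_estimate_iterates hB hS E'1 ls ns'; rewrite s0.
rewrite (L2sqnorm_rip ((L2_csqint f).2 cf)) L2sqnormE => h.
apply: (le_trans h); apply: lee_wpmul2r.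
  by apply: integral_ge0 => x _; rewrite lee_fin /rdot addr_ge0// -expr2 sqr_ge0.
rewrite lee_fin -/W.
have rE : Num.sqrt E' <= 1 + Num.sqrt E.
  rewrite /E'; have [_|_] := leP E 1; first by rewrite sqrtr1 lerDl sqrtr_ge0.
  by rewrite lerDr.
have WE0 : 0 <= W * Num.sqrt E' by rewrite mulr_ge0 ?sqrtr_ge0// ltW.
have c0 : 1 <= 1 + W * Num.sqrt E' by rewrite lerDl.
have e1 : expR 1 <= 16 * expR 1 / rho.
  rewrite ler_pdivlMr//; have := expR_gt0 (1 : R); move: (expR 1) => e e0.
  by apply: (@le_trans _ _ e); [rewrite ler_piMr// ltW|lra].
(* By sqrt E' <= 1 + sqrt E the exponent needed is covered by C2 and C3, and the nonnegative term
   with B is added on top. *)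
have cX : 1 + W * Num.sqrt E' <=
    1 + W + W / norm1 l * norm1 l * Num.sqrt E + 1 * (norm1 l ^+ 2 * B).
  rewrite divfK ?gt_eqF// -2!addrA lerD2l addrA mul1r.
  have -> : W + W * Num.sqrt E = W * (1 + Num.sqrt E) by ring.
  apply: (le_trans (ler_wpM2l (ltW W0) rE)).
  by rewrite lerDl mulr_ge0 ?sqr_ge0// ltW.
apply: le_trans (powR_ge_expR c0 e1 cX).
rewrite [1 + _]addrC addrK ler_wpM2r ?expR_ge0//.
rewrite ler_pM2r ?invr_gt0// ler_peMr//.
by have := expR1_ge2 R; lra.
Qed.
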